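(* Let $\mathcal{C}$ be a unitary fusion category and let $\mathcal{M}$ be an indecomposable, unitary, finitely semisimple, invertible $(\mathcal{C},\mathcal{C}^*_{\mathcal{M}})$-bimodule category, where $\mathcal{C}^*_{\mathcal{M}}$ is the dual category of $\mathcal{C}$ with respect to $\mathcal{M}$. Let $F^{\bowtie}$ be its bimodule associator $F$-symbols and $F_{\bowtie}$ the inverse symbols. Let $c,c'$ be simple objects of $\mathcal{C}^*_{\mathcal{M}}$. Then for all $b,d,e,f\in\operatorname{Irr}\mathcal{M}$ and all basis vectors $\beta\in\mathcal{M}(e\triangleleft c,d)$, $\beta'\in\mathcal{M}(e\triangleleft c',d)$, $\mu\in\mathcal{M}(b\triangleleft c,f)$, $\mu'\in\mathcal{M}(b\triangleleft c',f)$, $$\sum_{a\in\operatorname{Irr}\mathcal{C}}\ \sum_{\alpha,\nu}d_a\,\bigl[F^{\bowtie}{}_{abc}^{d}\bigr]_{(\alpha,e,\beta),(\mu,f,\nu)}\,\bigl[F_{\bowtie}{}_{abc'}^{d}\bigr]_{(\alpha,e,\beta'),(\mu',f,\nu)}=\delta_{c,c'}\,\delta_{\beta,\beta'}\,\delta_{\mu,\mu'}\,\frac{d_e\,d_f}{d_c},$$ where $\alpha$ runs over the chosen basis of $\mathcal{M}(a\triangleright b,e)$ and $\nu$ over the chosen basis of $\mathcal{M}(a\triangleright f,d)$.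
   Context: All categories are finite, $\mathbb{C}$-linear, semisimple and skeletal (each isomorphism class contains a single object). $\mathcal{A}(x,y)$ denotes the space of morphisms $x\to y$ in $\mathcal{A}$ and $\operatorname{Irr}\mathcal{A}$ the set of simple objects. A fusion category is a finitely semisimple rigid tensor category with simple unit; unitary means a unitary tensor category with its canonical spherical structure. $d_a$ is the Frobenius-Perron dimension of an object $a$ of a fusion category $\mathcal{A}$, and $\operatorname{FPdim}\mathcal{A}=\sum_{a\in\operatorname{Irr}\mathcal{A}}d_a^2$. A $(\mathcal{C},\mathcal{D})$-bimodule category is simultaneously a left $\mathcal{C}$-module category (action $\triangleright$) and a right $\mathcal{D}$-module category (action $\triangleleft$) with a coherent natural isomorphism $(-\triangleright-)\triangleleft-\simeq-\triangleright(-\triangleleft-)$ (the bimodule associator); it is unitary if it has a $C^*$-structure compatible with those of $\mathcal{C}$ and $\mathcal{D}$. It is invertible if there are bimodule equivalences $\mathcal{M}\boxtimes_{\mathcal{D}}\mathcal{M}^{\mathrm{op}}\cong\mathcal{C}$ and $\mathcal{M}^{\mathrm{op}}\boxtimes_{\mathcal{C}}\mathcal{M}\cong\mathcal{D}$, where $\mathcal{M}^{\mathrm{op}}$ is the opposite $(\mathcal{D},\mathcal{C})$-bimodule category. The dual category $\mathcal{C}^*_{\mathcal{M}}$ is the fusion category of $\mathcal{C}$-module endofunctors of $\mathcal{M}$, acting on $\mathcal{M}$ from the right by evaluation (with tensor product ordered so that this is a right action); it is the unique fusion category extending the left $\mathcal{C}$-module category $\mathcal{M}$ to an invertible bimodule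 category. Dimensions in $\mathcal{M}$: $(d_m)_{m\in\operatorname{Irr}\mathcal{M}}$ is the unique positive solution of $d_a d_b=\sum_{c\in\operatorname{Irr}\mathcal{M}}\dim_{\mathbb{C}}\mathcal{M}(a\triangleright b,c)\,d_c$ for all $a\in\operatorname{Irr}\mathcal{C}$, $b\in\operatorname{Irr}\mathcal{M}$, normalized by $\sum_{m\in\operatorname{Irr}\mathcal{M}}d_m^2=\operatorname{FPdim}\mathcal{C}$. $F$-symbols: fix bases of all spaces $\mathcal{M}(a\triangleright b,e)$ and $\mathcal{M}(b\triangleleft c,f)$ for simple objects. For $a\in\operatorname{Irr}\mathcal{C}$, $b,d\in\operatorname{Irr}\mathcal{M}$, $c\in\operatorname{Irr}\mathcal{C}^*_{\mathcal{M}}$, $$\beta\circ(\alpha\triangleleft \mathrm{id}_c)=\sum_{\mu,f,\nu}[F^{\bowtie}{}_{abc}^{d}]_{(\alpha,e,\beta),(\mu,f,\nu)}\;\nu\circ(\mathrm{id}_a\triangleright\mu)$$ where $e,f\in\operatorname{Irr}\mathcal{M}$ and $\alpha,\beta,\mu,\nu$ are basis vectors of $\mathcal{M}(a\triangleright b,e)$, $\mathcal{M}(e\triangleleft c,d)$, $\mathcal{M}(b\triangleleft c,f)$, $\mathcal{M}(a\triangleright f,d)$ (identifying $(a\triangleright b)\triangleleft c$ with $a\triangleright(b\triangleleft c)$ via the bimodule associator). The inverse symbols $F_{\bowtie}$ are indexed in the same way and satisfy $\sum_{\mu,f,\nu}[F^{\bowtie}{}_{abc}^{d}]_{(\alpha,e,\beta),(\mu,f,\nu)}[F_{\bowtie}{}_{abc}^{d}]_{(\alpha',e',\beta'),(\mu,f,\nu)}=\delta_{\alpha\alpha'}\delta_{ee'}\delta_{\beta\beta'}$.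 The bases are chosen so that these $F$-matrices are unitary, i.e. $F_{\bowtie}$ is the entrywise complex conjugate of $F^{\bowtie}$. *)

(* Defs.v *)
From HB Require Import structures.
From mathcomp Require Import all_boot all_order all_algebra.
From mathcomp Require Import complex reals.

Set Implicit Arguments.
Unset Strict Implicit.
Unset Printing Implicit Defensive.

Import Order.TTheory GRing.Theory Num.Theory.
Local Open Scope ring_scope.
Local Open Scope complex_scope.

(* The ground field is R[i] with R : realType. Structure that has to be built
   on opposite categories (bifunctors, bimodule data) is separated into data
   and a predicate collecting the axioms. *)

Record lincat (R : realType) := LinCat {
  obj :> Type;
  hom : obj -> obj -> vectType R[i];
  idm : forall x, hom x x;
  cmp : forall x y z, hom y z -> hom x y -> hom x z;
  cmp1m : forall x y (f : hom x y), cmp (idm y) f = f;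
  cmpm1 : forall x y (f : hom x y), cmp f (idm x) = f;
  cmpA : forall x y z t (h : hom z t) (g : hom y z) (f : hom x y),
    cmp h (cmp g f) = cmp (cmp h g) f;
  cmp_linearl : forall x y z (k : R[i]) (g g' : hom y z) (f : hom x y),
    cmp (k *: g + g') f = k *: cmp g f + cmp g' f;
  cmp_linearr : forall x y z (k : R[i]) (g : hom y z) (f f' : hom x y),
    cmp g (k *: f + f') = k *: cmp g f + cmp g f' }.

Arguments hom {R l} x y.
Arguments idm {R l} x.
Arguments cmp {R l x y z} g f.

Notation "g \oc f" := (cmp g f) (at level 50, left associativity).

Notation hdim x y := (\dim (fullv : {vspace hom x y})).

Definition op_cat (R : realType) (A : lincat R) : lincat R :=
  @LinCat R A (fun x y => hom y x) (@idm R A)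
    (fun x y z g f => f \oc g)
    (fun x y f => cmpm1 f) (fun x y f => cmp1m f)
    (fun x y z t h g f => esym (cmpA f g h))
    (fun x y z k g g' f => cmp_linearr k f g g')
    (fun x y z k g f f' => cmp_linearl k f f' g).

(* A pair of morphisms in opposite directions, an isomorphism when it
   satisfies [is_inv]. *)
Record arr (R : realType) (A : lincat R) (x y : A) := Arr {
  fwd : hom x y;
  bwd : hom y x }.

Definition is_inv (R : realType) (A : lincat R) (x y : A) (u : arr x y) :=
  bwd u \oc fwd u = idm x /\ fwd u \oc bwd u = idm y.

Definition inv_arr (R : realType) (A : lincat R) (x y : A) (u : arr x y) :
  arr y x := Arr (bwd u) (fwd u).

Definition cmp_arr (R : realType) (A : lincat R) (x y z : A)
    (v : arr y z) (u : arr x y) : arr x z :=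
  Arr (fwd v \oc fwd u) (bwd u \oc bwd v).

Definition op_arr (R : realType) (A : lincat R) (x y : A) (u : arr y x) :
  @arr R (op_cat A) x y := @Arr R (op_cat A) x y (fwd u) (bwd u).

Definition isomorphic (R : realType) (A : lincat R) (x y : A) :=
  exists u : arr x y, is_inv u.

(* [x] is the direct sum of the family [s]; the zero object if [n = 0]. *)
Definition is_dsum (R : realType) (A : lincat R) (n : nat) (s : 'I_n -> A)
    (x : A) :=
  exists (i : forall k, hom (s k) x) (p : forall k, hom x (s k)),
    [/\ forall k, p k \oc i k = idm (s k),
        forall k l, k != l -> p l \oc i k = 0 &
        \sum_k (i k \oc p k) = idm x].

Definition is_zero (R : realType) (A : lincat R) (x : A) := idm x = 0.

(* Simple objects of a semisimple category over an algebraically closed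
   field: End(x) is one-dimensional. *)
Definition simple (R : realType) (A : lincat R) (x : A) :=
  hdim x x = 1%N.

Record fsscat (R : realType) := FssCat {
  fss_cat :> lincat R;
  skeletal : forall x y : fss_cat, isomorphic x y -> x = y;
  irr : finType;
  smp : irr -> fss_cat;
  smp_inj : injective smp;
  smpP : forall x : fss_cat, simple x <-> exists i, x = smp i;
  smp_disjoint : forall (i j : irr) (f : hom (smp i) (smp j)), i != j -> f = 0;
  has_dsums : forall (n : nat) (s : 'I_n -> fss_cat), exists x, is_dsum s x;
  semisimple : forall x : fss_cat,
    exists (n : nat) (s : 'I_n -> irr), is_dsum (fun k => smp (s k)) x }.

Arguments irr {R} _.
Arguments smp {R _} i.

Record functor (R : realType) (A E : lincat R) := Functor {
  fo :> A -> E;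
  fm : forall x y, hom x y -> hom (fo x) (fo y) }.

Arguments fm {R A E} _ {x y} _.

Definition functor_laws (R : realType) (A E : lincat R) (F : functor A E) :=
  [/\ forall x, fm F (idm x) = idm (F x),
      forall x y z (g : hom y z) (f : hom x y),
        fm F (g \oc f) = fm F g \oc fm F f &
      forall x y (k : R[i]) (f g : hom x y),
        fm F (k *: f + g) = k *: fm F f + fm F g].

Definition fm_arr (R : realType) (A E : lincat R) (F : functor A E)
    (x y : A) (u : arr x y) : arr (F x) (F y) :=
  Arr (fm F (fwd u)) (fm F (bwd u)).

Definition natural (R : realType) (A E : lincat R) (F G : functor A E)
    (eta : forall x, hom (F x) (G x)) :=
  forall x y (f : hom x y), eta y \oc fm F f = fm G f \oc eta x.

Record bifunctor (R : realType) (A B E : lincat R) := Bifunctor {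
  bo :> A -> B -> E;
  bm : forall x x' y y', hom x x' -> hom y y' -> hom (bo x y) (bo x' y') }.

Arguments bm {R A B E} _ {x x' y y'} _ _.

Record bifunctor_laws (R : realType) (A B E : lincat R)
    (F : bifunctor A B E) : Prop := BifunctorLaws {
  bm1 : forall x y, bm F (idm x) (idm y) = idm (F x y);
  bm_cmp : forall x x' x'' y y' y'' (f' : hom x' x'') (f : hom x x')
      (g' : hom y' y'') (g : hom y y'),
    bm F (f' \oc f) (g' \oc g) = bm F f' g' \oc bm F f g;
  bm_linearl : forall x x' y y' (k : R[i]) (f f' : hom x x') (g : hom y y'),
    bm F (k *: f + f') g = k *: bm F f g + bm F f' g;
  bm_linearr : forall x x' y y' (k : R[i]) (f : hom x x') (g g' : hom y y'),
    bm F f (k *: g + g') = k *: bm F f g + bm F f g' }.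

Definition bm_arr (R : realType) (A B E : lincat R) (F : bifunctor A B E)
    (x x' : A) (y y' : B) (u : arr x x') (v : arr y y') :
  arr (F x y) (F x' y') :=
  Arr (bm F (fwd u) (fwd v)) (bm F (bwd u) (bwd v)).

Definition id_arr (R : realType) (A : lincat R) (x : A) : arr x x :=
  Arr (idm x) (idm x).

(* [dual x] is the left dual, with evaluation x^* (x) x -> 1 and coevaluation
   1 -> x (x) x^*; right duals are only required to exist. *)
Record fuscat (R : realType) := FusCat {
  fus_cat :> fsscat R;
  tens : bifunctor fus_cat fus_cat fus_cat;
  one : fus_cat;
  asc : forall x y z, arr (tens (tens x y) z) (tens x (tens y z));
  lun : forall x, arr (tens one x) x;
  run : forall x, arr (tens x one) x;
  dual : fus_cat -> fus_cat;
  ev : forall x, hom (tens (dual x) x) one;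
  coev : forall x, hom one (tens x (dual x));
  tens_laws : bifunctor_laws tens;
  asc_inv : forall x y z, is_inv (asc x y z);
  lun_inv : forall x, is_inv (lun x);
  run_inv : forall x, is_inv (run x);
  asc_natural : forall x x' y y' z z' (f : hom x x') (g : hom y y')
      (h : hom z z'),
    fwd (asc x' y' z') \oc bm tens (bm tens f g) h
      = bm tens f (bm tens g h) \oc fwd (asc x y z);
  lun_natural : forall x x' (f : hom x x'),
    fwd (lun x') \oc bm tens (idm one) f = f \oc fwd (lun x);
  run_natural : forall x x' (f : hom x x'),
    fwd (run x') \oc bm tens f (idm one) = f \oc fwd (run x);
  pentagon : forall x y z t,
    fwd (asc x y (tens z t)) \oc fwd (asc (tens x y) z t)
      = bm tens (idm x) (fwd (asc y z t)) \oc fwd (asc x (tens y z) t)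
          \oc bm tens (fwd (asc x y z)) (idm t);
  triangle : forall x y,
    bm tens (idm x) (fwd (lun y)) \oc fwd (asc x one y)
      = bm tens (fwd (run x)) (idm y);
  zigzag : forall x,
    fwd (run x) \oc bm tens (idm x) (ev x) \oc fwd (asc x (dual x) x)
      \oc bm tens (coev x) (idm x) \oc bwd (lun x) = idm x;
  zigzag_dual : forall x,
    fwd (lun (dual x)) \oc bm tens (ev x) (idm (dual x))
      \oc bwd (asc (dual x) x (dual x)) \oc bm tens (idm (dual x)) (coev x)
      \oc bwd (run (dual x)) = idm (dual x);
  right_duals : forall x, exists (x' : fus_cat) (e : hom (tens x x') one)
      (c : hom one (tens x' x)),
    fwd (lun x) \oc bm tens e (idm x) \oc bwd (asc x x' x)
      \oc bm tens (idm x) c \oc bwd (run x) = idm x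
    /\
    fwd (run x') \oc bm tens (idm x') e \oc fwd (asc x' x x')
      \oc bm tens c (idm x') \oc bwd (lun x') = idm x';
  one_simple : simple one }.

Arguments tens {R} _.
Arguments one {R _}.
Arguments asc {R _} x y z.
Arguments lun {R _} x.
Arguments run {R _} x.
Arguments dual {R _} x.
Arguments ev {R _} x.
Arguments coev {R _} x.

Section Duality.
Variables (R : realType) (A : fuscat R).

Local Notation "x \ox y" := (tens A x y) (at level 40, left associativity).
Local Notation "f \om g" := (bm (tens A) f g) (at level 40, left associativity).

(* The morphism z -> w^* corresponding to a pairing z (x) w -> 1. *)
Definition mate (z w : A) (g : hom (z \ox w) one) : hom z (dual w) :=
  fwd (lun (dual w)) \oc (g \om idm (dual w)) \oc bwd (asc z w (dual w))
    \oc (idm z \om coev w) \oc bwd (run z).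

(* The morphism w^* -> z corresponding to a copairing 1 -> w (x) z. *)
Definition comate (w z : A) (h : hom one (w \ox z)) : hom (dual w) z :=
  fwd (lun z) \oc (ev w \om idm z) \oc bwd (asc (dual w) w z)
    \oc (idm (dual w) \om h) \oc bwd (run (dual w)).

Definition dual_mor (x y : A) (f : hom x y) : hom (dual y) (dual x) :=
  mate (ev y \oc (idm (dual y) \om f)).

Definition dual_tens (x y : A) : arr (dual y \ox dual x) (dual (x \ox y)) :=
  Arr
    (mate (ev y
       \oc (idm (dual y) \om (fwd (lun y) \oc (ev x \om idm y)
                                \oc bwd (asc (dual x) x y)))
       \oc fwd (asc (dual y) (dual x) (x \ox y))))
    (comate (fwd (asc (x \ox y) (dual y) (dual x))
       \oc ((bwd (asc x y (dual y)) \oc (idm x \om coev y) \oc bwd (run x))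
              \om idm (dual x))
       \oc coev x)).

Definition dual_one : arr one (dual (one : A)) :=
  Arr (mate (fwd (lun one))) (comate (bwd (lun one))).

End Duality.

Record bimod (R : realType) (C D : fuscat R) (M : lincat R) := Bimod {
  lact : bifunctor C M M;
  ract : bifunctor M D M;
  lasc : forall a a' m, arr (lact (tens C a a') m) (lact a (lact a' m));
  lunit : forall m, arr (lact one m) m;
  rasc : forall m c c', arr (ract (ract m c) c') (ract m (tens D c c'));
  runit : forall m, arr (ract m one) m;
  basc : forall a m c, arr (ract (lact a m) c) (lact a (ract m c)) }.

Arguments lact {R C D M} b.
Arguments ract {R C D M} b.
Arguments lasc {R C D M} b a a' m.
Arguments lunit {R C D M} b m.
Arguments rasc {R C D M} b m c c'.
Arguments runit {R C D M} b m.
Arguments basc {R C D M} b a m c.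

Section BimodLaws.
Variables (R : realType) (C D : fuscat R) (M : lincat R) (B : bimod C D M).

Local Notation "a |> m" := (lact B a m) (at level 40, no associativity).
Local Notation "m <| c" := (ract B m c) (at level 40, no associativity).
Local Notation "f |>m g" := (bm (lact B) f g) (at level 40, no associativity).
Local Notation "g <|m h" := (bm (ract B) g h) (at level 40, no associativity).

Record bimod_laws : Prop := BimodLaws {
  lact_laws : bifunctor_laws (lact B);
  ract_laws : bifunctor_laws (ract B);
  lasc_inv : forall a a' m, is_inv (lasc B a a' m);
  lunit_inv : forall m, is_inv (lunit B m);
  rasc_inv : forall m c c', is_inv (rasc B m c c');
  runit_inv : forall m, is_inv (runit B m);
  basc_inv : forall a m c, is_inv (basc B a m c);
  lasc_natural : forall a1 a2 a1' a2' m1 m2 (f : hom a1 a2)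
      (f' : hom a1' a2') (g : hom m1 m2),
    fwd (lasc B a2 a2' m2) \oc ((bm (tens C) f f') |>m g)
      = (f |>m (f' |>m g)) \oc fwd (lasc B a1 a1' m1);
  lunit_natural : forall m1 m2 (g : hom m1 m2),
    fwd (lunit B m2) \oc (idm one |>m g) = g \oc fwd (lunit B m1);
  rasc_natural : forall m1 m2 c1 c2 c1' c2' (g : hom m1 m2) (h : hom c1 c2)
      (h' : hom c1' c2'),
    fwd (rasc B m2 c2 c2') \oc ((g <|m h) <|m h')
      = (g <|m (bm (tens D) h h')) \oc fwd (rasc B m1 c1 c1');
  runit_natural : forall m1 m2 (g : hom m1 m2),
    fwd (runit B m2) \oc (g <|m idm one) = g \oc fwd (runit B m1);
  basc_natural : forall a1 a2 m1 m2 c1 c2 (f : hom a1 a2) (g : hom m1 m2)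
      (h : hom c1 c2),
    fwd (basc B a2 m2 c2) \oc ((f |>m g) <|m h)
      = (f |>m (g <|m h)) \oc fwd (basc B a1 m1 c1);
  lact_pentagon : forall a a' a'' m,
    fwd (lasc B a a' (a'' |> m)) \oc fwd (lasc B (tens C a a') a'' m)
      = (idm a |>m fwd (lasc B a' a'' m)) \oc fwd (lasc B a (tens C a' a'') m)
          \oc (fwd (asc a a' a'') |>m idm m);
  lact_triangle : forall a m,
    (idm a |>m fwd (lunit B m)) \oc fwd (lasc B a one m)
      = fwd (run a) |>m idm m;
  ract_pentagon : forall m c c' c'',
    fwd (rasc B m c (tens D c' c'')) \oc fwd (rasc B (m <| c) c' c'')
      = (idm m <|m fwd (asc c c' c'')) \oc fwd (rasc B m (tens D c c') c'')
          \oc (fwd (rasc B m c c') <|m idm c'');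
  ract_triangle : forall m c,
    (idm m <|m fwd (lun c)) \oc fwd (rasc B m one c)
      = fwd (runit B m) <|m idm c;
  basc_pentagonl : forall a a' m c,
    fwd (lasc B a a' (m <| c)) \oc fwd (basc B (tens C a a') m c)
      = (idm a |>m fwd (basc B a' m c)) \oc fwd (basc B a (a' |> m) c)
          \oc (fwd (lasc B a a' m) <|m idm c);
  basc_pentagonr : forall a m c c',
    fwd (basc B a m (tens D c c')) \oc fwd (rasc B (a |> m) c c')
      = (idm a |>m fwd (rasc B m c c')) \oc fwd (basc B a (m <| c) c')
          \oc (fwd (basc B a m c) <|m idm c');
  basc_trianglel : forall m c,
    fwd (lunit B (m <| c)) \oc fwd (basc B one m c)
      = fwd (lunit B m) <|m idm c;
  basc_triangler : forall a m,
    (idm a |>m fwd (runit B m)) \oc fwd (basc B a m one)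
      = fwd (runit B (a |> m)) }.

(* A decomposition of [M] as a direct sum of two sub-bimodule categories,
   given by the classes of objects [P 0] and [P 1]. *)
Definition bimod_decomposition (P : 'I_2 -> M -> Prop) :=
  [/\ forall k a m, P k m -> P k (a |> m),
      forall k c m, P k m -> P k (m <| c),
      forall k l m n (f : hom m n), k != l -> P k m -> P l n -> f = 0 &
      forall m, exists s : 'I_2 -> M, (forall k, P k (s k)) /\ is_dsum s m].

Definition indecomposable :=
  (exists m : M, ~ is_zero m) /\
  forall P, bimod_decomposition P ->
    exists k, forall m, P k m -> is_zero m.

End BimodLaws.

Definition reg_bimod (R : realType) (C : fuscat R) : bimod C C C :=
  @Bimod R C C C (tens C) (tens C) asc lun asc run asc.

(* The actions are d |> m = m <| d^* and m <| c = c^* |> m. Left duals are used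
   on both sides: in the unitary case the canonical pivotal structure makes
   the choice between left and right duals immaterial. *)
Definition op_bimod (R : realType) (C D : fuscat R) (M : lincat R)
    (B : bimod C D M) : bimod D C (op_cat M) :=
  @Bimod R D C (op_cat M)
    (@Bifunctor R D (op_cat M) (op_cat M)
       (fun d m => ract B m (dual d))
       (fun d d' m m' (f : hom d d') (g : @hom R M m' m) =>
          bm (ract B) g (dual_mor f)))
    (@Bifunctor R (op_cat M) C (op_cat M)
       (fun m c => lact B (dual c) m)
       (fun m m' c c' (g : @hom R M m' m) (f : hom c c') =>
          bm (lact B) (dual_mor f) g))
    (fun d d' m => op_arr
       (cmp_arr (bm_arr (ract B) (@id_arr R M m) (dual_tens d d'))
                (rasc B m (dual d') (dual d))))
    (fun m => op_arr
       (cmp_arr (bm_arr (ract B) (@id_arr R M m) (dual_one D))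
                (inv_arr (runit B m))))
    (fun m c c' => op_arr
       (cmp_arr (lasc B (dual c') (dual c) m)
                (bm_arr (lact B) (inv_arr (dual_tens c c')) (@id_arr R M m))))
    (fun m => op_arr
       (cmp_arr (bm_arr (lact B) (dual_one C) (@id_arr R M m))
                (inv_arr (lunit B m))))
    (fun d m c => op_arr (basc B (dual c) m (dual d))).

Section RelativeProduct.
Variables (R : realType) (A D B : fuscat R) (M N : lincat R).
Variables (BM : bimod A D M) (BN : bimod D B N).

Record balanced (E : lincat R) (F : bifunctor M N E)
    (bal : forall m d n, arr (F (ract BM m d) n) (F m (lact BN d n))) : Prop :=
  Balanced {
  balanced_functor : bifunctor_laws F;
  balanced_inv : forall m d n, is_inv (bal m d n);
  balanced_natural : forall m m' d d' n n' (f : hom m m') (h : hom d d')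
      (g : hom n n'),
    fwd (bal m' d' n') \oc bm F (bm (ract BM) f h) g
      = bm F f (bm (lact BN) h g) \oc fwd (bal m d n);
  balanced_pentagon : forall m d d' n,
    fwd (bal m d (lact BN d' n)) \oc fwd (bal (ract BM m d) d' n)
      = bm F (idm m) (fwd (lasc BN d d' n)) \oc fwd (bal m (tens D d d') n)
          \oc bm F (fwd (rasc BM m d d')) (idm n);
  balanced_triangle : forall m n,
    bm F (idm m) (fwd (lunit BN n)) \oc fwd (bal m one n)
      = bm F (fwd (runit BM m)) (idm n) }.

(* (P, F, bal) is the relative Deligne product of M and N over D: composition
   with F is, for every E, an equivalence from functors P -> E to balanced
   functors M x N -> E. *)
Definition is_relative_product (P : lincat R) (F : bifunctor M N P)
    (bal : forall m d n, arr (F (ract BM m d) n) (F m (lact BN d n))) :=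
  [/\ balanced bal,
      forall (E : fsscat R) (G : bifunctor M N E)
        (balG : forall m d n, arr (G (ract BM m d) n) (G m (lact BN d n))),
        balanced balG ->
        exists (H : functor P E) (th : forall m n, arr (H (F m n)) (G m n)),
          [/\ functor_laws H,
              forall m n, is_inv (th m n),
              forall m m' n n' (f : hom m m') (g : hom n n'),
                fwd (th m' n') \oc fm H (bm F f g)
                  = bm G f g \oc fwd (th m n) &
              forall m d n,
                fwd (th m (lact BN d n)) \oc fm H (fwd (bal m d n))
                  = fwd (balG m d n) \oc fwd (th (ract BM m d) n)] &
      forall (E : fsscat R) (H H' : functor P E)
        (th : forall m n, hom (H (F m n)) (H' (F m n))),
        functor_laws H -> functor_laws H' ->
        (forall m m' n n' (f : hom m m') (g : hom n n'),
           th m' n' \oc fm H (bm F f g) = fm H' (bm F f g) \oc th m n) ->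
        (forall m d n,
           th m (lact BN d n) \oc fm H (fwd (bal m d n))
             = fm H' (fwd (bal m d n)) \oc th (ract BM m d) n) ->
        (exists eta : forall p, hom (H p) (H' p),
           natural eta /\ forall m n, eta (F m n) = th m n) /\
        (forall eta eta' : forall p, hom (H p) (H' p),
           natural eta -> natural eta' ->
           (forall m n, eta (F m n) = eta' (F m n)) ->
           forall p, eta p = eta' p)].

Record balanced_bimod_functor (P : lincat R) (BP : bimod A B P)
    (F : bifunctor M N P)
    (bal : forall m d n, arr (F (ract BM m d) n) (F m (lact BN d n)))
    (ls : forall a m n, arr (F (lact BM a m) n) (lact BP a (F m n)))
    (rs : forall m n b, arr (F m (ract BN n b)) (ract BP (F m n) b)) : Prop :=
  BalancedBimodFunctor {
  bbf_balanced : balanced bal;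
  ls_inv : forall a m n, is_inv (ls a m n);
  rs_inv : forall m n b, is_inv (rs m n b);
  ls_natural : forall a a' m m' n n' (h : hom a a') (f : hom m m')
      (g : hom n n'),
    fwd (ls a' m' n') \oc bm F (bm (lact BM) h f) g
      = bm (lact BP) h (bm F f g) \oc fwd (ls a m n);
  rs_natural : forall m m' n n' b b' (f : hom m m') (g : hom n n')
      (h : hom b b'),
    fwd (rs m' n' b') \oc bm F f (bm (ract BN) g h)
      = bm (ract BP) (bm F f g) h \oc fwd (rs m n b);
  ls_pentagon : forall a a' m n,
    fwd (lasc BP a a' (F m n)) \oc fwd (ls (tens A a a') m n)
      = bm (lact BP) (idm a) (fwd (ls a' m n)) \oc fwd (ls a (lact BM a' m) n)
          \oc bm F (fwd (lasc BM a a' m)) (idm n);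
  ls_triangle : forall m n,
    fwd (lunit BP (F m n)) \oc fwd (ls one m n)
      = bm F (fwd (lunit BM m)) (idm n);
  rs_pentagon : forall m n b b',
    fwd (rasc BP (F m n) b b') \oc bm (ract BP) (fwd (rs m n b)) (idm b')
        \oc fwd (rs m (ract BN n b) b')
      = fwd (rs m n (tens B b b')) \oc bm F (idm m) (fwd (rasc BN n b b'));
  rs_triangle : forall m n,
    fwd (runit BP (F m n)) \oc fwd (rs m n one)
      = bm F (idm m) (fwd (runit BN n));
  ls_rs : forall a m n b,
    bm (lact BP) (idm a) (fwd (rs m n b)) \oc fwd (ls a m (ract BN n b))
      = fwd (basc BP a (F m n) b) \oc bm (ract BP) (fwd (ls a m n)) (idm b)
          \oc fwd (rs (lact BM a m) n b);
  ls_bal : forall a m d n,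
    fwd (ls a m (lact BN d n)) \oc fwd (bal (lact BM a m) d n)
      = bm (lact BP) (idm a) (fwd (bal m d n)) \oc fwd (ls a (ract BM m d) n)
          \oc bm F (fwd (basc BM a m d)) (idm n);
  rs_bal : forall m d n b,
    bm (ract BP) (fwd (bal m d n)) (idm b) \oc fwd (rs (ract BM m d) n b)
      = fwd (rs m (lact BN d n) b) \oc bm F (idm m) (bwd (basc BN d n b))
          \oc fwd (bal m d (ract BN n b)) }.

(* M (x)_D N is equivalent to P as an (A,B)-bimodule category: P itself is a
   relative Deligne product, through a bimodule functor. *)
Definition relative_product_equiv (P : lincat R) (BP : bimod A B P) :=
  exists (F : bifunctor M N P)
    (bal : forall m d n, arr (F (ract BM m d) n) (F m (lact BN d n)))
    (ls : forall a m n, arr (F (lact BM a m) n) (lact BP a (F m n)))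
    (rs : forall m n b, arr (F m (ract BN n b)) (ract BP (F m n) b)),
    is_relative_product bal /\ balanced_bimod_functor bal ls rs.

End RelativeProduct.

Definition invertible (R : realType) (C D : fuscat R) (M : lincat R)
    (B : bimod C D M) :=
  relative_product_equiv B (op_bimod B) (reg_bimod C) /\
  relative_product_equiv (op_bimod B) B (reg_bimod D).

Section DualCategory.
Variables (R : realType) (C D : fuscat R) (M : lincat R) (B : bimod C D M).

Record endofunctor := EndoFunctor {
  endo :> functor M M;
  endo_str : forall a m, arr (endo (lact B a m)) (lact B a (endo m)) }.

Record module_functor_laws (G : endofunctor) : Prop := ModuleFunctorLaws {
  mf_functor : functor_laws G;
  mf_inv : forall a m, is_inv (endo_str G a m);
  mf_natural : forall a a' m m' (f : hom a a') (g : hom m m'),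
    fwd (endo_str G a' m') \oc fm G (bm (lact B) f g)
      = bm (lact B) f (fm G g) \oc fwd (endo_str G a m);
  mf_pentagon : forall a a' m,
    fwd (lasc B a a' (G m)) \oc fwd (endo_str G (tens C a a') m)
      = bm (lact B) (idm a) (fwd (endo_str G a' m))
          \oc fwd (endo_str G a (lact B a' m)) \oc fm G (fwd (lasc B a a' m));
  mf_triangle : forall m,
    fwd (lunit B (G m)) \oc fwd (endo_str G one m) = fm G (fwd (lunit B m)) }.

Definition module_natural (G G' : endofunctor)
    (eta : forall m, hom (G m) (G' m)) :=
  natural eta /\
  forall a m, fwd (endo_str G' a m) \oc eta (lact B a m)
    = bm (lact B) (idm a) (eta m) \oc fwd (endo_str G a m).

Definition ract_functor (c : D) : endofunctor :=
  @EndoFunctor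
    (@Functor R M M (fun m => ract B m c)
       (fun m n f => bm (ract B) f (idm c)))
    (fun a m => basc B a m c).

(* D, acting through B, is the category of C-module endofunctors of M acting by
   evaluation: c |-> (- <| c) is an equivalence of categories. It is
   automatically monoidal (in the order making evaluation a right action) by
   the axioms of the right action. *)
Definition is_dual_category :=
  (forall G : endofunctor, module_functor_laws G ->
     exists (c : D) (th : forall m, arr (ract_functor c m) (G m)),
       (forall m, is_inv (th m)) /\
       @module_natural (ract_functor c) G (fun m => fwd (th m))) /\
  (forall (c c' : D) (eta : forall m, hom (ract_functor c m)
                                          (ract_functor c' m)),
     @module_natural (ract_functor c) (ract_functor c') eta ->
     exists h : hom c c',
       (forall m, eta m = bm (ract B) (idm m) h) /\
       (forall h' : hom c c',
          (forall m, eta m = bm (ract B) (idm m) h') -> h' = h)).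

End DualCategory.

(* Completeness is automatic, as the hom spaces are finite-dimensional. *)
Record cstar (R : realType) (A : lincat R) := CStar {
  dag : forall x y : A, hom x y -> hom y x;
  dag_antilinear : forall x y (k : R[i]) (f g : hom x y),
    dag (k *: f + g) = k^* *: dag f + dag g;
  dag_cmp : forall x y z (g : hom y z) (f : hom x y),
    dag (g \oc f) = dag f \oc dag g;
  dagK : forall x y (f : hom x y), dag (dag f) = f;
  cstar_norm : exists nrm : forall x y : A, hom x y -> R,
    [/\ forall x y (f : hom x y), nrm x y f = 0 -> f = 0,
        forall x y (f g : hom x y), nrm x y (f + g) <= nrm x y f + nrm x y g,
        forall x y (k : R[i]) (f : hom x y),
          (nrm x y (k *: f))%:C = `|k| * (nrm x y f)%:C,
        forall x y z (g : hom y z) (f : hom x y),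
          nrm x z (g \oc f) <= nrm y z g * nrm x y f &
        forall x y (f : hom x y), nrm x x (dag f \oc f) = nrm x y f ^+ 2];
  cstar_pos : forall x y (f : hom x y),
    exists g : hom x x, dag f \oc f = dag g \oc g }.

Arguments dag {R A} c {x y} f.

Definition unitary_arr (R : realType) (A : lincat R) (s : cstar A) (x y : A)
    (u : arr x y) := bwd u = dag s (fwd u).

Record ufuscat (R : realType) := UFusCat {
  ufus_cat :> fuscat R;
  ufus_star : cstar ufus_cat;
  dag_tens : forall x x' y y' (f : hom x x') (g : hom y y'),
    dag ufus_star (bm (tens ufus_cat) f g)
      = bm (tens ufus_cat) (dag ufus_star f) (dag ufus_star g);
  asc_unitary : forall x y z, unitary_arr ufus_star (asc x y z);
  lun_unitary : forall x, unitary_arr ufus_star (lun x);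
  run_unitary : forall x, unitary_arr ufus_star (run x) }.

Record ubimod (R : realType) (C D : ufuscat R) := UBimod {
  ub_cat :> fsscat R;
  ub_str : bimod C D ub_cat;
  ub_laws : bimod_laws ub_str;
  ub_star : cstar ub_cat;
  dag_lact : forall a a' m m' (f : hom a a') (g : hom m m'),
    dag ub_star (bm (lact ub_str) f g)
      = bm (lact ub_str) (dag (ufus_star C) f) (dag ub_star g);
  dag_ract : forall m m' c c' (g : hom m m') (h : hom c c'),
    dag ub_star (bm (ract ub_str) g h)
      = bm (ract ub_str) (dag ub_star g) (dag (ufus_star D) h);
  lasc_unitary : forall a a' m, unitary_arr ub_star (lasc ub_str a a' m);
  lunit_unitary : forall m, unitary_arr ub_star (lunit ub_str m);
  rasc_unitary : forall m c c', unitary_arr ub_star (rasc ub_str m c c');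
  runit_unitary : forall m, unitary_arr ub_star (runit ub_str m);
  basc_unitary : forall a m c, unitary_arr ub_star (basc ub_str a m c) }.

Arguments ub_str {R C D} _.

Definition fusion_mx (R : realType) (A : fuscat R) (a : irr A) :
  'M[R]_#|irr A| :=
  \matrix_(i, j)
    (hdim (tens A (smp a) (smp (enum_val i))) (smp (enum_val j)))%:R.

Definition is_FPdim (R : realType) (A : fuscat R) (d : irr A -> R) :=
  forall a, [/\ 0 <= d a, eigenvalue (fusion_mx a) (d a) &
    forall l, 0 <= l -> eigenvalue (fusion_mx a) l -> l <= d a].

Definition FPdim_cat (R : realType) (A : fuscat R) (d : irr A -> R) : R :=
  \sum_a d a ^+ 2.

Definition is_module_dim (R : realType) (C D : ufuscat R) (M : ubimod C D)
    (dC : irr C -> R) (dM : irr M -> R) :=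
  [/\ forall m, 0 < dM m,
      forall a b, dC a * dM b
        = \sum_c (hdim (lact (ub_str M) (smp a) (smp b)) (smp c))%:R * dM c &
      \sum_m dM m ^+ 2 = FPdim_cat dC].

Section FSymbols.
Variables (R : realType) (C D : ufuscat R) (M : ubimod C D).

Definition ldim (a : irr C) (b e : irr M) : nat :=
  hdim (lact (ub_str M) (smp a) (smp b)) (smp e).
Definition rdim (b : irr M) (c : irr D) (f : irr M) : nat :=
  hdim (ract (ub_str M) (smp b) (smp c)) (smp f).

Definition lbasis := forall (a : irr C) (b e : irr M),
  (ldim a b e).-tuple (hom (lact (ub_str M) (smp a) (smp b)) (smp e)).
Definition rbasis := forall (b : irr M) (c : irr D) (f : irr M),
  (rdim b c f).-tuple (hom (ract (ub_str M) (smp b) (smp c)) (smp f)).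

Definition are_bases (bl : lbasis) (br : rbasis) :=
  (forall a b e, basis_of fullv (bl a b e)) /\
  (forall b c f, basis_of fullv (br b c f)).

(* [F a b c d e f al be mu nu] is the entry of [F_abc^d] at
   (al, e, be), (mu, f, nu). *)
Definition fsymbol := forall (a : irr C) (b : irr M) (c : irr D)
  (d e f : irr M),
  'I_(ldim a b e) -> 'I_(rdim e c d) -> 'I_(rdim b c f) -> 'I_(ldim a f d) ->
  R[i].

Definition is_Fsymbol (bl : lbasis) (br : rbasis) (F : fsymbol) :=
  forall (a : irr C) (b : irr M) (c : irr D) (d e : irr M)
    (al : 'I_(ldim a b e)) (be : 'I_(rdim e c d)),
    tnth (br e c d) be
      \oc bm (ract (ub_str M)) (tnth (bl a b e) al) (idm (smp c))
    = \sum_(f : irr M) \sum_(mu < rdim b c f) \sum_(nu < ldim a f d)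
        F a b c d e f al be mu nu *:
          (tnth (bl a f d) nu
             \oc bm (lact (ub_str M)) (idm (smp a)) (tnth (br b c f) mu)
             \oc fwd (basc (ub_str M) (smp a) (smp b) (smp c))).

(* Basis vectors are compared through their positions in the bases. *)
Definition is_inverse_Fsymbol (F Fi : fsymbol) :=
  forall (a : irr C) (b : irr M) (c : irr D) (d e e' : irr M)
    (al : 'I_(ldim a b e)) (be : 'I_(rdim e c d))
    (al' : 'I_(ldim a b e')) (be' : 'I_(rdim e' c d)),
    \sum_(f : irr M) \sum_(mu < rdim b c f) \sum_(nu < ldim a f d)
      F a b c d e f al be mu nu * Fi a b c d e' f al' be' mu nu
    = ([&& (al == al' :> nat), e == e' & (be == be' :> nat)])%:R.

Definition unitary_Fsymbol (F Fi : fsymbol) :=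
  forall (a : irr C) (b : irr M) (c : irr D) (d e f : irr M)
    (al : 'I_(ldim a b e)) (be : 'I_(rdim e c d)) (mu : 'I_(rdim b c f))
    (nu : 'I_(ldim a f d)),
    Fi a b c d e f al be mu nu = (F a b c d e f al be mu nu)^*.

End FSymbols.

Arguments ldim {R C D M} a b e.
Arguments rdim {R C D M} b c f.

(* Main.v *)
(** Averaging a morphism T : b <| c' -> b <| c over the simple objects a of C,
    with weights d_a, gives morphisms m <| c' -> m <| c natural in m and
    compatible with the left action of C. As the dual category acts fully
    faithfully, they are induced by a morphism c' -> c: zero if c and c' differ,
    a scalar otherwise. For T = mu^* mu' the matrix coefficients of the average
    are the sums of the theorem, and summing them over e and beta determines the
    scalar.

    The weights d_a are the right ones because the d-weighted trace on
    End(a |> m) is compatible with the partial trace given by the evaluation of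
    a. To see this, normalize ev_a and coev_a so that ev_a ev_a^* and
    coev_a^* coev_a are the same number q_a. Sphericity shows that q is a
    positive character of the fusion ring, so q = d by Perron-Frobenius, and the
    compatibility of the traces is then the equality case of a Cauchy-Schwarz
    inequality. *)

Require Import Defs.
From HB Require Import structures.
From mathcomp Require Import all_boot all_order all_algebra.
From mathcomp Require Import complex reals.
From mathcomp Require boolp.
From mathcomp Require Import ring.
(* Restores [hom], which mathcomp shadows. *)
Import Defs.

Set Implicit Arguments.
Unset Strict Implicit.
Unset Printing Implicit Defensive.

Import Order.TTheory GRing.Theory Num.Theory.
Local Open Scope ring_scope.

(** * Linear algebra in semisimple C*-categories *)

(** The duals of [C] come without a pivotal structure and with arbitrary scalings, so it is not
    clear that the normalized loop of a tensor product is the sum of the normalized loops of its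
    simple summands. Closing loops on the left and on the right gives the same Gram matrix for the
    two transposes of an orthonormal family, and positivity then forces its diagonal entries to be
    the loop value of the summand. This is what makes [q] multiplicative. Duality belongs to [C],
    traces and averages to [M]. Both are treated through functors on [M] together with a record of
    which families come from [C]: Schur's lemma for such families gives one scalar for all objects
    of [M], which can be read off at a single simple object. The constant d_e d_f / d_c has two
    sources. Averaging an identity, with the normalization of [dM], shows that the multiplicities of
    e in a |> b, weighted by d_a and summed over a, give d_b d_e. With the associativity of the two
    actions this makes [dM] an eigenvector for the right action too; the eigenvalue is a positive
    character of [D], hence d_c. *)

Section LinCat.
Variables (R : realType) (A : lincat R).
Implicit Types x y z t : A.

Lemma cmpDl x y z (g g' : hom y z) (f : hom x y) :
  (g + g') \oc f = (g \oc f) + (g' \oc f).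
Proof. by have := cmp_linearl 1 g g' f; rewrite !scale1r. Qed.

Lemma cmpDr x y z (g : hom y z) (f f' : hom x y) :
  g \oc (f + f') = (g \oc f) + (g \oc f').
Proof. by have := cmp_linearr 1 g f f'; rewrite !scale1r. Qed.

Lemma cmp0l x y z (f : hom x y) : (0 : hom y z) \oc f = 0.
Proof. by apply: (addIr (0 \oc f)); rewrite -cmpDl !add0r. Qed.

Lemma cmp0r x y z (g : hom y z) : g \oc (0 : hom x y) = 0.
Proof. by apply: (addIr (g \oc 0)); rewrite -cmpDr !add0r. Qed.

Lemma cmpZl x y z k (g : hom y z) (f : hom x y) :
  (k *: g) \oc f = k *: (g \oc f).
Proof. by have := cmp_linearl k g 0 f; rewrite cmp0l !addr0. Qed.

Lemma cmpZr x y z k (g : hom y z) (f : hom x y) :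
  g \oc (k *: f) = k *: (g \oc f).
Proof. by have := cmp_linearr k g f 0; rewrite cmp0r !addr0. Qed.

Lemma cmp_suml x y z (I : Type) (r : seq I) (P : pred I) (g : I -> hom y z)
    (f : hom x y) :
  (\sum_(i <- r | P i) g i) \oc f = \sum_(i <- r | P i) (g i \oc f).
Proof.
by apply: (big_morph (fun g => g \oc f)) => [? ?|]; rewrite ?cmpDl ?cmp0l.
Qed.

Lemma cmp_sumr x y z (I : Type) (r : seq I) (P : pred I) (g : hom y z)
    (f : I -> hom x y) :
  g \oc (\sum_(i <- r | P i) f i) = \sum_(i <- r | P i) (g \oc f i).
Proof.
by apply: (big_morph (fun f => g \oc f)) => [? ?|]; rewrite ?cmpDr ?cmp0r.
Qed.

End LinCat.

Section Bifunctor.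
Variables (R : realType) (A B E : lincat R) (F : bifunctor A B E).
Hypothesis FL : bifunctor_laws F.

Lemma bmDl x x' y y' (f f' : hom x x') (g : hom y y') :
  bm F (f + f') g = bm F f g + bm F f' g.
Proof. by have := bm_linearl FL 1 f f' g; rewrite !scale1r. Qed.

Lemma bmDr x x' y y' (f : hom x x') (g g' : hom y y') :
  bm F f (g + g') = bm F f g + bm F f g'.
Proof. by have := bm_linearr FL 1 f g g'; rewrite !scale1r. Qed.

Lemma bm0l x x' y y' (g : hom y y') : bm F (0 : hom x x') g = 0.
Proof. by apply: (addIr (bm F 0 g)); rewrite -bmDl !add0r. Qed.

Lemma bm0r x x' y y' (f : hom x x') : bm F f (0 : hom y y') = 0.
Proof. by apply: (addIr (bm F f 0)); rewrite -bmDr !add0r. Qed.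

Lemma bmZl x x' y y' k (f : hom x x') (g : hom y y') :
  bm F (k *: f) g = k *: bm F f g.
Proof. by have := bm_linearl FL k f 0 g; rewrite bm0l !addr0. Qed.

Lemma bmZr x x' y y' k (f : hom x x') (g : hom y y') :
  bm F f (k *: g) = k *: bm F f g.
Proof. by have := bm_linearr FL k f g 0; rewrite bm0r !addr0. Qed.

Lemma bm_suml x x' y y' (I : Type) (r : seq I) (P : pred I)
    (f : I -> hom x x') (g : hom y y') :
  bm F (\sum_(i <- r | P i) f i) g = \sum_(i <- r | P i) bm F (f i) g.
Proof.
by apply: (big_morph (fun f => bm F f g)) => [? ?|]; rewrite ?bmDl ?bm0l.
Qed.

Lemma bm_sumr x x' y y' (I : Type) (r : seq I) (P : pred I)
    (f : hom x x') (g : I -> hom y y') :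
  bm F f (\sum_(i <- r | P i) g i) = \sum_(i <- r | P i) bm F f (g i).
Proof.
by apply: (big_morph (bm F f)) => [? ?|]; rewrite ?bmDr ?bm0r.
Qed.

Lemma bm_cmpl x x' x'' y (f' : hom x' x'') (f : hom x x') :
  bm F (f' \oc f) (idm y) = bm F f' (idm y) \oc bm F f (idm y).
Proof. by rewrite -(bm_cmp FL) cmp1m. Qed.

Lemma bm_cmpr x y y' y'' (g' : hom y' y'') (g : hom y y') :
  bm F (idm x) (g' \oc g) = bm F (idm x) g' \oc bm F (idm x) g.
Proof. by rewrite -(bm_cmp FL) cmp1m. Qed.

Lemma bm_lr x x' y y' (f : hom x x') (g : hom y y') :
  bm F f (idm y') \oc bm F (idm x) g = bm F f g.
Proof. by rewrite -(bm_cmp FL) cmp1m cmpm1. Qed.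

Lemma bm_rl x x' y y' (f : hom x x') (g : hom y y') :
  bm F (idm x') g \oc bm F f (idm y) = bm F f g.
Proof. by rewrite -(bm_cmp FL) cmp1m cmpm1. Qed.

End Bifunctor.

Section Star.
Variables (R : realType) (A : lincat R) (s : cstar A).
Implicit Types x y z : A.
Local Notation "f ^H" := (dag s f) (at level 2, format "f ^H").

Lemma dagD x y (f g : hom x y) : (f + g)^H = f^H + g^H.
Proof. by have := dag_antilinear s 1 f g; rewrite rmorph1 !scale1r. Qed.

Lemma dag0 x y : (0 : hom x y)^H = 0.
Proof. by apply: (addIr (0^H)); rewrite -dagD !add0r. Qed.

Lemma dagZ x y k (f : hom x y) : (k *: f)^H = k^* *: f^H.
Proof. by have := dag_antilinear s k f 0; rewrite dag0 !addr0. Qed.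

Lemma dag_sum x y (I : Type) (r : seq I) (P : pred I) (f : I -> hom x y) :
  (\sum_(i <- r | P i) f i)^H = \sum_(i <- r | P i) (f i)^H.
Proof. by apply: (big_morph _ _ (dag0 x y)) => ? ?; rewrite dagD. Qed.

Lemma dag_idm x : (idm x)^H = idm x.
Proof. by rewrite -[LHS]cmpm1 -{2}(dagK s (idm x)) -dag_cmp cmpm1 dagK. Qed.

(** The C*-identity in [cstar_norm] reduces this to definiteness of the norm. *)
Lemma dag_cmp_eq0 x y (f : hom x y) : f^H \oc f = 0 -> f = 0.
Proof.
have [nrm [n0 _ nZ _ nC]] := cstar_norm s => f0.
have nrm0 : nrm x x 0 = 0.
  have := nZ x x 0 0; rewrite scale0r normr0 mul0r => /eqP.
  by rewrite (inj_eq (fmorph_inj _) _ 0) => /eqP.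
by apply/n0/eqP; rewrite -sqrf_eq0 -nC f0 nrm0.
Qed.

Lemma simple_scal x : simple x -> forall f : hom x x, exists k, f = k *: idm x.
Proof.
move=> x1 f.
have id0 : idm x != 0.
  apply/eqP=> id0; have : (fullv : {vspace hom x x}) = 0%VS.
    by apply/eqP; rewrite -subv0; apply/subvP=> g _;
      rewrite -[g]cmp1m id0 cmp0l mem0v.
  by move: x1; rewrite /simple => /[swap] ->; rewrite dimv0.
have /vlineP[k ->] : f \in <[idm x]>%VS; last by exists k.
suff -> : <[idm x]>%VS = fullv by rewrite memvf.
by apply/eqP; rewrite eqEdim subvf dim_vline id0 x1.
Qed.

Lemma simple_neq0 x : simple x -> idm x != 0.
Proof.
move=> x1; apply/eqP=> id0; have : (fullv : {vspace hom x x}) = 0%VS.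
  by apply/eqP; rewrite -subv0; apply/subvP=> g _;
    rewrite -[g]cmp1m id0 cmp0l mem0v.
by move: x1; rewrite /simple => /[swap] ->; rewrite dimv0.
Qed.

Lemma scale_idI x : simple x -> injective (fun k : R[i] => k *: idm x).
Proof.
move=> x1 k l /eqP; rewrite -subr_eq0 -scalerBl scaler_eq0.
by rewrite (negbTE (simple_neq0 x1)) orbF subr_eq0 => /eqP.
Qed.

(** By [cstar_pos], [f^H \oc f] is [g^H \oc g] for an endomorphism [g] of the simple object; this
    [g] is a scalar [l], and [k] is its squared modulus. *)
Lemma simple_dag_ge0 x y (f : hom x y) k :
  simple x -> f^H \oc f = k *: idm x -> 0 <= k.
Proof.
move=> x1 fE; have [g gE] := cstar_pos s f.
have [l gl] := simple_scal x1 g.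
have -> : k = l^* * l.
  apply: (scale_idI x1); rewrite -fE gE gl dagZ dag_idm.
  by rewrite cmpZl cmpZr cmp1m scalerA.
by rewrite mulrC mulcJ_ge0.
Qed.

Lemma simple_dag_gt0 x y (f : hom x y) k :
  simple x -> f != 0 -> f^H \oc f = k *: idm x -> 0 < k.
Proof.
move=> x1 f0 fE; rewrite lt0r (simple_dag_ge0 x1 fE) andbT.
by apply: contraNN f0 => /eqP k0; apply/eqP/dag_cmp_eq0; rewrite fE k0 scale0r.
Qed.

End Star.

(** * Orthonormal families for a positive Hermitian form *)

Section GramSchmidt.
Variables (R : realType) (V : vectType R[i]) (h : V -> V -> R[i]).
Hypothesis h_lin : forall k u v w, h (k *: u + v) w = k * h u w + h v w.
Hypothesis h_sym : forall u v, h v u = (h u v)^*.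
Hypothesis h_pos : forall u, u != 0 -> 0 < h u u.

Lemma exists_orthonormal k : (k <= \dim (fullv : {vspace V}))%N ->
  exists t : 'I_k -> V, forall i j, h (t i) (t j) = (i == j)%:R.
Proof.
have h0 w : h 0 w = 0.
  by have := h_lin (-1) 0 0 w; rewrite scaler0 add0r mulN1r addNr.
have hD u v w : h (u + v) w = h u w + h v w.
  by have := h_lin 1 u v w; rewrite scale1r mul1r.
have hZ c u w : h (c *: u) w = c * h u w.
  by have := h_lin c u 0 w; rewrite h0 !addr0.
have hS n (f : 'I_n -> V) w : h (\sum_i f i) w = \sum_i h (f i) w.
  by apply: (big_morph (h^~ w)) => // u v; exact: hD.
elim: k => [_|k IHk kV]; first by exists (fun=> 0); case.
have [t tE] := IHk (ltnW kV).
have [v vt] : exists v, v \notin <<[tuple t i | i < k]>>%VS.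
  apply: boolp.contrapT => /boolp.forallNP vt.
  move: kV; rewrite ltnNge => /negP[].
  have := dim_span [tuple t i | i < k]; rewrite size_tuple; apply: leq_trans.
  by apply/dimvS/subvP=> v _; move: (vt v) => /negP/negbNE.
pose u := v - \sum_i h v (t i) *: t i.
have u0 : u != 0.
  apply: contraNneq vt => /eqP; rewrite subr_eq0 => /eqP ->.
  apply: memv_suml => i _; apply/memvZ/memv_span.
  by apply/tnthP; exists i; rewrite tnth_mktuple.
have ut i : h u (t i) = 0.
  rewrite /u hD -scaleN1r hZ hS (bigD1 i) //= big1 => [|j ji]; rewrite hZ tE.
    by rewrite eqxx mulr1 addr0 mulN1r subrr.
  by rewrite (negbTE ji) mulr0.
pose c := (sqrtC (h u u))^-1.
have c_real : c^* = c.
  have : 0 <= c by rewrite invr_ge0 sqrtC_ge0 ltW ?h_pos.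
  by move=> /ger0_real/CrealP.
have cc : c * c * h u u = 1.
  by rewrite -expr2 exprVn sqrtCK mulVf // gt_eqF ?h_pos.
have huZ w z : h z (c *: w) = c * h z w.
  by rewrite h_sym hZ rmorphM /= c_real -h_sym.
exists (fun i => if unlift ord_max i is Some j then t j else c *: u) => i j.
case: unliftP => [i'|] ->; case: unliftP => [j'|] ->.
- by rewrite tE (inj_eq lift_inj).
- by rewrite huZ h_sym ut rmorph0 mulr0 eq_sym (negbTE (neq_lift _ _)).
- by rewrite hZ ut mulr0 (negbTE (neq_lift _ _)).
- by rewrite huZ hZ mulrA cc eqxx.
Qed.

End GramSchmidt.

Section Scalar.
Variables (R : realType) (A : lincat R).

(** As a coordinate this is linear for every [x]; it recovers the endomorphism when [x] is simple
    ([scE]). *)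
Definition sc (x : A) (f : hom x x) : R[i] := coord [tuple idm x] ord0 f.

Lemma sc_sum x (I : Type) (r : seq I) (P : pred I) (f : I -> hom x x) :
  sc (\sum_(i <- r | P i) f i) = \sum_(i <- r | P i) sc (f i).
Proof. by rewrite /sc linear_sum. Qed.

Lemma sc_scale x k (f : hom x x) : sc (k *: f) = k * sc f.
Proof. by rewrite /sc linearZ. Qed.

Lemma sc0 x : sc (0 : hom x x) = 0.
Proof. by rewrite /sc linear0. Qed.

Variable x : A.
Hypothesis x1 : simple x.

Lemma scZ k : sc (k *: idm x) = k.
Proof.
(* [coord_free] expects its argument as an entry of the family, here the one at index 0. *)
rewrite /sc linearZ /= -[X in coord _ _ X]/([tuple idm x]`_(@ord0 0)).
rewrite coord_free ?eqxx ?mulr1 //.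
by rewrite /free /= span_seq1 dim_vline simple_neq0.
Qed.

Lemma scE (f : hom x x) : f = sc f *: idm x.
Proof. by have [k ->] := simple_scal x1 f; rewrite scZ. Qed.

Lemma sc1 : sc (idm x) = 1.
Proof. by rewrite -[idm x]scale1r scZ. Qed.

Lemma sc_cmpl y (f : hom x x) (g : hom y x) : f \oc g = sc f *: g.
Proof. by rewrite {1}[f]scE cmpZl cmp1m. Qed.

Lemma sc_cmpr y (f : hom x x) (g : hom x y) : g \oc f = sc f *: g.
Proof. by rewrite {1}[f]scE cmpZr cmpm1. Qed.

End Scalar.

Lemma sc_dag (R : realType) (A : lincat R) (s : cstar A) (x : A)
    (f : hom x x) : simple x -> sc (dag s f) = (sc f)^*.
Proof. by move=> x1; rewrite {1}[f](scE x1) dagZ dag_idm scZ. Qed.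

Lemma smp_simple (R : realType) (A : fsscat R) (i : irr A) : simple (smp i).
Proof. by apply/smpP; exists i. Qed.
#[global] Hint Resolve smp_simple : core.

Section Bilinear.
Variables (R : realType) (U V Z : lmodType R[i]) (B : U -> V -> Z).

Definition bilin :=
  (forall k y1 y2 z, B (k *: y1 + y2) z = k *: B y1 z + B y2 z) /\
  (forall k y z1 z2, B y (k *: z1 + z2) = k *: B y z1 + B y z2).

Hypothesis BB : bilin.

Lemma bilin_suml (I : finType) (c : I -> R[i]) y z :
  B (\sum_i c i *: y i) z = \sum_i c i *: B (y i) z.
Proof.
have [Bl _] := BB.
have Bl0 : B 0 z = 0.
  by have := Bl (-1) 0 0 z; rewrite scaler0 add0r scaleN1r addNr.
rewrite (big_morph (B^~ z) (id1 := 0) (op1 := +%R)) //= => [|y1 y2].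
  by apply: eq_bigr => i _; have := Bl (c i) (y i) 0 z; rewrite Bl0 !addr0.
by have := Bl 1 y1 y2 z; rewrite !scale1r.
Qed.

Lemma bilin_sumr (I : finType) (c : I -> R[i]) y z :
  B y (\sum_i c i *: z i) = \sum_i c i *: B y (z i).
Proof.
have [_ Br] := BB.
have Br0 : B y 0 = 0.
  by have := Br (-1) y 0 0; rewrite scaler0 add0r scaleN1r addNr.
rewrite (big_morph (B y) (id1 := 0) (op1 := +%R)) //= => [|y1 y2].
  by apply: eq_bigr => i _; have := Br (c i) y (z i) 0; rewrite Br0 !addr0.
by have := Br 1 y y1 y2; rewrite !scale1r.
Qed.

Lemma bilinZr k y z : B y (k *: z) = k *: B y z.
Proof. by have := bilin_sumr (fun=> k) y (fun _ : 'I_1 => z);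
  rewrite !big_ord1. Qed.

End Bilinear.

(** * Orthonormal bases and resolutions of the identity *)

Section OrthonormalBases.
Variables (R : realType) (A : fsscat R) (s : cstar A).
Implicit Types (m n : A) (e : irr A).
Local Notation "f ^H" := (dag s f) (at level 2, format "f ^H").

Lemma onb_exists m e : exists t : 'I_(hdim m (smp e)) -> hom m (smp e),
  forall i j, t i \oc (t j)^H = (i == j)%:R *: idm (smp e).
Proof.
pose h (f g : hom m (smp e)) := sc (f \oc g^H).
have [|||//|t tE] := @exists_orthonormal _ _ h _ _ _ (hdim m (smp e)).
- by move=> k u v w; rewrite /h cmp_linearl /sc linearP.
- by move=> u v; rewrite /h -(sc_dag s) // dag_cmp dagK.
- move=> u u0; apply: (simple_dag_gt0 (s := s) (f := u^H) (smp_simple e)).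
    by apply: contraNneq u0 => /(congr1 (fun f => f^H));
      rewrite dagK dag0 => ->.
  by rewrite dagK -scE.
by exists t => i j; rewrite -tE -scE.
Qed.

Definition onb m e : 'I_(hdim m (smp e)) -> hom m (smp e) :=
  sval (boolp.cid (onb_exists m e)).

Lemma onbP m e i j : onb i \oc (@onb m e j)^H = (i == j)%:R *: idm (smp e).
Proof. by rewrite /onb; case: boolp.cid. Qed.

Lemma onb_expand m e (f : hom m (smp e)) :
  f = \sum_i sc (f \oc (@onb m e i)^H) *: onb i.
Proof.
pose X := [tuple @onb m e i | i < hdim m (smp e)].
have Xi (i : 'I_(hdim m (smp e))) : X`_i = onb i.
  by rewrite -tnth_nth tnth_mktuple.
have fX (k : 'I_(hdim m (smp e)) -> R[i]) j :
    sc ((\sum_i k i *: onb i) \oc (@onb m e j)^H) = k j.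
  rewrite cmp_suml (bigD1 j) //= big1 ?addr0 => [|i ij].
    by rewrite cmpZl onbP eqxx scalerA mulr1 scZ.
  by rewrite cmpZl onbP (negbTE ij) scale0r scaler0.
have XF : free X.
  apply/freeP => k; under eq_bigr do rewrite Xi.
  by move=> k0 i; rewrite -(fX k i) k0 cmp0l -[0](scale0r (idm _)) scZ.
have XB : basis_of fullv X.
  by rewrite basisEfree XF subvf size_tuple /=.
have fE : f = \sum_i coord X i f *: onb i.
  by rewrite {1}(coord_basis XB (memvf f)); apply: eq_bigr => i _; rewrite Xi.
by rewrite {1}fE; apply: eq_bigr => i _; rewrite {2}fE fX.
Qed.

(** Composed with a projection [p k] onto a simple summand of [m], the sum keeps only the terms with
    [e = t k], and these are the orthonormal expansion of [p k]. *)
Lemma onb_complete m : \sum_e \sum_i ((@onb m e i)^H \oc onb i) = idm m.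
Proof.
have [n [t [i [p [_ _ ip]]]]] := semisimple m.
rewrite -[LHS]cmp1m -ip cmp_suml; apply: eq_bigr => k _.
rewrite -[RHS]cmpm1 -!cmpA; congr (_ \oc _); rewrite cmpm1.
rewrite cmp_sumr (bigD1 (t k)) //= [X in _ + X]big1 ?addr0 => [|e et].
  rewrite cmp_sumr [RHS]onb_expand; apply: eq_bigr => j _.
  by rewrite cmpA (sc_cmpl (smp_simple _)).
rewrite cmp_sumr big1 // => j _; rewrite cmpA.
by rewrite [p k \oc _]smp_disjoint ?cmp0l.
Qed.

Lemma onb_expandr m e (f : hom (smp e) m) :
  f = \sum_i sc (@onb m e i \oc f) *: (onb i)^H.
Proof.
rewrite -[LHS](dagK s) [f^H in LHS]onb_expand dag_sum.
by apply: eq_bigr => i _; rewrite dagZ -(sc_dag s) // dag_cmp !dagK.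
Qed.

Lemma sc_insert m e (y : hom m (smp e)) (z : hom (smp e) m) :
  sc (y \oc z) = \sum_i sc (y \oc (@onb m e i)^H) * sc (onb i \oc z).
Proof.
rewrite {1}[y]onb_expand cmp_suml sc_sum; apply: eq_bigr => i _.
by rewrite cmpZl sc_scale.
Qed.

(** * Weighted traces and dual frames *)

Section Trace.
Variable w : irr A -> R[i].
Hypothesis w0 : forall e, w e != 0.

Definition tr m (f : hom m m) : R[i] :=
  \sum_e \sum_i w e * sc (@onb m e i \oc f \oc (onb i)^H).

Lemma tr_linear m k (f g : hom m m) : tr (k *: f + g) = k * tr f + tr g.
Proof.
rewrite /tr mulr_sumr -big_split; apply: eq_bigr => e _ /=.
rewrite mulr_sumr -big_split; apply: eq_bigr => i _ /=.
by rewrite cmp_linearr cmp_linearl /sc linearP /= mulrDr mulrCA.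
Qed.

Lemma trD m (f g : hom m m) : tr (f + g) = tr f + tr g.
Proof. by have := tr_linear 1 f g; rewrite scale1r mul1r. Qed.

Lemma tr0 m : @tr m 0 = 0.
Proof. by apply: (addIr (@tr m 0)); rewrite -trD !add0r. Qed.

Lemma trZ m k (f : hom m m) : tr (k *: f) = k * tr f.
Proof. by have := tr_linear k f 0; rewrite tr0 !addr0. Qed.

Lemma tr_sum m (I : Type) (r : seq I) (P : pred I) (f : I -> hom m m) :
  tr (\sum_(i <- r | P i) f i) = \sum_(i <- r | P i) tr (f i).
Proof. by apply: (big_morph _ _ (tr0 m)) => ? ?; rewrite trD. Qed.

Lemma trC m n (f : hom m n) (g : hom n m) : tr (g \oc f) = tr (f \oc g).
Proof.
apply: eq_bigr => e _.
under eq_bigr do rewrite !cmpA -[_ \oc f \oc _]cmpA sc_insert mulr_sumr.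
rewrite exchange_big; apply: eq_bigr => j _ /=.
rewrite -mulr_sumr !cmpA -[_ \oc g \oc _]cmpA sc_insert.
congr (_ * _); apply: eq_bigr => i _.
by rewrite mulrC !cmpA.
Qed.

Lemma tr_smp e (f : hom (smp e) (smp e)) : tr f = w e * sc f.
Proof.
rewrite /tr (bigD1 e) //= [X in _ + X]big1 ?addr0 => [|g ge].
  rewrite (eq_bigr (fun=> w e * sc f)) => [|i _]; last first.
    rewrite (sc_cmpr (smp_simple e) f) cmpZl onbP eqxx scale1r scZ //.
  by rewrite sumr_const card_ord smp_simple.
rewrite big1 // => i _.
by rewrite [onb i]smp_disjoint 1?eq_sym // !cmp0l -[0](scale0r (idm _)) scZ //
  mulr0.
Qed.

(* The two halves of the statement that [v] and [v'] are dual bases for the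
   pairing [tr (y \oc z)]; neither requires linear independence. *)
Definition lframe m n (K : finType) (v : K -> hom m n) (v' : K -> hom n m) :=
  forall y, y = \sum_k tr (y \oc v' k) *: v k.

Definition rframe m n (K : finType) (v : K -> hom m n) (v' : K -> hom n m) :=
  forall y, y = \sum_k tr (v k \oc y) *: v' k.

(** The formal sum of the pairs [v k], [v' k] is the copairing inverse to the trace pairing:
    expanding each [v' k] in [u'] and resumming over [k] produces [u]. *)
Lemma frame_indep m n (Z : lmodType R[i]) (B : hom m n -> hom n m -> Z)
    (K L : finType) (v : K -> hom m n) v' (u : L -> hom m n) u' :
  bilin B -> lframe v v' -> rframe u u' ->
  \sum_k B (v k) (v' k) = \sum_l B (u l) (u' l).
Proof.
move=> BB vF uF.
under eq_bigr => k _ do rewrite [v' k](uF _) bilin_sumr //.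
rewrite exchange_big; apply: eq_bigr => l _ /=.
by rewrite -bilin_suml // -vF.
Qed.

(** The coefficients of [f \oc v k] in [u] and of [u' l \oc f] in [v'] agree by cyclicity of the
    trace. This is the source of the naturality of averages. *)
Lemma frame_nat p m n (f : hom m n) (Z : lmodType R[i])
    (B : hom p n -> hom m p -> Z) (K L : finType)
    (v : K -> hom p m) v' (u : L -> hom p n) u' :
  bilin B -> rframe v v' -> lframe u u' ->
  \sum_k B (f \oc v k) (v' k) = \sum_l B (u l) (u' l \oc f).
Proof.
move=> BB vF uF.
under eq_bigr => k _ do rewrite [f \oc v k](uF _) bilin_suml //.
rewrite exchange_big; apply: eq_bigr => l _ /=.
rewrite [u' l \oc f](vF _) bilin_sumr //; apply: eq_bigr => k _.
by rewrite -cmpA trC cmpA.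
Qed.

Definition frame_idx m n : finType :=
  {g : irr A & ('I_(hdim n (smp g)) * 'I_(hdim m (smp g)))%type}.

Definition frm m n (k : frame_idx m n) : hom m n :=
  (onb (tagged k).1)^H \oc onb (tagged k).2.

(** The inverse weight compensates the factor [w g] in the trace of an endomorphism of [smp g]
    ([tr_smp]). *)
Definition cofrm m n (k : frame_idx m n) : hom n m :=
  (w (tag k))^-1 *: ((onb (tagged k).2)^H \oc onb (tagged k).1).

Lemma sum_frame_idx m n (Z : nmodType) (E : frame_idx m n -> Z) :
  \sum_k E k = \sum_g \sum_(i < hdim n (smp g)) \sum_(j < hdim m (smp g))
    E (@Tagged _ g
         (fun g => ('I_(hdim n (smp g)) * 'I_(hdim m (smp g)))%type) (i, j)).
Proof.
under [RHS]eq_bigr => g _.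
  rewrite (pair_bigA _ (fun i j => E (@Tagged _ g
         (fun g => ('I_(hdim n (smp g)) * 'I_(hdim m (smp g)))%type) (i, j)))).
  over.
rewrite (sig_big_dep xpredT (fun _ => xpredT) (fun g p => E (@Tagged _ g
         (fun g => ('I_(hdim n (smp g)) * 'I_(hdim m (smp g)))%type)
         (p.1, p.2)))) /=.
by apply: eq_bigr => -[g [i j]].
Qed.

Lemma frm_lframe m n : lframe (@frm m n) (@cofrm m n).
Proof.
move=> y; rewrite sum_frame_idx -[LHS]cmp1m -onb_complete cmp_suml.
apply: eq_bigr => g _; rewrite cmp_suml; apply: eq_bigr => i _.
rewrite -cmpA [onb i \oc y]onb_expand cmp_sumr; apply: eq_bigr => j _.
rewrite /frm /cofrm /= [X in tr X]cmpZr trZ cmpA trC cmpA tr_smp mulKf //.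
by rewrite cmpZr.
Qed.

Lemma frm_rframe m n : rframe (@frm m n) (@cofrm m n).
Proof.
move=> y; rewrite sum_frame_idx -[LHS]cmpm1 -onb_complete cmp_sumr.
apply: eq_bigr => g _; rewrite cmp_sumr; apply: eq_bigr => i _.
rewrite cmpA [y \oc _]onb_expandr cmp_suml; apply: eq_bigr => j _.
rewrite /frm /cofrm /= -cmpA trC tr_smp // scalerA mulrAC mulfV // mul1r.
by rewrite cmpZl cmpA.
Qed.

End Trace.
End OrthonormalBases.

(** Both sides count basis vectors, each one as a diagonal coefficient equal to 1. Cutting [m] and
    then [F (smp g)] along resolutions of the identity, and recomposing in the other cyclic order,
    turns one count into the other. *)
Lemma hdim_functor (R : realType) (A E : fsscat R) (sA : cstar A)
    (sE : cstar E) (F : functor A E) (m : A) (d : irr E) :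
  functor_laws F ->
  (hdim (F m) (smp d))%:R
    = \sum_g (hdim m (smp g))%:R * (hdim (F (smp g)) (smp d))%:R :> R[i].
Proof.
case=> F1 FM FL.
have FD x y (f g : hom x y) : fm F (f + g) = fm F f + fm F g.
  by have := FL x y 1 f g; rewrite !scale1r.
have F0 x y : fm F (0 : hom x y) = 0.
  by apply: (addIr (fm F 0)); rewrite -FD !add0r.
have FS x y (I : finType) (f : I -> hom x y) :
    fm F (\sum_i f i) = \sum_i fm F (f i).
  by apply: (big_morph _ _ (F0 x y)) => f1 f2; rewrite FD.
pose om i := @onb R A sA m i; pose Om := @onb R E sE (F m) d.
pose om' g := @onb R E sE (F (smp g)) d.
transitivity (\sum_k \sum_g \sum_i \sum_j
    sc (Om k \oc fm F (dag sA (om g i)) \oc dag sE (om' g j))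
    * sc (om' g j \oc (fm F (om g i) \oc dag sE (Om k)))).
  rewrite -[X in X%:R = _]card_ord.
  rewrite -sumr_const; apply: eq_bigr => k _.
  transitivity (sc (Om k \oc fm F (idm m) \oc dag sE (Om k))).
    by rewrite F1 cmpm1 onbP eqxx scZ.
  rewrite -(onb_complete sA) FS cmp_sumr cmp_suml sc_sum.
  apply: eq_bigr => g _; rewrite FS cmp_sumr cmp_suml sc_sum.
  apply: eq_bigr => i _; rewrite FM cmpA -cmpA.
  by rewrite (sc_insert sE).
rewrite exchange_big; apply: eq_bigr => g _ /=.
rewrite exchange_big -[X in X%:R * _]card_ord -sumr_const mulr_suml.
apply: eq_bigr => i _ /=.
rewrite exchange_big mul1r -[X in X%:R]card_ord -sumr_const.
apply: eq_bigr => j _ /=.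
transitivity (sc (om' g j \oc fm F (om g i)
                    \oc (fm F (dag sA (om g i)) \oc dag sE (om' g j)))).
  rewrite (sc_insert sE); apply: eq_bigr => k _.
  by rewrite mulrC !cmpA.
rewrite cmpA -[_ \oc _ \oc fm F (dag _ _)]cmpA -FM onbP eqxx scale1r F1 cmpm1.
by rewrite onbP eqxx scZ.
Qed.

Lemma hdim_functorN (R : realType) (A E : fsscat R) (sA : cstar A)
    (sE : cstar E) (F : functor A E) (m : A) (d : irr E) :
  functor_laws F ->
  hdim (F m) (smp d)
    = (\sum_g hdim m (smp g) * hdim (F (smp g)) (smp d))%N.
Proof.
move=> FL; apply/eqP; rewrite -(eqr_nat R[i]) (hdim_functor sA sE m d FL).
by rewrite natr_sum; apply/eqP/eq_bigr => g _; rewrite natrM.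
Qed.

Lemma hdim_iso (R : realType) (A : fsscat R) (s : cstar A) (x y : A)
    (u : arr x y) (e : irr A) : is_inv u -> hdim x (smp e) = hdim y (smp e).
Proof.
move=> [vu uv]; apply/eqP; rewrite -(eqr_nat R[i]).
have count z (g : hom z z) : g = idm z ->
    (hdim z (smp e))%:R = \sum_i sc (onb s i \oc g \oc dag s (@onb _ _ s z e
      i)).
  move=> ->; rewrite -[X in X%:R]card_ord -sumr_const; apply: eq_bigr => i _.
  by rewrite cmpm1 onbP eqxx scale1r sc1.
rewrite (count x _ vu) (count y _ uv); apply/eqP.
under eq_bigr do rewrite cmpA -cmpA (sc_insert s).
under [RHS]eq_bigr do rewrite cmpA -cmpA (sc_insert s).
rewrite exchange_big; apply: eq_bigr => j _; apply: eq_bigr => i _ /=.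
by rewrite mulrC !cmpA.
Qed.

Lemma dual_basis (R : realType) (A : fsscat R) (s : cstar A) (m : A)
    (e : irr A) (X : (hdim m (smp e)).-tuple (hom m (smp e))) :
  basis_of fullv X ->
  exists X' : 'I_(hdim m (smp e)) -> hom (smp e) m,
    (forall i j, tnth X i \oc X' j = (i == j)%:R *: idm (smp e)) /\
    \sum_i (X' i \oc tnth X i) = \sum_i (dag s (@onb _ _ s m e i) \oc onb s i).
Proof.
move=> XB; have Xi i : X`_(i : 'I_(hdim m (smp e))) = tnth X i.
  by rewrite -tnth_nth.
have expand f : f = \sum_j coord X j f *: tnth X j.
  by rewrite {1}(coord_basis XB (memvf f)); apply: eq_bigr => j _; rewrite Xi.
(* For the pairing [sc (f \oc y)] the adjoints of [onb s] are dual to [onb s], so the coordinate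
   forms of [X] are written in these adjoints. *)
exists (fun j => \sum_k coord X j (onb s k) *: dag s (onb s k)); split=> [i j|].
  transitivity (coord X j (tnth X i) *: idm (smp e)); last first.
    by rewrite -Xi coord_free ?(basis_free XB).
  rewrite [X in coord _ _ X](onb_expand s) linear_sum scaler_suml cmp_sumr.
  apply: eq_bigr => k _.
  by rewrite cmpZr linearZ /= [_ \oc dag _ _](scE (smp_simple e)) scZ //
    !scalerA mulrC.
under eq_bigr do rewrite cmp_suml.
rewrite exchange_big; apply: eq_bigr => k _ /=.
rewrite [X in _ = _ \oc X]expand cmp_sumr; apply: eq_bigr => j _.
by rewrite cmpZl cmpZr.
Qed.

Lemma dual_expandr (R : realType) (A : fsscat R) (s : cstar A) (m : A)
    (e : irr A) (X : 'I_(hdim m (smp e)) -> hom m (smp e))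
    (X' : 'I_(hdim m (smp e)) -> hom (smp e) m) (y : hom (smp e) m) :
  \sum_i (X' i \oc X i) = \sum_i (dag s (@onb _ _ s m e i) \oc onb s i) ->
  y = \sum_i sc (X i \oc y) *: X' i.
Proof.
move=> E; rewrite [LHS](onb_expandr s).
transitivity ((\sum_i (X' i \oc X i)) \oc y).
  rewrite E cmp_suml; apply: eq_bigr => i _.
  by rewrite -cmpA (sc_cmpr (smp_simple e)).
rewrite cmp_suml; apply: eq_bigr => i _.
by rewrite -cmpA (sc_cmpr (smp_simple e)).
Qed.

(** * Frobenius-Perron dimensions *)

Section PerronFrobenius.
Variables (R : realType) (A : fuscat R) (d chi : irr A -> R).
Hypothesis dP : is_FPdim d.
Hypothesis chi_gt0 : forall a, 0 < chi a.
Hypothesis chiM : forall a i,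
  chi a * chi i = \sum_j (hdim (tens A (smp a) (smp i)) (smp j))%:R * chi j.

(** The positive vector [chi] is a right eigenvector of [fusion_mx a] with eigenvalue [chi a], so
    maximality gives [chi a <= d a]. Pairing it with the entrywise absolute value of a left
    eigenvector for [d a] gives the converse. *)
Lemma FPdim_unique a : d a = chi a.
Proof.
have [d_ge0 d_eig d_max] := dP a.
pose N := fusion_mx a; pose x (i : 'I_#|irr A|) := chi (enum_val i).
have xE i : \sum_j N i j * x j = chi a * x i.
  rewrite chiM (reindex (@enum_val (irr A) predT)) /=; last first.
    by apply: onW_bij; apply: enum_val_bij.
  by apply: eq_bigr => j _; rewrite mxE.
apply/eqP; rewrite eq_le; apply/andP; split; last first.
  apply: d_max; first exact/ltW.
  (* [eigenvalue] refers to row vectors and [x] is a column eigenvector, whence the detour through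
     the transpose. *)
  have : eigenvalue N^T (chi a).
    apply/eigenvalueP; exists (\row_i x i); last first.
      apply/eqP => /rowP/(_ (enum_rank a))/eqP.
      by rewrite !mxE gt_eqF ?chi_gt0.
    apply/rowP => i; rewrite !mxE -xE.
    by apply: eq_bigr => j _; rewrite !mxE mulrC.
  rewrite /eigenvalue /eigenspace !kermx_eq0 !row_free_unit.
  by rewrite -unitmx_tr linearB /= trmxK tr_scalar_mx.
have [v vE v0] := eigenvalueP d_eig.
pose S := \sum_j `|v 0 j| * x j.
have S_ge0 j : 0 <= `|v 0 j| * x j.
  by apply: mulr_ge0 => //; apply/ltW/chi_gt0.
have S_gt0 : 0 < S.
  rewrite lt0r sumr_ge0 // andbT; apply: contraNneq v0 => /eqP.
  rewrite psumr_eq0 // => /allP S0; apply/eqP/rowP => j; rewrite mxE.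
  have := S0 j; rewrite mem_index_enum => /(_ isT)/=.
  by rewrite mulf_eq0 normr_eq0 [x j == 0]gt_eqF ?chi_gt0 // orbF => /eqP.
rewrite -(ler_pM2r S_gt0) /S !mulr_sumr.
apply: (@le_trans _ _ (\sum_j (\sum_i `|v 0 i| * N i j) * x j)).
  apply: ler_sum => j _; rewrite mulrA ler_wpM2r ?(ltW (chi_gt0 _)) //.
  have := congr1 (fun r : 'rV_ _ => r 0 j) vE; rewrite !mxE => vj.
  rewrite -[X in X * _]ger0_norm // -normrM -vj.
  apply: le_trans (ler_norm_sum _ _ _) _; apply: ler_sum => i _.
  by rewrite normrM [`|N _ _|]ger0_norm // mxE ler0n.
under eq_bigr do rewrite mulr_suml.
rewrite exchange_big; apply: ler_sum => i _ /=.
under eq_bigr do rewrite -mulrA.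
by rewrite -mulr_sumr xE mulrCA.
Qed.

End PerronFrobenius.

(** * Natural families induced by morphisms of C *)

Section ModuleCategory.
Variables (R : realType) (C D : ufuscat R) (M : ubimod C D).
Local Notation "a |> m" := (lact (ub_str M) a m)
  (at level 40, no associativity).
Local Notation "f |>f g" := (bm (lact (ub_str M)) f g)
  (at level 40, no associativity).
Local Notation "a |>m g" := (bm (lact (ub_str M)) (idm a) g)
  (at level 40, no associativity).
Local Notation "m <| c" := (ract (ub_str M) m c)
  (at level 40, no associativity).
Local Notation "g <|m c" := (bm (ract (ub_str M)) g (idm c))
  (at level 40, no associativity).
Local Notation sM := (ub_star M).
Local Notation sC := (ufus_star C).
Local Notation "f ^H" := (dag sM f) (at level 2, format "f ^H").
Local Notation "f ^h" := (dag sC f) (at level 2, format "f ^h").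
Local Notation lasc a b m := (fwd (lasc (ub_str M) a b m)).
Local Notation lunit m := (fwd (lunit (ub_str M) m)).
Local Notation bs a m c := (fwd (basc (ub_str M) a m c)).
Local Notation bsV a m c := (bwd (basc (ub_str M) a m c)).

Let ML := ub_laws M.
Let LL := lact_laws ML.
Let RL := ract_laws ML.

Lemma lascK a b m : (lasc a b m)^H \oc lasc a b m = idm _.
Proof. by have [<- _] := lasc_inv ML a b m; rewrite lasc_unitary. Qed.

Lemma lascKV a b m : lasc a b m \oc (lasc a b m)^H = idm _.
Proof. by have [_ <-] := lasc_inv ML a b m; rewrite lasc_unitary. Qed.

Lemma lunitK m : (lunit m)^H \oc lunit m = idm _.
Proof. by have [<- _] := lunit_inv ML m; rewrite lunit_unitary. Qed.

Lemma lunitKV m : lunit m \oc (lunit m)^H = idm _.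
Proof. by have [_ <-] := lunit_inv ML m; rewrite lunit_unitary. Qed.

Lemma la_id a m : a |>m idm m = idm (a |> m).
Proof. exact: (bm1 LL). Qed.

Lemma la_cmp a x y z (g : hom y z) (f : hom x y) :
  a |>m (g \oc f) = (a |>m g) \oc (a |>m f).
Proof. exact: (bm_cmpr LL). Qed.

Lemma la_dag a x y (f : hom x y) : (a |>m f)^H = a |>m f^H.
Proof. by rewrite dag_lact dag_idm. Qed.

Lemma laZ a x y k (f : hom x y) : a |>m (k *: f) = k *: (a |>m f).
Proof. exact: (bmZr LL). Qed.

(* A functor of the form [x |> -], up to a unitary isomorphism [crho]. Composing
   functors instead of tensoring objects removes the associators of [C] from the
   duality calculus. *)
Record crep := Crep {
  cfun :> functor M M;
  cobj : C;
  crho : forall m, hom (cobj |> m) (cfun m);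
  crhoK : forall m, (crho m)^H \oc crho m = idm _;
  crhoKV : forall m, crho m \oc (crho m)^H = idm _;
  crho_nat : forall m n (f : hom m n),
    fm cfun f \oc crho m = crho n \oc (cobj |>m f) }.

Lemma crep_fm (F : crep) m n (f : hom m n) :
  fm F f = crho F n \oc (cobj F |>m f) \oc (crho F m)^H.
Proof. by rewrite -crho_nat -cmpA crhoKV cmpm1. Qed.

Lemma crep_id (F : crep) m : fm F (idm m) = idm (F m).
Proof. by rewrite crep_fm la_id cmpm1 crhoKV. Qed.

Lemma crep_cmp (F : crep) x y z (g : hom y z) (f : hom x y) :
  fm F (g \oc f) = fm F g \oc fm F f.
Proof.
by rewrite !crep_fm la_cmp !cmpA -[_ \oc (crho F y)^H \oc _]cmpA crhoK cmpm1.
Qed.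

Lemma crep_dag (F : crep) x y (f : hom x y) : (fm F f)^H = fm F f^H.
Proof. by rewrite !crep_fm !dag_cmp dagK la_dag cmpA. Qed.

Lemma crep_linear (F : crep) x y k (f g : hom x y) :
  fm F (k *: f + g) = k *: fm F f + fm F g.
Proof.
by rewrite !crep_fm (bm_linearr LL) cmp_linearr cmp_linearl.
Qed.

Lemma crep_laws (F : crep) : functor_laws F.
Proof.
by split; [apply: crep_id|apply: crep_cmp|apply: crep_linear].
Qed.

Lemma crepZ (F : crep) x y k (f : hom x y) : fm F (k *: f) = k *: fm F f.
Proof. by rewrite !crep_fm laZ cmpZr cmpZl. Qed.

Lemma crep_sum (F : crep) x y (I : Type) (r : seq I) (P : pred I)
    (f : I -> hom x y) :
  fm F (\sum_(i <- r | P i) f i) = \sum_(i <- r | P i) fm F (f i).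
Proof.
rewrite !crep_fm (bm_sumr LL) cmp_sumr cmp_suml.
by apply: eq_bigr => i _; rewrite crep_fm.
Qed.

Definition act_functor (a : C) : functor M M :=
  @Functor R M M (fun m => a |> m) (fun m n f => a |>m f).

Definition act (a : C) : crep.
Proof.
apply: (@Crep (act_functor a) a (fun m => idm _)) => [m|m|m n f] /=.
- by rewrite dag_idm cmp1m.
- by rewrite dag_idm cmp1m.
- by rewrite cmp1m cmpm1.
Defined.

Definition id_crep : crep.
Proof.
apply: (@Crep (@Functor R M M (fun m => m) (fun m n f => f)) one
          (fun m => lunit m)) => [m|m|m n f] /=.
- exact: lunitK.
- exact: lunitKV.
- by rewrite (lunit_natural ML).
Defined.

Definition comp_crep (F G : crep) : crep.
Proof.
apply: (@Crep (@Functor R M M (fun m => F (G m)) (fun m n f => fm F (fm G f)))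
          (tens C (cobj F) (cobj G))
          (fun m => crho F (G m) \oc (cobj F |>m crho G m) \oc lasc _ _ m))
  => [m|m|m n f] /=.
- rewrite !dag_cmp la_dag !cmpA -[_ \oc _ \oc (crho F _)]cmpA crhoK cmpm1.
  by rewrite -[_ \oc _ \oc (_ |>m crho G _)]cmpA -la_cmp crhoK la_id cmpm1
    lascK.
- rewrite !dag_cmp la_dag !cmpA -[_ \oc lasc _ _ _ \oc _]cmpA lascKV cmpm1.
  by rewrite -[_ \oc _ \oc (_ |>m (crho G _)^H)]cmpA -la_cmp crhoKV la_id cmpm1
    crhoKV.
- rewrite !cmpA crho_nat -[_ \oc _ \oc (_ |>m crho G m)]cmpA -la_cmp crho_nat.
  rewrite la_cmp !cmpA -!cmpA -(bm1 (tens_laws C)).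
  by rewrite (lasc_natural ML).
Defined.

(** The family by which a morphism of [C] acts, transported along [crho]; it is determined by [f]
    ([crelE]). *)
Definition crel (F G : crep) (th : forall m, hom (F m) (G m))
    (f : hom (cobj F) (cobj G)) :=
  forall m, th m \oc crho F m = crho G m \oc (f |>f idm m).

Lemma crelE F G th f m : @crel F G th f ->
  th m = crho G m \oc (f |>f idm m) \oc (crho F m)^H.
Proof. by move=> thf; rewrite -thf -cmpA crhoKV cmpm1. Qed.

Lemma crel_cmp F G H th ph f g : @crel F G th f -> @crel G H ph g ->
  @crel F H (fun m => ph m \oc th m) (g \oc f).
Proof.
by move=> thf phg m; rewrite -cmpA thf cmpA phg -cmpA -(bm_cmpl LL).
Qed.

Lemma crel_lw H F G th f : @crel F G th f ->
  @crel (comp_crep H F) (comp_crep H G) (fun m => fm H (th m))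
    (bm (tens C) (idm _) f).
Proof.
move=> thf m; rewrite /= !cmpA crho_nat -[_ \oc _ \oc (_ |>m crho F m)]cmpA.
by rewrite -la_cmp thf la_cmp -!cmpA (lasc_natural ML) !cmpA.
Qed.

Lemma crel_rw H F G th f : @crel F G th f ->
  @crel (comp_crep F H) (comp_crep G H) (fun m => th (H m))
    (bm (tens C) f (idm _)).
Proof.
move=> thf m; rewrite /= !cmpA thf -[_ \oc _ \oc (_ |>m crho H m)]cmpA.
by rewrite (bm_lr LL) -(bm_rl LL) -!cmpA (lasc_natural ML) (bm1 LL) !cmpA.
Qed.

Lemma crel_dag F G th f : @crel F G th f ->
  @crel G F (fun m => (th m)^H) f^h.
Proof.
move=> thf m; rewrite (crelE m thf) !dag_cmp dagK dag_lact dag_idm.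
by rewrite -!cmpA crhoK cmpm1.
Qed.

Lemma crel_id F : @crel F F (fun m => idm _) (idm _).
Proof. by move=> m; rewrite cmp1m (bm1 LL) cmpm1. Qed.

Lemma crel_nat F G th f m n (g : hom m n) : @crel F G th f ->
  th n \oc fm F g = fm G g \oc th m.
Proof.
move=> thf; rewrite !(crelE _ thf) !crep_fm !cmpA.
rewrite -[_ \oc (crho F n)^H \oc _]cmpA crhoK cmpm1.
rewrite -[_ \oc (crho G m)^H \oc _]cmpA crhoK cmpm1.
by rewrite -[_ \oc _ \oc (_ |>m g)]cmpA -[_ \oc _ \oc (_ |>f idm m)]cmpA
  (bm_lr LL) (bm_rl LL).
Qed.

Lemma crho_assoc F G H m :
  crho (comp_crep (comp_crep F G) H) m
    = crho (comp_crep F (comp_crep G H)) m \oc (fwd (asc _ _ _) |>f idm m).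
Proof.
rewrite /= !la_cmp -!cmpA; congr (_ \oc (_ \oc _)).
rewrite [X in _ = _ \oc X]cmpA -(lact_pentagon ML) !cmpA; congr (_ \oc _).
by rewrite -(lasc_natural ML) (bm1 (tens_laws C)).
Qed.

Lemma crho_unitr F m :
  crho (comp_crep F id_crep) m = crho F m \oc (fwd (run _) |>f idm m).
Proof. by rewrite /= -cmpA (lact_triangle ML). Qed.

(* Kelly's argument: [one |> -] is faithful, so the identity may be checked
   after applying it, where the pentagon and the triangle suffice. *)
Lemma lunit_lact a m :
  lunit (a |> m) \oc lasc one a m = fwd (lun a) |>f idm m.
Proof.
have one_inj x y (f g : hom x y) : one |>m f = one |>m g -> f = g.
  move=> fg; rewrite -[f]cmpm1 -(lunitKV x) !cmpA -(lunit_natural ML) fg.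
  by rewrite (lunit_natural ML) -cmpA lunitKV cmpm1.
apply: one_inj; rewrite la_cmp.
have [_ ascV] := asc_inv (one : C) one a.
suff E : (one |>m lunit (a |> m)) \oc (one |>m lasc one a m)
    \oc lasc one _ m \oc (fwd (asc one one a) |>f idm m)
  = (one |>m (fwd (lun a) |>f idm m)) \oc lasc one _ m
    \oc (fwd (asc one one a) |>f idm m).
  move/(congr1 (fun h => h \oc (bwd (asc one one a) |>f idm m))): E.
  rewrite -![_ \oc _ \oc (bwd _ |>f _)]cmpA -(bm_cmpl LL) ascV (bm1 LL) !cmpm1.
  by move/(congr1 (fun h => h \oc (lasc one _ m)^H));
    rewrite -![_ \oc lasc _ _ _ \oc _]cmpA lascKV !cmpm1.
rewrite -[LHS]cmpA -[LHS]cmpA [X in _ \oc X = _]cmpA -(lact_pentagon ML) cmpA.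
rewrite (lact_triangle ML) -(lasc_natural ML) -[RHS]cmpA -(bm_cmpl LL).
by rewrite triangle -(bm1 LL) (lasc_natural ML).
Qed.

Lemma crho_unitl F m :
  crho (comp_crep id_crep F) m = crho F m \oc (fwd (lun _) |>f idm m).
Proof. by rewrite /= (lunit_natural ML) -cmpA lunit_lact. Qed.

(** Both bracketings act by the same functor, and by the pentagon of the action the associator of
    [C] acts on it as an identity family. *)
Lemma crel_assoc F G H :
  @crel (comp_crep (comp_crep F G) H) (comp_crep F (comp_crep G H))
    (fun m => idm (F (G (H m)))) (fwd (asc _ _ _)).
Proof. by move=> m; rewrite crho_assoc cmp1m. Qed.

Lemma crel_unitl F : @crel (comp_crep id_crep F) F (fun m => idm _) (fwd (lun
  _)).
Proof. by move=> m; rewrite crho_unitl cmp1m. Qed.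

Lemma crel_unitr F : @crel (comp_crep F id_crep) F (fun m => idm _) (fwd (run
  _)).
Proof. by move=> m; rewrite crho_unitr cmp1m. Qed.

Lemma crel_inv (F G : crep) (th : forall m, hom (F m) (G m)) (th' : forall m,
  hom (G m) (F m))
    (u : arr (cobj F) (cobj G)) :
  is_inv u -> (forall m, th m \oc th' m = idm _) ->
  (forall m, th' m \oc th m = idm _) -> crel th (fwd u) -> crel th' (bwd u).
Proof.
move=> [_ uV] thV thV' thu m;
  rewrite -[crho G m]cmpm1 -(bm1 LL) -uV (bm_cmpl LL).
by rewrite !cmpA -[_ \oc crho G m \oc _]cmpA -thu !cmpA thV' cmp1m.
Qed.

Lemma crel_assocV F G H :
  @crel (comp_crep F (comp_crep G H)) (comp_crep (comp_crep F G) H)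
    (fun m => idm (F (G (H m)))) (bwd (asc _ _ _)).
Proof.
apply: crel_inv (crel_assoc F G H) => [|m|m]; first exact: asc_inv.
  exact: cmp1m.
exact: cmp1m.
Qed.

Lemma crel_unitlV F : @crel F (comp_crep id_crep F) (fun m => idm _) (bwd (lun
  _)).
Proof.
by apply: crel_inv (crel_unitl F) => [|m|m]; rewrite ?cmp1m //; apply: lun_inv.
Qed.

Lemma crel_unitrV F : @crel F (comp_crep F id_crep) (fun m => idm _) (bwd (run
  _)).
Proof.
by apply: crel_inv (crel_unitr F) => [|m|m]; rewrite ?cmp1m //; apply: run_inv.
Qed.

Lemma crel_ext F G th th' f : @crel F G th f -> (forall m, th m = th' m) ->
  crel th' f.
Proof. by move=> thf e m; rewrite -e. Qed.

(** Turns an equation between morphisms of [C], such as a zigzag identity, into an equation between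
    families in [M]. *)
Lemma crel_inj F G th th' f : @crel F G th f -> @crel F G th' f ->
  forall m, th m = th' m.
Proof. by move=> thf thf' m; rewrite (crelE m thf) (crelE m thf'). Qed.

Definition cfam (F G : crep) (th : forall m, hom (F m) (G m)) :=
  exists f, crel th f.

Lemma cfam_cmp F G H th ph : @cfam F G th -> @cfam G H ph ->
  @cfam F H (fun m => ph m \oc th m).
Proof. by move=> [f ?] [g ?]; exists (g \oc f); apply: crel_cmp. Qed.

Lemma cfam_lw H F G th : @cfam F G th ->
  @cfam (comp_crep H F) (comp_crep H G) (fun m => fm H (th m)).
Proof. by move=> [f ?]; exists (bm (tens C) (idm _) f); apply: crel_lw. Qed.

Lemma cfam_rw H F G th : @cfam F G th ->
  @cfam (comp_crep F H) (comp_crep G H) (fun m => th (H m)).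
Proof. by move=> [f ?]; exists (bm (tens C) f (idm _)); apply: crel_rw. Qed.

Lemma cfam_dag F G th : @cfam F G th -> @cfam G F (fun m => (th m)^H).
Proof. by move=> [f ?]; exists f^h; apply: crel_dag. Qed.

Lemma cfam_nat F G th : @cfam F G th ->
  forall m n (g : hom m n), th n \oc fm F g = fm G g \oc th m.
Proof. by move=> [f thf] m n g; apply: crel_nat thf. Qed.

Lemma cfam_pre (F F' G : crep) th (f : hom (cobj F') (cobj F)) (j : forall m,
  hom (F' m) (F m))
    (th' : forall m, hom (F' m) (G m)) :
  crel j f -> (forall m, th m \oc j m = th' m) -> @cfam F G th -> cfam th'.
Proof.
move=> jf e [g thg]; exists (g \oc f).
exact: crel_ext (crel_cmp jf thg) e.
Qed.

Lemma cfam_post (F G G' : crep) th (f : hom (cobj G) (cobj G')) (j : forall m,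
  hom (G m) (G' m))
    (th' : forall m, hom (F m) (G' m)) :
  crel j f -> (forall m, j m \oc th m = th' m) -> @cfam F G th -> cfam th'.
Proof.
move=> jf e [g thg]; exists (f \oc g).
exact: crel_ext (crel_cmp thg jf) e.
Qed.

(** In this rule and the seven that follow, the functors before and after have convertible values,
    so the family [th] stays the same; only the object of [C] that represents the source or target
    changes. *)
Lemma cfam_srcA F G H K th : @cfam (comp_crep F (comp_crep G H)) K th ->
  @cfam (comp_crep (comp_crep F G) H) K th.
Proof. by apply: cfam_pre (@crel_assoc F G H) _ => m; apply: cmpm1. Qed.

Lemma cfam_srcAV F G H K th : @cfam (comp_crep (comp_crep F G) H) K th ->
  @cfam (comp_crep F (comp_crep G H)) K th.
Proof. by apply: cfam_pre (@crel_assocV F G H) _ => m; apply: cmpm1. Qed.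

Lemma cfam_tgtA F G H K th : @cfam K (comp_crep (comp_crep F G) H) th ->
  @cfam K (comp_crep F (comp_crep G H)) th.
Proof. by apply: cfam_post (@crel_assoc F G H) _ => m; apply: cmp1m. Qed.

Lemma cfam_tgtAV F G H K th : @cfam K (comp_crep F (comp_crep G H)) th ->
  @cfam K (comp_crep (comp_crep F G) H) th.
Proof. by apply: cfam_post (@crel_assocV F G H) _ => m; apply: cmp1m. Qed.

Lemma cfam_src1l F K th : @cfam (comp_crep id_crep F) K th -> @cfam F K th.
Proof. by apply: cfam_pre (@crel_unitlV F) _ => m; apply: cmpm1. Qed.

Lemma cfam_src1r F K th : @cfam (comp_crep F id_crep) K th -> @cfam F K th.
Proof. by apply: cfam_pre (@crel_unitrV F) _ => m; apply: cmpm1. Qed.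

Lemma cfam_tgt1l F K th : @cfam K (comp_crep id_crep F) th -> @cfam K F th.
Proof. by apply: cfam_post (@crel_unitl F) _ => m; apply: cmp1m. Qed.

Lemma cfam_tgt1r F K th : @cfam K (comp_crep F id_crep) th -> @cfam K F th.
Proof. by apply: cfam_post (@crel_unitr F) _ => m; apply: cmp1m. Qed.

(** Schur's lemma with a single scalar for all [m]. Naturality in [m] alone would let the scalar
    vary with the simple objects of [M]. *)
Definition scalar (F : crep) := forall th, @cfam F F th ->
  exists k, forall m, th m = k *: idm (F m).

Lemma scalar_simple F : simple (cobj F) -> scalar F.
Proof.
move=> F1 th [f thf]; exists (sc f) => m.
by rewrite (crelE m thf) [f](scE F1) scZ // (bmZl LL) (bm1 LL) cmpZr cmpZl
  cmpm1 crhoKV.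
Qed.

(** * Standard duals *)

(** An adjunction, [Lb] being left adjoint to [L], whose unit and counit come from [C]. *)
Record dualpair (L Lb : crep) := DualPair {
  eps : forall m, hom (Lb (L m)) m;
  kap : forall m, hom m (L (Lb m));
  eps_cfam : @cfam (comp_crep Lb L) (id_crep) eps;
  kap_cfam : @cfam (id_crep) (comp_crep L Lb) kap;
  zz1 : forall m, fm L (eps m) \oc kap (L m) = idm _;
  zz2 : forall m, eps (Lb m) \oc fm Lb (kap m) = idm _ }.

Lemma eps_nat L Lb (d : dualpair L Lb) m n (f : hom m n) :
  eps d n \oc fm Lb (fm L f) = f \oc eps d m.
Proof. exact: (cfam_nat (eps_cfam d)). Qed.

Lemma kap_nat L Lb (d : dualpair L Lb) m n (f : hom m n) :
  kap d n \oc f = fm L (fm Lb f) \oc kap d m.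
Proof. exact: (cfam_nat (kap_cfam d)). Qed.

(** A family on [Lb] is transposed to a family on [L], where it is a scalar; the zigzag identity
    recovers the original family from its transpose. *)
Lemma scalar_dual L Lb : dualpair L Lb -> scalar L -> scalar Lb.
Proof.
move=> d Ls th thc.
pose g m := fm L (eps d m) \oc (fm L (th (L m)) \oc kap d (L m)).
have [|k kE] := Ls g.
  apply: cfam_tgt1r; apply: cfam_cmp (cfam_lw L (eps_cfam d)).
  apply: cfam_tgtA; apply: cfam_src1l.
  apply: cfam_cmp (cfam_rw L (kap_cfam d)) _.
  apply: cfam_tgtAV; apply: cfam_srcA.
  exact: cfam_lw (cfam_rw L thc).
have epsth m : eps d m \oc th (L m) = k *: eps d m.
  have : eps d m \oc fm Lb (g m) = k *: eps d m.
    by rewrite kE crepZ crep_id cmpZr cmpm1.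
  move=> <-; rewrite /g !crep_cmp cmpA eps_nat cmpA -[_ \oc _ \oc fm Lb (fm L
    _)]cmpA.
  by rewrite eps_nat !cmpA -[LHS]cmpm1 -[in LHS](zz2 d (L m)) -!cmpA.
exists k => m; rewrite -[th m]cmp1m -(zz2 d).
rewrite -cmpA -(cfam_nat thc) cmpA epsth.
by rewrite cmpZl zz2.
Qed.

Definition comp_pair L1 Lb1 L2 Lb2 (d1 : dualpair L1 Lb1) (d2 : dualpair L2
  Lb2) :
  dualpair (comp_crep L1 L2) (comp_crep Lb2 Lb1).
Proof.
apply: (@DualPair (comp_crep L1 L2) (comp_crep Lb2 Lb1) (fun m => eps d2 m \oc
  fm Lb2 (eps d1 (L2 m)))
  (fun m => fm L1 (kap d2 (Lb1 m)) \oc kap d1 m)) => [||m|m] /=.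
- apply: cfam_cmp (eps_cfam d2); apply: cfam_srcA; apply: cfam_lw.
  by apply: cfam_tgt1l; apply: cfam_srcAV; apply: cfam_rw; apply: eps_cfam.
- apply: cfam_cmp (kap_cfam d1) _; apply: cfam_tgtAV; apply: cfam_lw.
  by apply: cfam_src1l; apply: cfam_tgtA; apply: cfam_rw; apply: kap_cfam.
- rewrite !crep_cmp cmpA -[_ \oc _ \oc fm L1 (kap d2 _)]cmpA -crep_cmp.
  rewrite -kap_nat crep_cmp cmpA -[fm L1 _ \oc _]crep_cmp zz1 crep_id cmp1m.
  by rewrite zz1.
- rewrite !crep_cmp cmpA -[_ \oc _ \oc fm Lb2 (fm Lb1 (fm L1 _))]cmpA -crep_cmp.
  rewrite eps_nat crep_cmp cmpA zz2 cmp1m -crep_cmp zz2.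
  by rewrite crep_id.
Defined.

Definition normed L Lb (d : dualpair L Lb) (q : R[i]) :=
  (forall m, eps d m \oc (eps d m)^H = q *: idm m) /\
  (forall m, (kap d m)^H \oc kap d m = q *: idm m).

(* Both closures of [th] equal the mixed one, in which the first factor is
   closed on the left and the second on the right. *)
Lemma spherical L1 Lb1 L2 Lb2 (d1 : dualpair L1 Lb1) (d2 : dualpair L2 Lb2)
    q1 q2 (d := comp_pair d1 d2) (b : irr M) th :
  normed d1 q1 -> normed d2 q2 -> scalar L1 -> scalar L2 ->
  @cfam (comp_crep L1 L2) (comp_crep L1 L2) th ->
  exists p,
    (forall m, eps d m \oc fm (comp_crep Lb2 Lb1) (th m) \oc (eps d m)^H
       = p *: idm m) /\
    (forall m, (kap d m)^H \oc th (Lb2 (Lb1 m)) \oc kap d m = p *: idm m).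
Proof.
move=> [e1 k1] [e2 k2] s1 s2 thc.
have [|l lE] := s2 (fun m => eps d1 (L2 m) \oc (fm Lb1 (th m) \oc (eps d1 (L2
  m))^H)).
  have epsc : @cfam (comp_crep Lb1 (comp_crep L1 L2)) L2
      (fun m => eps d1 (L2 m)).
    by apply: cfam_tgt1l; apply: cfam_srcAV; apply: cfam_rw; apply: eps_cfam.
  by apply: cfam_cmp (epsc); apply: cfam_cmp (cfam_dag epsc) (cfam_lw Lb1 thc).
have [|r rE] := s1 (fun m => fm L1 (kap d2 m)^H \oc (th (Lb2 m) \oc fm L1 (kap
  d2 m))).
  have kapc : @cfam L1 (comp_crep (comp_crep L1 L2) Lb2)
      (fun m => fm L1 (kap d2 m)).
    by apply: cfam_src1r; apply: cfam_tgtAV; apply: cfam_lw; apply: kap_cfam.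
  have kapc' : @cfam (comp_crep (comp_crep L1 L2) Lb2) L1
      (fun m => fm L1 (kap d2 m)^H).
    have := cfam_dag kapc; case=> f fE; exists f.
    by apply: crel_ext fE _ => m; rewrite crep_dag.
  by apply: cfam_cmp kapc'; apply: cfam_cmp kapc (cfam_rw Lb2 thc).
have epsE m : eps d m \oc fm (comp_crep Lb2 Lb1) (th m) \oc (eps d m)^H
    = (l * q2) *: idm m.
  rewrite /= dag_cmp crep_dag !cmpA.
  rewrite -[_ \oc fm Lb2 _ \oc fm Lb2 _]cmpA -crep_cmp.
  rewrite -[_ \oc fm Lb2 _ \oc fm Lb2 _]cmpA -crep_cmp lE crepZ crep_id cmpZr
    cmpm1 cmpZl e2.
  by rewrite scalerA.
have kapE m : (kap d m)^H \oc th (Lb2 (Lb1 m)) \oc kap d m = (r * q1) *: idm m.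
  rewrite /= dag_cmp crep_dag !cmpA -[_ \oc fm L1 _ \oc th _]cmpA.
  rewrite -[_ \oc _ \oc fm L1 _]cmpA -[_ \oc th _ \oc _]cmpA rE cmpZr cmpm1
    cmpZl k1.
  by rewrite scalerA.
exists (l * q2); split=> // m; rewrite kapE; congr (_ *: _).
apply: (scale_idI (smp_simple b)).
transitivity (eps d1 (smp b) \oc (fm Lb1 (fm L1 (kap d2 (smp b))^H \oc
    (th (Lb2 (smp b)) \oc fm L1 (kap d2 (smp b)))) \oc (eps d1 (smp b))^H)).
  by rewrite rE crepZ crep_id cmpZl cmp1m cmpZr e1 scalerA.
have epsD : fm Lb1 (fm L1 (kap d2 (smp b))) \oc (eps d1 (smp b))^H
    = (eps d1 _)^H \oc kap d2 (smp b).
  have := congr1 (@dag _ _ (ub_star M) _ _) (eps_nat d1 (kap d2 (smp b))^H).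
  by rewrite !dag_cmp !crep_dag dagK.
rewrite !crep_cmp -!cmpA epsD !cmpA eps_nat -!cmpA.
rewrite [X in _ \oc X]cmpA [X in _ \oc X]cmpA -[X in _ \oc (X \oc _)]cmpA lE.
by rewrite cmpZl cmp1m cmpZr k2 scalerA.
Qed.

Definition dmate L Lb (d : dualpair L Lb) m n (f : hom m (L n)) : hom (Lb m) n
  :=
  eps d n \oc fm Lb f.

Lemma dmateK L Lb (d : dualpair L Lb) m n (f : hom m (L n)) :
  fm L (dmate d f) \oc kap d m = f.
Proof.
by rewrite /dmate crep_cmp -cmpA -kap_nat cmpA zz1 cmp1m.
Qed.

Lemma dmateV L Lb (d : dualpair L Lb) m n (h : hom (Lb m) n) :
  dmate d (fm L h \oc kap d m) = h.
Proof.
by rewrite /dmate crep_cmp cmpA eps_nat -cmpA zz2 cmpm1.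
Qed.

Lemma dmate_nat L Lb (d : dualpair L Lb) m n k (h : hom n k) (f : hom m (L n)) :
  h \oc dmate d f = dmate d (fm L h \oc f).
Proof. by rewrite /dmate crep_cmp cmpA -eps_nat cmpA. Qed.

Lemma cfam_dmate L Lb (d : dualpair L Lb) (F G : crep)
    (th : forall m, hom (F m) (L (G m))) :
  @cfam F (comp_crep L G) th ->
  @cfam (comp_crep Lb F) G (fun m => dmate d (th m)).
Proof.
move=> thc; apply: cfam_cmp (cfam_lw Lb thc) _.
by apply: cfam_tgt1l; apply: cfam_srcAV; apply: cfam_rw; apply: eps_cfam.
Qed.

(** [Lb m] is nonzero, because closing its identity with [kap] gives the nonzero loop [q]. *)
Lemma normed_inj L Lb (d : dualpair L Lb) q m k l : normed d q -> q != 0 ->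
  simple m -> k *: idm (Lb m) = l *: idm (Lb m) -> k = l.
Proof.
move=> [_ kq] q0 m1 kl; apply: (mulIf q0); apply: (scale_idI m1).
have E c : (c * q) *: idm m
    = (kap d m)^H \oc (fm L (c *: idm (Lb m)) \oc kap d m).
  by rewrite crepZ crep_id cmpZl cmp1m cmpZr kq scalerA.
by rewrite !E kl.
Qed.

(* The two transposes [u i] and [(v i)^H] of [g i] have the same Gram matrix
   [p / q], and these Gram matrices are inverse to each other because [u] and
   [v] are dual and the [u i] span. Hence [p i i <= q], while positivity of
   [u i - (v i)^H] gives [q <= p i i]. *)
Section StandardNorm.
Variables (Y Yb X Xb : crep) (dY : dualpair Y Yb) (dX : dualpair X Xb).
Variables (q : R[i]) (b : irr M) (n : nat).
Variables (g : 'I_n -> forall m, hom (Y m) (X m)) (p : 'I_n -> 'I_n -> R[i]).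
Hypotheses (q_gt0 : 0 < q) (dXq : normed dX q) (X_scalar : scalar X).
Hypothesis gc : forall i, cfam (g i).
Hypothesis g_orth : forall i j m,
  g i m \oc (g j m)^H = (i == j)%:R *: idm (X m).
Hypothesis g_complete : forall th, @cfam Y X th ->
  exists c : 'I_n -> R[i], forall m, th m = \sum_i c i *: g i m.
Hypothesis p_eps : forall i j m,
  eps dY m \oc fm Yb ((g j m)^H \oc g i m) \oc (eps dY m)^H = p j i *: idm m.
Hypothesis p_kap : forall i j m,
  (kap dY m)^H \oc ((g j (Yb m))^H \oc g i (Yb m)) \oc kap dY m = p j i *: idm
    m.

Let u i m : hom (Xb m) (Yb m) := dmate dX (g i (Yb m) \oc kap dY m).
Let v i m : hom (Yb m) (Xb m) := dmate dY ((g i (Xb m))^H \oc kap dX m).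

Let uc i : cfam (u i).
Proof.
apply: cfam_src1r; apply: cfam_dmate; apply: cfam_cmp (kap_cfam dY) _.
exact: cfam_rw (gc i).
Qed.

Let vc i : cfam (v i).
Proof.
apply: cfam_src1r; apply: cfam_dmate; apply: cfam_cmp (kap_cfam dX) _.
exact: cfam_rw (cfam_dag (gc i)).
Qed.

Let vu i j m : v j m \oc u i m = (i == j)%:R *: idm (Xb m).
Proof.
rewrite /u dmate_nat cmpA -(cfam_nat (gc i)) -cmpA dmateK cmpA g_orth.
by rewrite cmpZl cmp1m /dmate crepZ cmpZr zz2.
Qed.

Let q_neq0 : q != 0. Proof. by rewrite gt_eqF. Qed.

Let uu i j m : (u j m)^H \oc u i m = (p j i / q) *: idm (Xb m).
Proof.
have Xbs := scalar_dual dX X_scalar.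
have [k kE] := Xbs _ (cfam_cmp (uc i) (cfam_dag (uc j))).
rewrite kE; congr (_ *: _); apply: (mulIf q_neq0); rewrite mulfVK //.
apply: (scale_idI (smp_simple b)); rewrite -(p_kap i j).
transitivity ((kap dX (smp b))^H
    \oc (fm X (k *: idm (Xb (smp b))) \oc kap dX (smp b))).
  by rewrite crepZ crep_id cmpZl cmp1m cmpZr (proj2 dXq) scalerA.
rewrite -kE crep_cmp -crep_dag -cmpA dmateK !cmpA -dag_cmp dmateK.
by rewrite dag_cmp.
Qed.

Let vv i j m : v j m \oc (v i m)^H = (p j i / q) *: idm (Xb m).
Proof.
have Xbs := scalar_dual dX X_scalar.
have [k kE] := Xbs _ (cfam_cmp (cfam_dag (vc i)) (vc j)).
rewrite kE; congr (_ *: _); apply: (mulIf q_neq0); rewrite mulfVK //.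
apply: (scale_idI (smp_simple b)); rewrite -(p_eps i j).
have ev h : eps dX (smp b) \oc v h (X (smp b))
    = eps dY (smp b) \oc fm Yb (g h (smp b))^H.
  have gn m' n' (f : hom m' n') :
    (g h n')^H \oc fm X f = fm Y f \oc (g h m')^H :=
      cfam_nat (cfam_dag (gc h)) f.
  by rewrite /v dmate_nat cmpA -gn -cmpA zz1 cmpm1.
transitivity (eps dX (smp b) \oc (k *: idm (Xb (X (smp b))))
    \oc (eps dX (smp b))^H).
  by rewrite cmpZr cmpm1 cmpZl (proj1 dXq) scalerA.
rewrite -kE cmpA -cmpA -dag_cmp !ev dag_cmp crep_dag dagK crep_cmp.
by rewrite !cmpA.
Qed.

(** Bending both legs of [(v j)^H] gives a family from [Y] to [X], hence a combination of the [g i];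
    bending back turns [g i] into [u i]. *)
Let vE j : exists c : 'I_n -> R[i], forall m, (v j m)^H = \sum_i c i *: u i m.
Proof.
pose w m := (v j m)^H.
have wc : cfam w := cfam_dag (vc j).
have [|c cE] := @g_complete (fun m => fm X (eps dY m \oc w (Y m)) \oc kap dX (Y
  m)).
  apply: cfam_src1l; apply: cfam_cmp (cfam_rw Y (kap_cfam dX)) _.
  apply: cfam_srcA; apply: cfam_tgt1r; apply: cfam_lw.
  apply: cfam_cmp (eps_cfam dY); exact: cfam_rw.
exists c => m; rewrite -/(w m) -[LHS](dmateV dX).
transitivity (dmate dX (\sum_i c i *: (g i (Yb m) \oc kap dY m))).
  congr dmate; under eq_bigr do rewrite -cmpZl.
  rewrite -cmp_suml -cE -cmpA kap_nat cmpA -crep_cmp -cmpA (cfam_nat wc).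
  by rewrite cmpA zz2 cmp1m.
rewrite /dmate crep_sum cmp_sumr; apply: eq_bigr => i _.
by rewrite crepZ cmpZr.
Qed.

Lemma standard_norm i : p i i = q.
Proof.
have pC k l : p l k = (p k l)^*.
  apply: (scale_idI (smp_simple b)); rewrite -(p_kap k l).
  have := congr1 (@dag _ _ (ub_star M) _ _) (p_kap l k (smp b)).
  by rewrite dagZ dag_idm => <-; rewrite !dag_cmp !dagK !cmpA.
have p_ge_q : q <= p i i.
  pose z := fm X (u i (smp b) - (v i (smp b))^H) \oc kap dX (smp b).
  (* The four terms of the square are [p i i / q] twice ([uu], [vv]) and -1 twice ([vu] and its
     adjoint); closing with [kap] multiplies their sum by [q]. *)
  have zz : z^H \oc z = ((p i i - q) *+ 2) *: idm (smp b).
    rewrite /z dag_cmp crep_dag -cmpA [X in _ \oc X]cmpA -crep_cmp.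
    rewrite -scaleN1r dagD dagZ dagK rmorphN1 cmpDl !cmpDr !cmpZl !cmpZr.
    have := congr1 (@dag _ _ (ub_star M) _ _) (vu i i (smp b)).
    rewrite dag_cmp dagZ dag_idm rmorph_nat => ->.
    rewrite uu vu vv eqxx !scalerA -!scalerDl crepZ crep_id.
    rewrite cmpZl cmp1m cmpZr (proj2 dXq) scalerA; congr (_ *: _).
    by rewrite /=; field.
  have := simple_dag_ge0 (smp_simple b) zz.
  by rewrite pmulrn_lge0 // subr_ge0.
have [c cE] := vE i.
have cp k : c k = p k i / q.
  apply: (normed_inj dXq q_neq0 (smp_simple b)).
  rewrite -(vv i k) cE cmp_sumr (bigD1 k) //= big1 ?addr0 => [|l lk].
    by rewrite cmpZr vu eqxx scale1r.
  by rewrite cmpZr vu (negbTE lk) scale0r scaler0.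
(* Substituting the expansion of [(v i)^H] in the [u k] into the adjoint of [v i \oc u i = 1] gives
   a sum of products of Gram entries equal to 1. *)
have pp : \sum_k p i k * p k i = q ^+ 2.
  apply: (mulIf (invr_neq0 q_neq0)); apply: (mulIf (invr_neq0 q_neq0)).
  rewrite -[RHS]mulrA -expr2 -exprMn mulfV // expr1n.
  apply: (normed_inj dXq q_neq0 (smp_simple b)).
  have := congr1 (@dag _ _ (ub_star M) _ _) (vu i i (smp b)).
  rewrite dag_cmp dagZ dag_idm rmorph_nat eqxx => <-.
  rewrite cE cmp_sumr -mulrA mulr_suml scaler_suml; apply: eq_bigr => k _.
  rewrite cmpZr uu scalerA cp; congr (_ *: _).
  by field.
apply/eqP; rewrite eq_le p_ge_q andbT.
have p_ge0 : 0 <= p i i by apply: le_trans p_ge_q; apply: ltW.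
have q_ge0 := ltW q_gt0.
rewrite -(ler_pXn2r (n := 2)) ?nnegrE //.
rewrite -pp (bigD1 i) //= -expr2 lerDl sumr_ge0 // => k _.
by rewrite [p k i]pC mul_conjC_ge0.
Qed.

End StandardNorm.

(** The zigzag identities fix only the product of the scalings of evaluation and coevaluation. The
    remaining freedom equalizes the two loops, which are nonzero because [x] is. *)
Lemma balanced_dual (x : C) : simple x ->
  exists (e : hom (tens C (dual x) x) one) (k : hom one (tens C x (dual x))) q,
  [/\ 0 < q, e \oc e^h = q *: idm one, k^h \oc k = q *: idm one,
    fwd (run x) \oc bm (tens C) (idm x) e \oc fwd (asc x (dual x) x)
      \oc bm (tens C) k (idm x) \oc bwd (lun x) = idm x &
    fwd (lun (dual x)) \oc bm (tens C) e (idm (dual x))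
      \oc bwd (asc (dual x) x (dual x)) \oc bm (tens C) (idm (dual x)) k
      \oc bwd (run (dual x)) = idm (dual x)].
Proof.
move=> x1; have TL := tens_laws C; have [zz zzd] := (zigzag x, zigzag_dual x).
have [de deE] := simple_scal (one_simple C) (ev x \oc (ev x)^h).
have [dk dkE] := simple_scal (one_simple C) ((coev x)^h \oc coev x).
have de_gt0 : 0 < de.
  apply: (simple_dag_gt0 (s := ufus_star C) (f := (ev x)^h) (one_simple C)).
    apply: contraNneq (simple_neq0 x1) => e0.
    rewrite -zz -[ev x](dagK (ufus_star C)) e0 dag0 (bm0r TL).
    by rewrite cmp0r !cmp0l.
  by rewrite dagK.
have dk_gt0 : 0 < dk.
  apply: (simple_dag_gt0 (s := ufus_star C) (f := coev x) (one_simple C)) => //.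
  apply: contraNneq (simple_neq0 x1) => e0.
  by rewrite -zz e0 (bm0l TL) cmp0r !cmp0l.
(* With the fourth power of [t] equal to [dk / de], the rescaled loops [t ^+ 2 * de] and
   [dk / t ^+ 2] agree. *)
pose t := sqrtC (sqrtC (dk / de)).
have t_gt0 : 0 < t by rewrite !sqrtC_gt0 divr_gt0.
have t0 : t != 0 by rewrite gt_eqF.
have tC : t^* = t by apply/CrealP/gtr0_real.
have tVC : (t^-1)^* = t^-1 by apply/CrealP/gtr0_real; rewrite invr_gt0.
have t4 : t ^+ 2 * t ^+ 2 = dk / de by rewrite -expr2 !sqrtCK.
exists (t *: ev x), (t^-1 *: coev x), (t ^+ 2 * de); split.
- by rewrite mulr_gt0 ?exprn_gt0.
- by rewrite dagZ cmpZl cmpZr deE !scalerA tC expr2.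
- rewrite dagZ cmpZl cmpZr dkE !scalerA tVC; congr (_ *: _).
  have -> : dk = t ^+ 2 * t ^+ 2 * de by rewrite t4 divfK // gt_eqF.
  by field.
- rewrite (bmZr TL) (bmZl TL) !(cmpZr, cmpZl) scalerA.
  by rewrite ?mulfV ?mulVf // scale1r.
- rewrite (bmZr TL) (bmZl TL) !(cmpZr, cmpZl) scalerA.
  by rewrite ?mulfV ?mulVf // scale1r.
Qed.

Lemma crho_act2 (a a' : C) m :
  crho (comp_crep (act a) (act a')) m = lasc a a' m.
Proof. by rewrite /= cmp1m la_id cmp1m. Qed.

Lemma standard_pair (x : C) : simple x ->
  exists dq : dualpair (act x) (act (dual x)) * R[i],
    0 < dq.2 /\ normed dq.1 dq.2.
Proof.
move=> x1; have [e [k [q [q0 eE kE z1 z2]]]] := balanced_dual x1.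
pose ep m := lunit m \oc (e |>f idm m) \oc (lasc (dual x) x m)^H.
pose ka m := lasc x (dual x) m \oc (k |>f idm m) \oc (lunit m)^H.
have epc : @crel (comp_crep (act (dual x)) (act x)) (id_crep) ep e.
  by move=> m; rewrite crho_act2 -cmpA lascK cmpm1.
have kac : @crel (id_crep) (comp_crep (act x) (act (dual x))) ka k.
  by move=> m; rewrite crho_act2 -cmpA lunitK cmpm1.
(* The zigzag composites of [C] read as composites of families: unitors and associators act as
   identities, so only [ep] and [ka] remain. *)
have zz1c := crel_cmp (crel_cmp (crel_cmp (crel_cmp (crel_unitlV (act x))
  (crel_rw (act x) kac)) (crel_assoc _ _ _)) (crel_lw (act x) epc))
  (crel_unitr (act x)).
have zz2c := crel_cmp (crel_cmp (crel_cmp (crel_cmp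
  (crel_unitrV (act (dual x))) (crel_lw (act (dual x)) kac))
  (crel_assocV _ _ _)) (crel_rw (act (dual x)) epc))
  (crel_unitl (act (dual x))).
rewrite !cmpA /= z1 in zz1c; rewrite !cmpA /= z2 in zz2c.
have zz1 m : x |>m ep m \oc ka (x |> m) = idm (x |> m).
  by have := crel_inj zz1c (crel_id _) m; rewrite /= cmpm1 !cmp1m.
have zz2 m : ep (dual x |> m) \oc (dual x |>m ka m) = idm (dual x |> m).
  by have := crel_inj zz2c (crel_id _) m; rewrite /= cmpm1 !cmp1m.
exists (@DualPair (act x) (act (dual x)) ep ka
  (ex_intro _ e epc) (ex_intro _ k kac) zz1 zz2, q).
split=> //=; split=> m /=.
- rewrite /ep !dag_cmp dagK !cmpA -[_ \oc (lasc _ _ _)^H \oc _]cmpA lascK cmpm1.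
  rewrite dag_lact dag_idm -[_ \oc _ \oc (e^h |>f _)]cmpA -(bm_cmpl LL) eE.
  by rewrite (bmZl LL) (bm1 LL) cmpZr cmpZl cmpm1 lunitKV.
- rewrite /ka !dag_cmp dagK !cmpA -[_ \oc (lasc _ _ _)^H \oc _]cmpA lascK cmpm1.
  rewrite dag_lact dag_idm -[_ \oc _ \oc (k |>f _)]cmpA -(bm_cmpl LL) kE.
  by rewrite (bmZl LL) (bm1 LL) cmpZr cmpZl cmpm1 lunitKV.
Qed.

(* [stdq a] is the common value of both loops of the balanced dual of [a]; it
   turns out to be the Frobenius-Perron dimension, see [stdqE]. *)
Definition stdp (a : irr C) :
    dualpair (act (smp a)) (act (dual (smp a))) * R[i] :=
  sval (boolp.cid (standard_pair (smp_simple a))).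
Definition stdd a := (stdp a).1.
Definition stdq a := (stdp a).2.

Lemma stdq_gt0 a : 0 < stdq a.
Proof. by rewrite /stdq /stdp; case: boolp.cid => ? []. Qed.

Lemma std_normed a : normed (stdd a) (stdq a).
Proof. by rewrite /stdd /stdq /stdp; case: boolp.cid => ? []. Qed.

Lemma act_scalar (a : irr C) : scalar (act (smp a)).
Proof. exact: (@scalar_simple (act (smp a)) (smp_simple a)). Qed.

(** * Multiplicativity of the loop value *)

Definition fuse (a a' x : C) (f : hom (tens C a a') x) m :
  hom (a |> (a' |> m)) (x |> m) := (f |>f idm m) \oc (lasc a a' m)^H.

Lemma fuse_crel a a' x (f : hom (tens C a a') x) :
  @crel (comp_crep (act a) (act a')) (act x) (fuse f) f.
Proof. by move=> m; rewrite crho_act2 /fuse -cmpA lascK cmpm1 cmp1m. Qed.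

Lemma fuse_cfam a a' x (f : hom (tens C a a') x) :
  @cfam (comp_crep (act a) (act a')) (act x) (fuse f).
Proof. by exists f; apply: fuse_crel. Qed.

Lemma crel_fuse a a' x th f :
  @crel (comp_crep (act a) (act a')) (act x) th f ->
  forall m, th m = fuse f m.
Proof. by move=> thf m; rewrite (crel_inj thf (fuse_crel f)). Qed.

Lemma fuse_dag a a' x (f : hom (tens C a a') x) m :
  (fuse f m)^H = lasc a a' m \oc (f^h |>f idm m).
Proof. by rewrite /fuse dag_cmp dagK dag_lact dag_idm. Qed.

Lemma fuse_cmp a a' x y (f : hom (tens C a a') x) (g : hom (tens C a a') y) m :
  fuse g m \oc (fuse f m)^H = (g \oc f^h) |>f idm m.
Proof.
by rewrite fuse_dag /fuse cmpA -[_ \oc (lasc _ _ _)^H \oc _]cmpA lascK cmpm1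
  -(bm_cmpl LL).
Qed.

Lemma fuse_sum a a' x (I : finType) (c : I -> R[i])
    (f : I -> hom (tens C a a') x) m :
  fuse (\sum_i c i *: f i) m = \sum_i c i *: fuse (f i) m.
Proof.
rewrite /fuse (bm_suml LL) cmp_suml; apply: eq_bigr => i _.
by rewrite (bmZl LL) cmpZl.
Qed.

Lemma fuse_complete a a' m :
  \sum_x \sum_i ((fuse (onb (ufus_star C) (m := tens C a a') (e := x) i) m)^H
     \oc fuse (onb (ufus_star C) (e := x) i) m) = idm (a |> (a' |> m)).
Proof.
transitivity (lasc a a' m \oc (idm (tens C a a') |>f idm m) \oc (lasc a a'
  m)^H).
  rewrite -(onb_complete (ufus_star C)) (bm_suml LL) cmp_sumr cmp_suml.
  apply: eq_bigr => x _; rewrite (bm_suml LL) cmp_sumr cmp_suml.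
  by apply: eq_bigr => i _; rewrite fuse_dag /fuse (bm_cmpl LL) !cmpA.
by rewrite (bm1 LL) cmpm1 lascKV.
Qed.

Lemma comp_pair_eps L1 Lb1 L2 Lb2 (d1 : @dualpair L1 Lb1)
    (d2 : @dualpair L2 Lb2) q1 q2 m :
  normed d1 q1 -> normed d2 q2 ->
  eps (comp_pair d1 d2) m \oc (eps (comp_pair d1 d2) m)^H = (q1 * q2) *: idm m.
Proof.
move=> [e1 _] [e2 _]; rewrite /= dag_cmp crep_dag !cmpA.
rewrite -[_ \oc fm Lb2 _ \oc fm Lb2 _]cmpA -crep_cmp e1 crepZ crep_id.
by rewrite cmpZr cmpm1 cmpZl e2 scalerA.
Qed.

(** The loop of the composite pair is [stdq a * stdq a']. Cutting its identity along orthonormal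
    morphisms onto simple objects [x] leaves one loop [p x i i] for each basis vector. By
    [spherical] the left and right closures share the matrix [p], so [standard_norm] evaluates each
    of these loops to [stdq x]. *)
Lemma stdqM (b : irr M) a a' : stdq a * stdq a'
  = \sum_x (hdim (tens C (smp a) (smp a')) (smp x))%:R * stdq x.
Proof.
pose d := comp_pair (stdd a) (stdd a').
pose g x i m := fuse (onb (ufus_star C) (m := tens C (smp a) (smp a')) (e := x)
  i) m.
pose p x j i := sc (eps d (smp b) \oc
  fm (comp_crep (act (dual (smp a'))) (act (dual (smp a))))
    ((g x j (smp b))^H \oc g x i (smp b)) \oc (eps d (smp b))^H).
have pP x i j : (forall m, eps d m \oc
      fm (comp_crep (act (dual (smp a'))) (act (dual (smp a))))
        ((g x j m)^H \oc g x i m) \oc (eps d m)^H = p x j i *: idm m) /\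
    (forall m, (kap d m)^H \oc ((g x j (dual (smp a') |> (dual (smp a) |> m)))^H
      \oc g x i (dual (smp a') |> (dual (smp a) |> m))) \oc kap d m
      = p x j i *: idm m).
  have gc k := fuse_cfam (onb (ufus_star C) (m := tens C (smp a) (smp a')) (e
    := x) k).
  have [p0 [pe pk]] := spherical b (std_normed a) (std_normed a')
    (@act_scalar a) (@act_scalar a') (cfam_cmp (gc i) (cfam_dag (gc j))).
  by rewrite /p pe scZ.
have pq x i : p x i i = stdq x.
  apply: (@standard_norm _ _ _ _ d (stdd x) (stdq x) b _ (g x) (p x)).
  - exact: stdq_gt0.
  - exact: std_normed.
  - exact: act_scalar.
  - by move=> k; apply: fuse_cfam.
  - move=> k l m; rewrite /g fuse_cmp onbP (bmZl LL) (bm1 LL).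
    by [].
  - move=> th [f thf]; exists (fun k => sc (f \oc (onb (ufus_star C) k)^h)) =>
    m.
    rewrite (crel_fuse thf) {1}[f](onb_expand (ufus_star C)) fuse_sum.
    by [].
  - by move=> k l m; have [-> _] := pP x k l.
  - by move=> k l m; have [_ ->] := pP x k l.
apply: (scale_idI (smp_simple b)).
rewrite -(comp_pair_eps (smp b) (std_normed a) (std_normed a')).
transitivity (eps d (smp b) \oc
  fm (comp_crep (act (dual (smp a'))) (act (dual (smp a)))) (idm _)
  \oc (eps d (smp b))^H); first by rewrite crep_id cmpm1.
rewrite -(fuse_complete (smp a) (smp a')) crep_sum cmp_sumr cmp_suml
  scaler_suml.
apply: eq_bigr => x _; rewrite crep_sum cmp_sumr cmp_suml.
transitivity (\sum_(i < hdim (tens C (smp a) (smp a')) (smp x)) p x i i *: idm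
  (smp b)).
  by apply: eq_bigr => i _; have [-> _] := pP x i i.
under eq_bigr do rewrite pq.
by rewrite sumr_const card_ord -scaler_nat scalerA.
Qed.

Section Dimensions.
Variables (dC : irr C -> R) (dM : irr M -> R).
Hypotheses (dC_FPdim : is_FPdim dC) (dM_dim : is_module_dim dC dM).
Local Notation q := stdq.

Local Notation dual_ a := (dual (smp a)).

Definition wt (e : irr M) : R[i] := (dM e)%:C%C.

Lemma stdqE (b0 : irr M) a : q a = (dC a)%:C%C.
Proof.
(* The Perron-Frobenius argument is over [R]; being positive, [q x] equals its real part. *)
have qR x : (complex.Re (q x))%:C%C = q x by rewrite RRe_real ?gtr0_real
  ?stdq_gt0.
rewrite (@FPdim_unique _ _ dC (fun x => complex.Re (q x))) ?qR // => [x|x y].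
  by rewrite -ltcR qR stdq_gt0.
apply: (fmorph_inj (real_complex R));
  rewrite rmorphM rmorph_sum /= !qR (stdqM b0).
by apply: eq_bigr => z _; rewrite rmorphM rmorph_nat /= qR.
Qed.

Lemma wt_gt0 e : 0 < wt e.
Proof. by rewrite /wt ltcR; case: dM_dim. Qed.

Lemma wt_neq0 e : wt e != 0. Proof. by rewrite gt_eqF ?wt_gt0. Qed.

Lemma wt_conj e : (wt e)^* = wt e.
Proof. by apply/CrealP/gtr0_real/wt_gt0. Qed.

Lemma wtM a b : q a * wt b = \sum_e (ldim a b e)%:R * wt e.
Proof.
have [_ + _] := dM_dim => /(_ a b) /(congr1 (real_complex R)).
rewrite rmorphM rmorph_sum /= -(stdqE b) => ->.
by apply: eq_bigr => e _; rewrite rmorphM rmorph_nat.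
Qed.

(** * Partial traces and the weighted trace *)

Section Phi.
Variable a : irr C.
Local Notation d := (stdd a).

Definition ptr m (f : hom (smp a |> m) (smp a |> m)) : hom m m :=
  eps d m \oc (dual_ a |>m f) \oc (eps d m)^H.

(** Frobenius reciprocity in two ways. [al] and [be] are orthonormal bases of the morphisms from
    [a |> b] to [e] and from [a^* |> e] to [b]; [A] compares them by bending along [eps], and [B] by
    bending along [kap]. *)
Let al b e := @onb _ _ sM (smp a |> smp b) e.
Let be e b := @onb _ _ sM (dual_ a |> smp e) b.
Arguments al : clear implicits.
Arguments be : clear implicits.
Let A b e i k := sc (dmate d (al b e i)^H \oc (be e b k)^H).
Let B b e i k :=
  sc ((kap d (smp e))^H \oc (smp a |>m (be e b k)^H) \oc (al b e i)^H).

Arguments A : clear implicits.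
Arguments B : clear implicits.

Let alE b e i : al b e i
  = (kap d (smp e))^H \oc (smp a |>m (dmate d (al b e i)^H)^H).
Proof.
rewrite -[LHS](dagK sM) -[X in X^H](dmateK d) dag_cmp; congr (_ \oc _).
exact: la_dag.
Qed.

Let sum_AA b e i j : \sum_k A b e i k * (A b e j k)^*
  = sc (dmate d (al b e i)^H \oc (dmate d (al b e j)^H)^H).
Proof.
rewrite (sc_insert sM); apply: eq_bigr => k _; congr (_ * _).
by rewrite -(sc_dag sM) // dag_cmp dagK.
Qed.

Let ptr_al b e i j : ptr ((al b e i)^H \oc al b e j)
  = (\sum_k A b e i k * (A b e j k)^*) *: idm (smp b).
Proof.
rewrite sum_AA -(scE (smp_simple b)) /ptr la_cmp dag_cmp crep_dag dagK.
by rewrite !cmpA.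
Qed.

Let sum_AB b e i j : \sum_k (A b e i k)^* * B b e j k = (i == j)%:R.
Proof.
transitivity (sc (al b e i \oc (al b e j)^H)); last by rewrite onbP scZ.
rewrite {1}alE (onb_expand sM (dmate d (al b e i)^H)) dag_sum (bm_sumr LL).
rewrite cmp_sumr cmp_suml sc_sum; apply: eq_bigr => k _.
by rewrite dagZ laZ cmpZr cmpZl sc_scale.
Qed.

Let normA b : \sum_e \sum_i \sum_k A b e i k * (A b e i k)^* = q a.
Proof.
apply: (scale_idI (smp_simple b)).
rewrite -(proj1 (std_normed a) (smp b)).
transitivity (ptr (idm (smp a |> smp b))); last by rewrite /ptr la_id cmpm1.
rewrite -(onb_complete sM (smp a |> smp b)) /ptr (bm_sumr LL) cmp_sumr cmp_suml
  scaler_suml.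
apply: eq_bigr => e _; rewrite (bm_sumr LL) cmp_sumr cmp_suml scaler_suml.
by apply: eq_bigr => i _; rewrite -ptr_al.
Qed.

Let normB e : \sum_b \sum_i \sum_k B b e i k * (B b e i k)^* = q a.
Proof.
apply: (scale_idI (smp_simple e)).
rewrite -(proj2 (std_normed a) (smp e)).
rewrite -[X in _ = _ \oc X]cmp1m -[idm _ in RHS]la_id.
rewrite -(onb_complete sM (dual_ a |> smp e)) (bm_sumr LL).
rewrite cmp_suml cmp_sumr scaler_suml; apply: eq_bigr => b _.
rewrite (bm_sumr LL) cmp_suml cmp_sumr exchange_big scaler_suml.
apply: eq_bigr => k _ /=; rewrite la_cmp -cmpA cmpA.
rewrite [RHS](scE (smp_simple e)) (sc_insert sM); congr (_ *: _).
apply: eq_bigr => i _; congr (_ * _).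
by rewrite -(sc_dag sM) // !dag_cmp !dagK la_dag dagK cmpA.
Qed.

(* Equality case of Cauchy-Schwarz: by [sum_AB], [normA] and [normB] the squares
   of [wt b * A - wt e * B] add up to zero. *)
Let AB b e i k : wt b * A b e i k = wt e * B b e i k.
Proof.
pose X b e i k := wt b * A b e i k - wt e * B b e i k.
suff X0 : \sum_b \sum_e \sum_i \sum_k @X b e i k * (@X b e i k)^* = 0.
  apply/eqP; rewrite -subr_eq0 -/(@X b e i k) -mul_conjC_eq0.
  have ge0 b' e' i' k' : 0 <= @X b' e' i' k' * (@X b' e' i' k')^*.
    exact: mul_conjC_ge0.
  move/eqP: X0; rewrite psumr_eq0 => [/allP/(_ b)|b' _]; last first.
    by do 3!apply: sumr_ge0 => ? _.
  rewrite mem_index_enum => /(_ isT)/=.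
  rewrite psumr_eq0 => [/allP/(_ e)|e' _]; last by do 2!apply: sumr_ge0 => ? _.
  rewrite mem_index_enum => /(_ isT)/=.
  rewrite psumr_eq0 => [/allP/(_ i)|i' _]; last by apply: sumr_ge0 => ? _.
  rewrite mem_index_enum => /(_ isT)/=.
  rewrite psumr_eq0 => [/allP/(_ k)|i' _] //.
  by rewrite mem_index_enum => /(_ isT).
have XE b' e' i' : \sum_k @X b' e' i' k * (@X b' e' i' k)^* =
  wt b' ^+ 2 * (\sum_k A b' e' i' k * (A b' e' i' k)^*)
  + wt e' ^+ 2 * (\sum_k B b' e' i' k * (B b' e' i' k)^*)
  - (wt b' * wt e') *+ 2.
  have AB1 := sum_AB i' i'; rewrite eqxx in AB1.
  have BA1 : \sum_k A b' e' i' k * (B b' e' i' k)^* = 1.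
    rewrite -[RHS]conjC1 -[X in X^*]AB1 rmorph_sum; apply: eq_bigr => k' _.
    by rewrite rmorphM /= conjCK.
  transitivity (wt b' ^+ 2 * (\sum_k A b' e' i' k * (A b' e' i' k)^*)
    + wt e' ^+ 2 * (\sum_k B b' e' i' k * (B b' e' i' k)^*)
    - (wt b' * wt e') * (\sum_k (A b' e' i' k)^* * B b' e' i' k)
    - (wt b' * wt e') * (\sum_k A b' e' i' k * (B b' e' i' k)^*)).
    rewrite !mulr_sumr -!sumrN -!big_split; apply: eq_bigr => k' _ /=.
    by rewrite /X rmorphB !rmorphM /= !wt_conj; ring.
  by rewrite AB1 BA1 /=; ring.
(* The squares contribute through [normA] and [normB], and each cross term is counted [ldim a b' e']
   times. By [wtM] the cross terms sum to twice the sum of [q a * wt b' ^+ 2], which cancels the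
   squares. *)
transitivity (\sum_b' (wt b' ^+ 2 * q a)
  + \sum_e' (wt e' ^+ 2 * q a)
  - \sum_b' \sum_e' ((ldim a b' e')%:R * (wt b' * wt e') *+ 2)).
  have hA : \sum_b' (wt b' ^+ 2 * q a) =
    \sum_b' \sum_e' \sum_i wt b' ^+ 2 * (\sum_k A b' e' i k * (A b' e' i k)^*).
    apply: eq_bigr => b' _; rewrite -(normA b') mulr_sumr.
    by apply: eq_bigr => e' _; rewrite mulr_sumr.
  have hB : \sum_e' (wt e' ^+ 2 * q a) =
    \sum_b' \sum_e' \sum_i wt e' ^+ 2 * (\sum_k B b' e' i k * (B b' e' i k)^*).
    rewrite exchange_big; apply: eq_bigr => e' _; rewrite -(normB e') mulr_sumr.
    by apply: eq_bigr => b' _; rewrite mulr_sumr.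
  rewrite {1}hA hB -sumrN -!big_split; apply: eq_bigr => b' _ /=.
  rewrite -sumrN -!big_split; apply: eq_bigr => e' _ /=.
  under eq_bigr do rewrite XE.
  rewrite big_split big_split /= sumrN sumr_const card_ord.
  by rewrite mulr_natl mulrnAC.
rewrite -big_split -sumrN -big_split big1 //= => b' _.
have -> : \sum_e' (ldim a b' e')%:R * (wt b' * wt e') *+ 2
   = (wt b' * (q a * wt b')) *+ 2.
  rewrite wtM mulr_sumr -sumrMnl; apply: eq_bigr => e' _.
  by congr (_ *+ _); rewrite mulrCA.
by ring.
Qed.

(** By [AB] the Gram sums of [A] are [wt e / wt b] times the sums in [sum_AB]. This gives the
    partial trace of every matrix unit [(al b e i)^H \oc al b e j]. *)
Lemma ptr_simple b (f : hom (smp a |> smp b) (smp a |> smp b)) :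
  ptr f = (tr sM wt f / wt b) *: idm (smp b).
Proof.
have ptr_sum (I : finType) (c : I -> R[i]) (g : I -> hom _ _) :
    @ptr (smp b) (\sum_i c i *: g i) = \sum_i c i *: ptr (g i).
  rewrite /ptr (bm_sumr LL) cmp_sumr cmp_suml; apply: eq_bigr => i _.
  by rewrite laZ cmpZr cmpZl.
have ptr_sum1 (I : finType) (g : I -> hom _ _) :
    @ptr (smp b) (\sum_i g i) = \sum_i ptr (g i).
  by rewrite /ptr (bm_sumr LL) cmp_sumr cmp_suml.
rewrite -[f in LHS]cmp1m -(onb_complete sM (smp a |> smp b)) cmp_suml ptr_sum1.
rewrite /tr mulr_suml scaler_suml; apply: eq_bigr => e _.
rewrite cmp_suml ptr_sum1 mulr_suml scaler_suml; apply: eq_bigr => i _.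
have ptr_al' j : ptr ((al b e i)^H \oc al b e j)
    = ((j == i)%:R * (wt e / wt b)) *: idm (smp b).
  rewrite ptr_al; congr (_ *: _); rewrite -(sum_AB j i) mulr_suml.
  apply: eq_bigr => k _; apply: (mulfI (wt_neq0 b)).
  rewrite [LHS]mulrA AB; have := wt_neq0 b;
    move: (wt b) (_ ^*) (B _ _ _ _) => x y z x0.
  by field.
rewrite -cmpA [X in _ \oc X](onb_expand sM) cmp_sumr.
under eq_bigr do rewrite cmpZr.
rewrite ptr_sum (bigD1 i) //= big1 ?addr0 => [|j ji].
  rewrite -/(al b e i) ptr_al' eqxx scalerA; congr (_ *: _).
  by rewrite mul1r mulrCA mulrA.
by rewrite -/(al b e i) -/(al b e j) ptr_al' (negbTE ji) mul0r scale0r scaler0.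
Qed.

(** [m] is cut into simple objects, and naturality of [eps] moves the cut inside the partial trace,
    where [ptr_simple] applies. *)
Lemma tr_ptr m (f : hom (smp a |> m) (smp a |> m)) : tr sM wt (ptr f) = tr sM
  wt f.
Proof.
rewrite [RHS](_ : _ = tr sM wt (f \oc (smp a |>m idm m))); last first.
  by rewrite la_id cmpm1.
rewrite -(onb_complete sM m) (bm_sumr LL) cmp_sumr tr_sum {1}/tr.
apply: eq_bigr => e _; rewrite (bm_sumr LL) cmp_sumr tr_sum.
apply: eq_bigr => i _; set o := onb _ i.
have -> : o \oc ptr f \oc o^H
   = ptr ((smp a |>m o) \oc f \oc (smp a |>m o^H)).
  rewrite /ptr !cmpA -(eps_nat d o) !la_cmp -!cmpA;
    congr (_ \oc (_ \oc (_ \oc _))).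
  have := congr1 (@dag _ _ sM _ _) (eps_nat d o).
  by rewrite !dag_cmp !crep_dag => <-.
rewrite ptr_simple scZ // mulrC divfK ?wt_neq0 //.
by rewrite -cmpA trC la_cmp cmpA.
Qed.

End Phi.

(** * Averaging *)

(* The families [tframe] and [frm] both expand morphisms [a' |> b -> x |> m];
   exchanging them is what makes the average commute with [x |> -]. *)
Section TensorFrame.
Variables (x a' : irr C) (b : irr M) (m : M).
Local Notation d := (stdd x).

Definition tframe_idx : finType := {a : irr C & (frame_idx (smp a |> smp b) m
  * 'I_(hdim (tens C (smp x) (smp a)) (smp a')))%type}.

Definition tframe (k : tframe_idx) : hom (smp a' |> smp b) (smp x |> m) :=
  (smp x |>m frm sM (tagged k).1)
    \oc (fuse (onb sC (tagged k).2) (smp b))^H.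

(** The factor [q a / q a'] is the reciprocal of the one produced by the partial trace in
    [eps_fuse_eq]. *)
Definition cotframe (k : tframe_idx) : hom (smp x |> m) (smp a' |> smp b) :=
  (q (tag k) / q a') *:
   (fuse (onb sC (tagged k).2) (smp b) \oc (smp x |>m cofrm sM wt (tagged
     k).1)).

Lemma sum_tframe_idx (Z : nmodType) (E : tframe_idx -> Z) :
  \sum_k E k = \sum_a \sum_(k : frame_idx (smp a |> smp b) m)
    \sum_(i < hdim (tens C (smp x) (smp a)) (smp a')) E (@Tagged _ a
         (fun a => (frame_idx (smp a |> smp b) m
            * 'I_(hdim (tens C (smp x) (smp a)) (smp a')))%type) (k, i)).
Proof.
under [RHS]eq_bigr => a _.
  rewrite (pair_bigA _ (fun k i => E (@Tagged _ a
         (fun a => (frame_idx (smp a |> smp b) m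
            * 'I_(hdim (tens C (smp x) (smp a)) (smp a')))%type) (k, i)))).
  over.
rewrite (sig_big_dep xpredT (fun _ => xpredT) (fun a p => E (@Tagged _ a
         (fun a => (frame_idx (smp a |> smp b) m
            * 'I_(hdim (tens C (smp x) (smp a)) (smp a')))%type)
         (p.1, p.2)))) /=.
by apply: eq_bigr => -[g [i j]].
Qed.

Lemma tr_idm_lact (a e : irr _) : tr sM wt (idm (smp a |> smp e)) = q a * wt e.
Proof.
rewrite wtM /tr; apply: eq_bigr => g _.
under eq_bigr do rewrite cmpm1 onbP eqxx scZ // mulr1.
by rewrite sumr_const card_ord mulr_natl.
Qed.

Lemma ptr_sandwich n1 n2 (f : hom n1 m) (T : hom (smp x |> n2) (smp x |> n1))
    (h : hom m n2) :
  ptr ((smp x |>m f) \oc T \oc (smp x |>m h))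
    = f \oc (eps d n1 \oc (dual (smp x) |>m T) \oc (eps d n2)^H) \oc h.
Proof.
have en k l (g : hom k l) :
    eps d l \oc (dual (smp x) |>m (smp x |>m g)) = g \oc eps d k.
  exact: (eps_nat d g).
rewrite /ptr !la_cmp !cmpA en -!cmpA; congr (_ \oc (_ \oc (_ \oc _))).
have := congr1 (@dag _ _ sM _ _) (en _ _ h^H).
by rewrite !dag_cmp !la_dag dagK.
Qed.

(** The partial trace over [x] is again a family induced from [C], here by a morphism between simple
    objects. *)
Lemma eps_fuse a1 a2 (g1 : hom (tens C (smp x) (smp a1)) (smp a'))
    (g2 : hom (tens C (smp x) (smp a2)) (smp a')) :
  exists f : hom (smp a2) (smp a1), forall n,
    eps d (smp a1 |> n) \oc (dual (smp x) |>m ((fuse g1 n)^H \oc fuse g2 n))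
      \oc (eps d (smp a2 |> n))^H = f |>f idm n.
Proof.
have epsc a : @cfam (comp_crep (act (dual (smp x)))
    (comp_crep (act (smp x)) (act (smp a)))) (act (smp a))
    (fun n => eps d (smp a |> n)).
  apply: cfam_tgt1l; apply: cfam_srcAV.
  exact: (cfam_rw (act (smp a)) (eps_cfam d)).
have [f fE] := cfam_cmp (cfam_dag (epsc a2)) (cfam_cmp
  (cfam_lw (act (dual (smp x))) (cfam_cmp (fuse_cfam g2) (cfam_dag (fuse_cfam
    g1))))
  (epsc a1)).
exists f => n; have := fE n; rewrite /= cmpm1 cmp1m => <-.
by rewrite !cmpA.
Qed.

Lemma eps_fuse_neq a1 a2 (g1 : hom (tens C (smp x) (smp a1)) (smp a'))
    (g2 : hom (tens C (smp x) (smp a2)) (smp a')) n : a2 != a1 ->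
  eps d (smp a1 |> n) \oc (dual (smp x) |>m ((fuse g1 n)^H \oc fuse g2 n))
    \oc (eps d (smp a2 |> n))^H = 0.
Proof.
move=> a12; have [f ->] := eps_fuse g1 g2.
by rewrite [f]smp_disjoint // (bm0l LL).
Qed.

(** The scalar is the same for all [n], so it may be computed at [smp b] by taking traces. There
    [tr_ptr] removes the partial trace and cyclicity brings [g2] and [g1^h] together on [smp a']. *)
Lemma eps_fuse_eq a (g1 g2 : hom (tens C (smp x) (smp a)) (smp a')) n :
  eps d (smp a |> n) \oc (dual (smp x) |>m ((fuse g1 n)^H \oc fuse g2 n))
    \oc (eps d (smp a |> n))^H = (sc (g2 \oc g1^h) * q a' / q a) *: idm _.
Proof.
have [f fE] := eps_fuse g1 g2; rewrite fE.
rewrite [f](scE (smp_simple a)) (bmZl LL) (bm1 LL); congr (_ *: _).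
have qw0 : q a * wt b != 0 by apply: mulf_neq0;
  rewrite ?wt_neq0 ?gt_eqF ?stdq_gt0.
apply: (mulIf qw0).
transitivity (tr sM wt (f |>f idm (smp b))).
  rewrite [f in RHS](scE (smp_simple a)) (bmZl LL) (bm1 LL) trZ.
  by rewrite tr_idm_lact.
rewrite -fE -/(ptr _) tr_ptr trC fuse_cmp.
rewrite [g2 \oc _](scE (smp_simple a')) (bmZl LL) (bm1 LL) trZ tr_idm_lact.
rewrite scZ //; have : q a != 0 by rewrite gt_eqF ?stdq_gt0.
move: (q a) (q a') (wt b) => u v z u0.
by field.
Qed.

Lemma tframe_generator a (f : hom (smp a |> smp b) m)
    (g : hom (tens C (smp x) (smp a)) (smp a'))
    (y := (smp x |>m f) \oc (fuse g (smp b))^H) :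
  y = \sum_k tr sM wt (y \oc cotframe k) *: tframe k.
Proof.
have q0 c : q c != 0 by rewrite gt_eqF ?stdq_gt0.
have fk s (h : hom m (smp a |> smp b)) : f \oc (s *: idm _) \oc h = s *: (f \oc
  h).
  by rewrite cmpZr cmpm1 cmpZl.
have tE c (f1 : hom m (smp c |> smp b)) (g1 : hom (tens C (smp x) (smp c)) (smp
  a')) :
    tr sM wt (y \oc ((q c / q a') *: (fuse g1 (smp b) \oc (smp x |>m f1))))
    = (q c / q a') * tr sM wt (f \oc (eps d (smp a |> smp b)
        \oc (dual (smp x) |>m ((fuse g (smp b))^H \oc fuse g1 (smp b)))
        \oc (eps d (smp c |> smp b))^H) \oc f1).
  rewrite cmpZr trZ -ptr_sandwich tr_ptr.
  by rewrite /y !cmpA.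
rewrite sum_tframe_idx (bigD1 a) //= [X in _ + X]big1 ?addr0 => [|c ca].
  rewrite exchange_big.
  transitivity (\sum_i sc (onb sC i \oc g^h) *:
      ((smp x |>m f) \oc (fuse (onb sC i) (smp b))^H)).
    rewrite /y [g in LHS](onb_expand sC) fuse_sum dag_sum cmp_sumr.
    by apply: eq_bigr => i _; rewrite dagZ cmpZr -(sc_dag sC) // dag_cmp dagK.
  apply: eq_bigr => i _ /=.
  rewrite {1}[f](frm_lframe sM wt_neq0) (bm_sumr LL) cmp_suml scaler_sumr.
  apply: eq_bigr => k _.
  rewrite /cotframe /= tE eps_fuse_eq fk trZ /tframe /=.
  rewrite laZ cmpZl !scalerA; congr (_ *: _).
  have := q0 a; have := q0 a'; move: (q a) (q a') => u v v0 u0.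
  by field; rewrite u0.
rewrite big1 // => k _; rewrite big1 // => i _.
rewrite /cotframe /= tE eps_fuse_neq // cmp0r cmp0l.
by rewrite tr0 mulr0 scale0r.
Qed.

(** Bending [x] to the source and cutting the tensor product of [dual (smp x)] and [smp a'] into
    simple objects writes [y] as a sum of morphisms to which [tframe_generator] applies. *)
Lemma tframe_lframe : lframe sM wt tframe cotframe.
Proof.
move=> y.
pose yh := dmate d y.
pose xa' := tens C (dual (smp x)) (smp a').
pose sg a (k : 'I_(hdim xa' (smp a))) := fuse (onb sC k) (smp b).
have yE : y = \sum_a \sum_k ((smp x |>m (yh \oc (@sg a k)^H))
    \oc ((smp x |>m sg a k) \oc kap d (smp a' |> smp b))).
  rewrite -[LHS](dmateK d) -/yh -[yh in LHS]cmpm1.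
  rewrite -(fuse_complete (dual (smp x)) (smp a') (smp b)) cmp_sumr crep_sum
    cmp_suml.
  apply: eq_bigr => a _; rewrite cmp_sumr crep_sum cmp_suml.
  apply: eq_bigr => k _; rewrite [RHS]cmpA -la_cmp.
  by rewrite [X in fm _ X]cmpA.
have gE a (k : 'I_(hdim xa' (smp a))) :
    exists g : hom (tens C (smp x) (smp a)) (smp a'),
      (smp x |>m sg a k) \oc kap d (smp a' |> smp b) = (fuse g (smp b))^H.
  have fc := fuse_cfam (onb sC k).
  have kc : @cfam (act (smp a')) (comp_crep (act (smp x))
     (comp_crep (act (dual (smp x))) (act (smp a'))))
     (fun n => kap d (smp a' |> n)).
    apply: cfam_tgtA; apply: cfam_src1l.
    exact: (cfam_rw (act (smp a')) (kap_cfam d)).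
  have [g gE] := cfam_dag (cfam_cmp kc (cfam_lw (act (smp x)) fc)).
  exists g; have := crel_fuse gE (smp b) => /(congr1 (@dag _ _ sM _ _)) <-.
  by rewrite dagK.
rewrite [LHS]yE; under [RHS]eq_bigr => k _.
  rewrite {1}yE cmp_suml tr_sum scaler_suml.
  under eq_bigr => a _ do rewrite cmp_suml tr_sum scaler_suml.
  over.
rewrite exchange_big; apply: eq_bigr => a _ /=.
rewrite exchange_big; apply: eq_bigr => k _ /=.
by have [g ->] := gE a k; apply: tframe_generator.
Qed.

End TensorFrame.

(** * The average as a module natural transformation *)

Section Average.
Variables (b : irr M) (c c' : D).
Variable T : hom (smp b <| c) (smp b <| c').

Definition transport (y : C) : hom ((y |> smp b) <| c) ((y |> smp b) <| c') :=
  bsV y (smp b) c' \oc (y |>m T) \oc bs y (smp b) c.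

Definition sandwich a m n (y : hom (a |> smp b) n) (z : hom m (a |> smp b)) :
    hom (m <| c) (n <| c') :=
  (y <|m c') \oc transport a \oc (z <|m c).

(** The inner sum evaluates [sandwich] on the copairing of the trace, so any dual frames give the
    same value. The inverse weights of the trace enter through [cofrm]. *)
Definition average m : hom (m <| c) (m <| c') :=
  \sum_a q a *: \sum_(k : frame_idx (smp a |> smp b) m)
    sandwich (frm sM k) (cofrm sM wt k).

Lemma bsK a m e : bsV a m e \oc bs a m e = idm _.
Proof. by have [] := basc_inv ML a m e. Qed.

Lemma bsKV a m e : bs a m e \oc bsV a m e = idm _.
Proof. by have [] := basc_inv ML a m e. Qed.

Lemma sandwich_bilin a m n : bilin (@sandwich a m n).
Proof.
split=> k y z z'; rewrite /sandwich.
  by rewrite (bm_linearl RL) !cmp_linearl.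
by rewrite (bm_linearl RL) cmp_linearr.
Qed.

Lemma sandwich_l a m n n' (f : hom n n') y z :
  (f <|m c') \oc @sandwich a m n y z = sandwich (f \oc y) z.
Proof. by rewrite /sandwich (bm_cmpl RL) !cmpA. Qed.

Lemma sandwich_r a m m' n (f : hom m' m) y z :
  @sandwich a m n y z \oc (f <|m c) = sandwich y (z \oc f).
Proof. by rewrite /sandwich (bm_cmpl RL) !cmpA. Qed.

Lemma average_nat m n (f : hom m n) :
  average n \oc (f <|m c) = (f <|m c') \oc average m.
Proof.
rewrite /average cmp_suml cmp_sumr; apply: eq_bigr => a _.
rewrite cmpZl cmpZr; congr (_ *: _); rewrite cmp_suml cmp_sumr.
under eq_bigr do rewrite sandwich_r.
under [RHS]eq_bigr do rewrite sandwich_l.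
apply/esym.
apply: (@frame_nat _ _ sM wt (smp a |> smp b) m n f _ (@sandwich (smp a) m n)).
- exact: sandwich_bilin.
- exact: (frm_rframe sM wt_neq0).
- exact: (frm_lframe sM wt_neq0).
Qed.

Lemma bs_l x m n (f : hom m n) e :
  (x |>m (f <|m e)) \oc bs x m e = bs x n e \oc ((x |>m f) <|m e).
Proof. by rewrite (basc_natural ML). Qed.

Lemma bsV_l x y (f : hom x y) m e :
  bsV y m e \oc (f |>f idm (m <| e)) = ((f |>f idm m) <|m e) \oc bsV x m e.
Proof.
rewrite -[LHS]cmpm1 -(bsKV x) cmpA -[_ \oc _ \oc bs _ _ _]cmpA.
have := basc_natural ML f (idm m) (idm e); rewrite (bm1 RL) => <-.
by rewrite cmpA bsK cmp1m.
Qed.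

Lemma transport_nat y z (f : hom y z) :
  transport z \oc ((f |>f idm (smp b)) <|m c)
    = ((f |>f idm (smp b)) <|m c') \oc transport y.
Proof.
have bn := basc_natural ML f (idm (smp b)) (idm c); rewrite (bm1 RL) in bn.
rewrite /transport -cmpA bn !cmpA -bsV_l.
congr (_ \oc _); rewrite -!cmpA; congr (_ \oc _).
by rewrite (bm_rl LL) (bm_lr LL).
Qed.

Lemma bs_tens x a m e :
  (x |>m bs a m e) \oc bs x (a |> m) e
    = lasc x a (m <| e) \oc bs (tens C x a) m e \oc ((lasc x a m)^H <|m e).
Proof.
rewrite (basc_pentagonl ML) -cmpA -(bm_cmpl RL) lascKV (bm1 RL) cmpm1.
by [].
Qed.

(** The mixed pentagon [basc_pentagonl], used for [c] and, inverted, for [c']: transporting along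
    [a] and then along [x] is transporting along their tensor product. *)
Lemma transport_tens x a :
  bsV x (a |> smp b) c' \oc (x |>m transport a) \oc bs x (a |> smp b) c
    = (lasc x a (smp b) <|m c') \oc transport (tens C x a)
        \oc ((lasc x a (smp b))^H <|m c).
Proof.
have bV : bsV x (a |> smp b) c' \oc (x |>m bsV a (smp b) c')
   = (lasc x a (smp b) <|m c') \oc bsV (tens C x a) (smp b) c'
      \oc (lasc x a (smp b <| c'))^H.
  have u1 : (x |>m bs a (smp b) c') \oc bs x (a |> smp b) c'
      \oc (bsV x (a |> smp b) c' \oc (x |>m bsV a (smp b) c')) = idm _.
    rewrite !cmpA -[_ \oc bs _ _ _ \oc _]cmpA bsKV cmpm1 -la_cmp bsKV la_id.
    by [].
  rewrite -[LHS]cmp1m.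
  have u2 : (lasc x a (smp b) <|m c') \oc bsV (tens C x a) (smp b) c'
      \oc (lasc x a (smp b <| c'))^H
      \oc ((x |>m bs a (smp b) c') \oc bs x (a |> smp b) c') = idm _.
    rewrite bs_tens !cmpA -[_ \oc _ \oc lasc _ _ _]cmpA lascK cmpm1.
    by rewrite -[_ \oc _ \oc bs _ _ _]cmpA bsK cmpm1 -(bm_cmpl RL) lascKV (bm1
      RL).
  by rewrite -u2 -cmpA u1 cmpm1.
rewrite {1}/transport !la_cmp !cmpA bV.
rewrite -[_ \oc (x |>m bs _ _ _) \oc _]cmpA bs_tens !cmpA.
rewrite -[_ \oc (lasc _ _ _)^H \oc _]cmpA.
have -> : (lasc x a (smp b <| c'))^H \oc (x |>m (a |>m T))
    = (tens C x a |>m T) \oc (lasc x a (smp b <| c))^H.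
  rewrite -[RHS]cmp1m -(lascK x a) -cmpA [X in _ = _ \oc X]cmpA.
  have := lasc_natural ML (idm x) (idm a) T; rewrite (bm1 (tens_laws C)) => ->.
  by rewrite -[X in _ = _ \oc X]cmpA lascKV cmpm1.
rewrite !cmpA -[_ \oc (lasc _ _ _)^H \oc lasc _ _ _]cmpA lascK cmpm1.
by rewrite /transport ?cmpA.
Qed.

Lemma transport_fuse (x a : C) :
  bsV x (a |> smp b) c' \oc (x |>m transport a) \oc bs x (a |> smp b) c
    = \sum_a' \sum_i sandwich
        (fuse (onb sC (m := tens C x a) (e := a') i) (smp b))^H
        (fuse (onb sC (m := tens C x a) (e := a') i) (smp b)).
Proof.
rewrite transport_tens.
rewrite -[transport (tens C x a)]cmpm1 -(bm1 RL) -(bm1 LL) -(onb_complete sC).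
rewrite (bm_suml LL) (bm_suml RL) !cmp_sumr cmp_suml; apply: eq_bigr => a' _.
rewrite (bm_suml LL) (bm_suml RL) !cmp_sumr cmp_suml; apply: eq_bigr => i _.
rewrite (bm_cmpl LL) (bm_cmpl RL) [X in _ \oc X \oc _]cmpA transport_nat.
by rewrite /sandwich fuse_dag /fuse !(bm_cmpl RL) !cmpA.
Qed.

(** Splitting the tensor products of [x] and [a] into simple objects [a'] turns the right-hand side
    into an average over [a'] written with [tframe] and [cotframe]; frame independence replaces
    these by [frm] and [cofrm]. *)
Lemma average_module_smp (x : irr C) m :
  bs (smp x) m c' \oc average (smp x |> m)
    = (smp x |>m average m) \oc bs (smp x) m c.
Proof.
have q0 a : q a != 0 by rewrite gt_eqF ?stdq_gt0.
have bsl y z (f : hom y z) : smp x |>m (f <|m c')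
    = bs (smp x) z c' \oc ((smp x |>m f) <|m c') \oc bsV (smp x) y c'.
  by rewrite -bs_l -cmpA bsKV cmpm1.
have la3 m1 m2 m3 m4 (g1 : hom m3 m4) (g2 : hom m2 m3) (g3 : hom m1 m2) :
    smp x |>m (g1 \oc g2 \oc g3)
      = (smp x |>m g1) \oc (smp x |>m g2) \oc (smp x |>m g3).
  by rewrite !la_cmp.
apply/esym.
transitivity (\sum_a q a *: \sum_(k : frame_idx (smp a |> smp b) m) \sum_a'
   \sum_(i < hdim (tens C (smp x) (smp a)) (smp a'))
   (bs (smp x) m c' \oc sandwich
     ((smp x |>m frm sM k) \oc (fuse (onb sC i) (smp b))^H)
     (fuse (onb sC i) (smp b) \oc (smp x |>m cofrm sM wt k)))).
  rewrite /average (bm_sumr LL) cmp_suml; apply: eq_bigr => a _.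
  rewrite laZ cmpZl; congr (_ *: _).
  rewrite (bm_sumr LL) cmp_suml; apply: eq_bigr => k _.
  rewrite {1}/sandwich la3 bsl -[LHS]cmpA bs_l !cmpA.
  rewrite -[_ \oc (smp x |>m transport _) \oc _]cmpA.
  rewrite -[_ \oc bsV _ _ _ \oc _]cmpA [X in _ \oc X \oc _]cmpA transport_fuse.
  rewrite cmp_sumr cmp_suml; apply: eq_bigr => a' _.
  rewrite cmp_sumr cmp_suml; apply: eq_bigr => i _.
  by rewrite -[_ \oc sandwich _ _]cmpA sandwich_l -[LHS]cmpA sandwich_r.
(* The weight [q a] is [q a'] times the factor [q a / q a'] of [cotframe], so the regrouped sum
   carries the weights of the average. *)
transitivity (\sum_a' q a' *: \sum_(k : tframe_idx x a' b m)
   (bs (smp x) m c' \oc sandwich (tframe k) (cotframe k))).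
  under [RHS]eq_bigr do rewrite sum_tframe_idx scaler_sumr.
  rewrite exchange_big; apply: eq_bigr => a _ /=.
  rewrite scaler_sumr; under eq_bigr do rewrite scaler_sumr.
  rewrite exchange_big; apply: eq_bigr => a' _ /=.
  rewrite scaler_sumr; apply: eq_bigr => k _.
  rewrite !scaler_sumr; apply: eq_bigr => i _.
  rewrite /tframe /cotframe /= /sandwich (bmZl RL) !cmpZr scalerA.
  by rewrite mulrCA mulfV // mulr1.
rewrite /average cmp_sumr; apply: eq_bigr => a' _.
rewrite cmpZr; congr (_ *: _); rewrite -!cmp_sumr; congr (_ \oc _).
apply: (@frame_indep _ _ sM wt _ _ _ (@sandwich (smp a') (smp x |> m) (smp x |>
  m))).
- exact: sandwich_bilin.
- exact: tframe_lframe.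
- exact: (frm_rframe sM wt_neq0).
Qed.

(** A resolution of the identity of [x] reduces the claim to simple objects, by naturality of the
    average and of the bimodule associator. *)
Lemma average_module x m :
  bs x m c' \oc average (x |> m) = (x |>m average m) \oc bs x m c.
Proof.
have idE : idm ((x |> m) <| c) = \sum_e \sum_i
    ((((onb sC (m := x) (e := e) i)^h \oc onb sC i) |>f idm m) <|m c).
  rewrite -(bm1 RL) -(bm1 LL) -(onb_complete sC) (bm_suml LL) (bm_suml RL).
  by apply: eq_bigr => e _; rewrite (bm_suml LL) (bm_suml RL).
rewrite -[LHS]cmpm1 -[RHS]cmpm1 idE [LHS]cmp_sumr [RHS]cmp_sumr.
apply: eq_bigr => e _; rewrite [LHS]cmp_sumr [RHS]cmp_sumr.
apply: eq_bigr => i _.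
rewrite (bm_cmpl LL) (bm_cmpl RL) !cmpA; congr (_ \oc _).
have bn (d : D) := basc_natural ML (onb sC i)^h (idm m) (idm d).
rewrite -[LHS]cmpA average_nat [LHS]cmpA bn -[LHS]cmpA average_module_smp (bm1
  RL).
rewrite cmpA (bm_lr LL) -[RHS]cmpA bn (bm1 RL) cmpA (bm_rl LL).
by [].
Qed.

End Average.

(** * Averages induced by morphisms of the dual category *)

Hypothesis D_dual : is_dual_category (ub_str M).

Lemma average_dual b (c c' : D) (T : hom (smp b <| c) (smp b <| c')) :
  exists h : hom c c', forall m, average T m = bm (ract (ub_str M)) (idm m) h.
Proof.
have [_ ff] := D_dual.
have [|h [hE _]] := ff c c' (average T); last by exists h.
split=> [m n f|a m]; first exact: average_nat.
exact: average_module.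
Qed.

(** At a simple object the trace is [wt e] times [sc], so any basis and its dual form a frame once
    the dual vectors are divided by [wt e]. *)
Lemma average_smp b (c c' : D) (T : hom (smp b <| c) (smp b <| c')) e
    (al : forall a, 'I_(ldim a b e) -> hom (smp a |> smp b) (smp e))
    (al' : forall a, 'I_(ldim a b e) -> hom (smp e) (smp a |> smp b)) :
  (forall a y, y = \sum_i sc (al a i \oc y) *: al' a i) ->
  average T (smp e)
    = (wt e)^-1 *: \sum_a q a *: \sum_i sandwich T (al a i) (al' a i).
Proof.
move=> alE; rewrite /average scaler_sumr; apply: eq_bigr => a _.
rewrite scalerA mulrC -scalerA; congr (_ *: _).
transitivity (\sum_i sandwich T (al a i) ((wt e)^-1 *: al' a i)); last first.
  rewrite scaler_sumr; apply: eq_bigr => i _.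
  exact: (bilinZr (sandwich_bilin T _ _ _)).
apply: (@frame_indep _ _ sM wt _ _ _
  (@sandwich b _ _ T (smp a) (smp e) (smp e))).
- exact: sandwich_bilin.
- exact: (frm_lframe sM wt_neq0).
- move=> y; rewrite {1}[y](alE a); apply: eq_bigr => i _.
  by rewrite tr_smp scalerA mulrAC mulfV ?wt_neq0 // mul1r.
Qed.

Lemma ract_one_neq0 e : idm (smp e <| one) != 0.
Proof.
apply: contraNneq (simple_neq0 (smp_simple e)) => i0.
have [_ <-] := runit_inv ML (smp e).
by rewrite -[fwd _]cmpm1 i0 cmp0r cmp0l.
Qed.

(* The average of the identity of [b <| one] is a scalar, so the left-hand side
   is proportional to [wt e]; the normalization of [dM] fixes the factor. *)
Lemma sum_ldim b e : \sum_a q a * (ldim a b e)%:R = wt b * wt e.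
Proof.
pose T := idm (smp b <| (one : D)).
have [h hE] := average_dual T.
have [z zE] := simple_scal (one_simple D) h.
have PE g : \sum_a q a * (ldim a b g)%:R = z * wt g.
  suff : (wt g)^-1 * (\sum_a q a * (ldim a b g)%:R) = z.
    by move=> <-; rewrite mulrAC mulVf ?wt_neq0 // mul1r.
  have inj k l : k *: idm (smp g <| (one : D)) = l *: idm (smp g <| one) -> k =
    l.
    move/eqP; rewrite -subr_eq0 -scalerBl scaler_eq0 (negbTE (ract_one_neq0 g)).
    by rewrite orbF subr_eq0 => /eqP.
  apply: inj; transitivity (average T (smp g)); last first.
    by rewrite hE zE (bmZr RL) (bm1 RL).
  rewrite (@average_smp b _ _ T g (fun a i => onb sM i) (fun a i => (onb sM
    i)^H)).
    rewrite -scalerA scaler_suml; congr (_ *: _); apply: eq_bigr => a _.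
    rewrite -scalerA; congr (_ *: _).
    rewrite (eq_bigr (fun=> idm _)) => [|i _];
      first by rewrite sumr_const card_ord scaler_nat.
    rewrite /sandwich /transport la_id cmpm1 bsK cmpm1 -(bm_cmpl RL) onbP eqxx
      scale1r.
    by rewrite (bm1 RL).
  by move=> a y; apply: onb_expandr.
have S_neq0 : \sum_g wt g ^+ 2 != 0.
  rewrite gt_eqF // lt0r sumr_ge0 ?andbT => [|g _]; last first.
    by rewrite exprn_ge0 // ltW // wt_gt0.
  rewrite psumr_eq0 => [|g _]; last by rewrite exprn_ge0 // ltW // wt_gt0.
  apply/allPn; exists b; first by rewrite mem_index_enum.
  by rewrite expf_neq0 ?wt_neq0.
suff -> : wt b = z by [].
apply: (mulIf S_neq0).
(* Double counting: exchanging the sums and applying [wtM] gives [wt b] times the sum of the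
   [q a ^+ 2], which the normalization identifies with the sum of the [wt g ^+ 2]; [PE] gives [z]
   times the latter. *)
transitivity (\sum_g (\sum_a q a * (ldim a b g)%:R) * wt g).
  have [_ _ norm] := dM_dim.
  have -> : \sum_g wt g ^+ 2 = \sum_a q a ^+ 2.
    have := congr1 (real_complex R) norm;
      rewrite /FPdim_cat !rmorph_sum /= => E.
    transitivity (\sum_i (dM i ^+ 2)%:C%C); first by apply: eq_bigr => g _;
      rewrite rmorphXn.
    by rewrite E; apply: eq_bigr => a _; rewrite rmorphXn /= -(stdqE b).
  under [RHS]eq_bigr do rewrite mulr_suml.
  rewrite exchange_big mulr_sumr; apply: eq_bigr => a _ /=.
  transitivity (q a * (q a * wt b)); first by rewrite mulrC -mulrA.
  rewrite wtM mulr_sumr.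
  by apply: eq_bigr => g _; rewrite mulrA.
rewrite mulr_sumr; apply: eq_bigr => g _; rewrite PE expr2 !mulrA.
by [].
Qed.

Definition ract_by (c : D) : functor M M :=
  @Functor R M M (fun m => m <| c) (fun m n f => f <|m c).

Lemma ract_by_laws c : functor_laws (ract_by c).
Proof.
split=> [m|m n p g f|m n k f g] /=.
- exact: (bm1 RL).
- exact: (bm_cmpl RL).
- exact: (bm_linearl RL).
Qed.

Definition ract_on (m : M) : functor D M :=
  @Functor R D M (fun c => m <| c) (fun c d f => bm (ract (ub_str M)) (idm m)
    f).

Lemma ract_on_laws m : functor_laws (ract_on m).
Proof.
split=> [c|c d e g f|c d k f g] /=.
- exact: (bm1 RL).
- exact: (bm_cmpr RL).
- exact: (bm_linearr RL).
Qed.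

Lemma ldim_rdim (a : irr C) (b : irr M) (c : irr D) (d : irr M) :
  (\sum_e ldim a b e * rdim e c d = \sum_f rdim b c f * ldim a f d)%N.
Proof.
have e1 := hdim_functorN sM sM (smp a |> smp b) d (ract_by_laws (smp c)).
have e2 := hdim_functorN sM sM (smp b <| smp c) d (crep_laws (act (smp a))).
rewrite /ldim /rdim -e1 -e2.
exact: (hdim_iso sM d (basc_inv ML _ _ _)).
Qed.

Lemma rdim_rdim (b : irr M) (c c' : irr D) (d : irr M) :
  (\sum_f rdim b c f * rdim f c' d
     = \sum_g hdim (tens D (smp c) (smp c')) (smp g) * rdim b g d)%N.
Proof.
have e1 := hdim_functorN sM sM (smp b <| smp c) d (ract_by_laws (smp c')).
have e2 := hdim_functorN (ufus_star D) sM (tens D (smp c) (smp c')) d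
  (ract_on_laws (smp b)).
rewrite /rdim -e1 -e2.
exact: (hdim_iso sM d (rasc_inv ML _ _ _)).
Qed.

Lemma hdim_eq0 (m : M) : (forall e, hdim m (smp e) = 0%N) -> idm m = 0.
Proof.
move=> m0; rewrite -(onb_complete sM) big1 // => e _; rewrite big1 // => i _.
by have := ltn_ord i; rewrite [X in (_ < X)%N]m0.
Qed.

(** * Frobenius-Perron dimensions of the dual category *)

Section RightDimension.
Variables (dD : irr D -> R) (dD_FPdim : is_FPdim dD) (b0 : irr M).

(** The eigenvalue of the right action of [smp c] on [dM], read off at [b0]; [lam_right] shows that
    every other simple object gives the same value. *)
Let lam c := (\sum_f (rdim b0 c f)%:R * dM f) / dM b0.

Let dM_gt0 e : 0 < dM e. Proof. by case: dM_dim. Qed.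
Let dM_neq0 e : dM e != 0. Proof. by rewrite gt_eqF. Qed.

Let sum_ldimR b e : \sum_a dC a * (ldim a b e)%:R = dM b * dM e.
Proof.
apply: (fmorph_inj (real_complex R)); rewrite rmorphM rmorph_sum /=.
rewrite -[RHS](sum_ldim b e); apply: eq_bigr => a _.
by rewrite rmorphM rmorph_nat (stdqE b0).
Qed.

(** Multiplicities in the two bracketings agree by [ldim_rdim]. Summed over [a] with weights [dC a],
    each [ldim] becomes a product of two values of [dM]. *)
Let two_sided b c d : dM b * (\sum_e dM e * (rdim e c d)%:R)
  = (\sum_f (rdim b c f)%:R * dM f) * dM d.
Proof.
transitivity (\sum_a dC a * (\sum_e ldim a b e * rdim e c d)%N%:R).
  under [RHS]eq_bigr do rewrite natr_sum mulr_sumr.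
  rewrite exchange_big mulr_sumr; apply: eq_bigr => e _ /=.
  rewrite mulrA -sum_ldimR mulr_suml; apply: eq_bigr => a _.
  by rewrite natrM mulrA.
under eq_bigr do rewrite ldim_rdim natr_sum mulr_sumr.
rewrite exchange_big mulr_suml; apply: eq_bigr => f _ /=.
rewrite -mulrA -sum_ldimR mulr_sumr; apply: eq_bigr => a _.
by rewrite natrM mulrCA.
Qed.

Let lam_left c d : \sum_e dM e * (rdim e c d)%:R = lam c * dM d.
Proof.
by apply: (mulfI (dM_neq0 b0));
  rewrite two_sided mulrA /lam [dM b0 * _]mulrC divfK.
Qed.

Let lam_right c b : \sum_f (rdim b c f)%:R * dM f = lam c * dM b.
Proof.
by apply: (mulIf (dM_neq0 b)); rewrite -two_sided lam_left mulrC.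
Qed.

(** If [lam c] vanished, [smp c] would send every object to zero; then its identity and its zero
    endomorphism would induce the same natural family, against faithfulness of the action. *)
Let lam_gt0 c : 0 < lam c.
Proof.
rewrite lt0r; apply/andP; split; last first.
  by rewrite divr_ge0 ?(ltW (dM_gt0 _)) ?sumr_ge0 // => f _;
    rewrite mulr_ge0 ?ler0n ?(ltW (dM_gt0 _)).
apply/eqP => lam0.
have r0 (b f : irr M) : rdim b c f = 0%N.
  have := lam_right c b; rewrite lam0 mul0r => /eqP;
    rewrite psumr_eq0 => [/allP/(_ f)|g _].
    rewrite mem_index_enum => /(_ isT) /=.
    by rewrite mulf_eq0 (negbTE (dM_neq0 f)) orbF pnatr_eq0 => /eqP.
  by rewrite mulr_ge0 ?ler0n ?(ltW (dM_gt0 _)).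
have m0 m : idm (m <| smp c) = 0.
  apply: hdim_eq0 => d.
  rewrite (hdim_functorN sM sM m d (ract_by_laws (smp c))) big1 // => g _.
  by rewrite [hdim (ract_by _ _) _]r0 muln0.
have [_ ff] := D_dual.
have [|h [_ hU]] := ff (smp c) (smp c) (fun m => idm (m <| smp c)).
  split=> [m n f|a m]; first by rewrite cmp1m cmpm1.
  by rewrite (bm1 LL) cmp1m cmpm1.
have h1 : idm (smp c) = h by apply: hU => m; rewrite (bm1 RL).
have h0 : 0 = h by apply: hU => m; rewrite (bm0r RL) m0.
by have := simple_neq0 (smp_simple c); rewrite h1 -h0 eqxx.
Qed.

(** Associativity of the right action makes [lam] a character of the fusion ring of [D], and it is
    positive. *)
Let dD_lam c : dD c = lam c.
Proof.
apply: FPdim_unique => // x y; apply: (mulIf (dM_neq0 b0)).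
rewrite [lam x * _]mulrC -mulrA -lam_right mulr_sumr mulr_suml.
transitivity (\sum_d (\sum_(f : irr M) rdim b0 x f * rdim f y d)%N%:R * dM d).
  under [RHS]eq_bigr do rewrite natr_sum mulr_suml.
  rewrite exchange_big /=; apply: eq_bigr => f _.
  rewrite mulrCA -lam_right mulr_sumr; apply: eq_bigr => d _.
  by rewrite natrM mulrA.
under eq_bigr do rewrite rdim_rdim natr_sum mulr_suml.
rewrite exchange_big /=; apply: eq_bigr => g _.
rewrite -mulrA -lam_right mulr_sumr; apply: eq_bigr => d _.
by rewrite natrM mulrA.
Qed.

Lemma dD_gt0 c : 0 < dD c.
Proof. by rewrite dD_lam. Qed.

Lemma sum_rdim c d : \sum_e dM e * (rdim e c d)%:R = dD c * dM d.
Proof. by rewrite dD_lam lam_left. Qed.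

End RightDimension.

(** * Orthogonality of the F-symbols *)

Section Orthogonality.
Variables (dD : irr D -> R) (dD_FPdim : is_FPdim dD).
Variables (bl : lbasis M) (br : rbasis M) (bases : are_bases bl br).
Variables (F Fi : fsymbol M) (F_symbol : is_Fsymbol bl br F).
Hypothesis Fi_inverse : is_inverse_Fsymbol F Fi.

Definition bl' a b e := sval (boolp.cid (dual_basis sM (proj1 bases a b e))).
Definition br' b c f := sval (boolp.cid (dual_basis sM (proj2 bases b c f))).

Lemma blP a b e i j : tnth (bl a b e) i \oc bl' j = (i == j)%:R *: idm (smp e).
Proof. by rewrite /bl'; case: boolp.cid => ? []. Qed.

Lemma brP b c f i j : tnth (br b c f) i \oc br' j = (i == j)%:R *: idm (smp f).
Proof. by rewrite /br'; case: boolp.cid => ? []. Qed.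

Lemma bl_complete a b :
  \sum_e \sum_i (bl' i \oc tnth (bl a b e) i) = idm (smp a |> smp b).
Proof.
rewrite -(onb_complete sM); apply: eq_bigr => e _.
by rewrite /bl'; case: boolp.cid => ? [].
Qed.

Lemma bl_expandr a b e (y : hom (smp e) (smp a |> smp b)) :
  y = \sum_i sc (tnth (bl a b e) i \oc y) *: bl' i.
Proof. by apply: (dual_expandr (s := sM)); rewrite /bl';
  case: boolp.cid => ? []. Qed.

Lemma br_expandr b c f (y : hom (smp f) (smp b <| smp c)) :
  y = \sum_i sc (tnth (br b c f) i \oc y) *: br' i.
Proof. by apply: (dual_expandr (s := sM)); rewrite /br';
  case: boolp.cid => ? []. Qed.

Section Sector.
Variables (a : irr C) (b d : irr M) (c : irr D).

(** [lpath] and [rpath] are the two bases of morphisms from [(a |> b) <| c] to [d] that [F]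
    compares; the primed paths are their dual bases. *)
Definition lpath e al be : hom ((smp a |> smp b) <| smp c) (smp d) :=
  tnth (br e c d) be \oc (tnth (bl a b e) al <|m smp c).
Definition lpath' e al be : hom (smp d) ((smp a |> smp b) <| smp c) :=
  (@bl' a b e al <|m smp c) \oc @br' e c d be.
Definition rpath f mu nu : hom ((smp a |> smp b) <| smp c) (smp d) :=
  tnth (bl a f d) nu \oc (smp a |>m tnth (br b c f) mu)
    \oc bs (smp a) (smp b) (smp c).
Definition rpath' f mu nu : hom (smp d) ((smp a |> smp b) <| smp c) :=
  bsV (smp a) (smp b) (smp c) \oc (smp a |>m @br' b c f mu) \oc @bl' a f d nu.

Lemma lpathE e al be : @lpath e al be
  = \sum_f \sum_mu \sum_nu F al be mu nu *: @rpath f mu nu.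
Proof. exact: F_symbol. Qed.

Lemma lpath_expand z :
  z = \sum_e \sum_al \sum_be sc (@lpath e al be \oc z) *: lpath' al be.
Proof.
rewrite -[LHS]cmp1m -(bm1 RL) -bl_complete (bm_suml RL) cmp_suml.
apply: eq_bigr => e _; rewrite (bm_suml RL) cmp_suml; apply: eq_bigr => al _.
rewrite (bm_cmpl RL) -cmpA [X in _ \oc X]br_expandr cmp_sumr.
by apply: eq_bigr => be _; rewrite cmpZr /lpath cmpA.
Qed.

Lemma lpathP e al be e' al' be' : @lpath e' al' be' \oc @lpath' e al be
  = ([&& (al' == al :> nat), e' == e & (be' == be :> nat)])%:R *: idm (smp d).
Proof.
rewrite /lpath /lpath' !cmpA -[_ \oc _ \oc (_ <|m _)]cmpA -(bm_cmpl RL).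
case: eqVneq al' be' => [->|ee] al' be' /=; last first.
  rewrite [tnth _ al' \oc _]smp_disjoint 1?eq_sym // (bm0l RL) cmp0r cmp0l.
  by rewrite andbF scale0r.
rewrite blP (bmZl RL) (bm1 RL) cmpZr cmpm1 cmpZl brP scalerA -natrM mulnb.
by [].
Qed.

Lemma rpath_pair f mu nu g k l :
  @rpath f mu nu \oc @rpath' g k l = tnth (bl a f d) nu
    \oc (smp a |>m (tnth (br b c f) mu \oc br' k)) \oc bl' l.
Proof.
rewrite /rpath /rpath' !cmpA -[_ \oc bs _ _ _ \oc _]cmpA bsKV cmpm1.
by rewrite -[_ \oc _ \oc (_ |>m br' k)]cmpA -la_cmp.
Qed.

Lemma rpath_neq f mu nu g k l : g != f ->
  @rpath f mu nu \oc @rpath' g k l = 0.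
Proof.
move=> gf; rewrite rpath_pair [tnth _ mu \oc _]smp_disjoint //.
by rewrite (bm0r LL) cmp0r cmp0l.
Qed.

Lemma rpath_eq f mu nu k l : @rpath f mu nu \oc @rpath' f k l
  = ((mu == k) && (nu == l))%:R *: idm (smp d).
Proof.
rewrite rpath_pair brP laZ la_id cmpZr cmpm1 cmpZl blP scalerA -natrM mulnb.
by [].
Qed.

Lemma rpathP f mu nu (z : forall f, 'I_(rdim b c f) -> 'I_(ldim a f d) -> R[i])
  :
  @rpath f mu nu \oc (\sum_g \sum_k \sum_l z g k l *: @rpath' g k l)
    = z f mu nu *: idm (smp d).
Proof.
rewrite cmp_sumr (bigD1 f) //= [X in _ + X]big1 ?addr0 => [|g gf]; last first.
  rewrite cmp_sumr big1 // => k _; rewrite cmp_sumr big1 // => l _.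
  by rewrite cmpZr rpath_neq // scaler0.
rewrite cmp_sumr (bigD1 mu) //= [X in _ + X]big1 ?addr0 => [|k kmu]; last first.
  rewrite cmp_sumr big1 // => l _.
  by rewrite cmpZr rpath_eq eq_sym (negbTE kmu) scale0r scaler0.
rewrite cmp_sumr (bigD1 nu) //= [X in _ + X]big1 ?addr0 => [|l lnu].
  by rewrite cmpZr rpath_eq !eqxx scale1r.
by rewrite cmpZr rpath_eq [nu == l]eq_sym (negbTE lnu) andbF scale0r scaler0.
Qed.

Lemma lpath_rpath' e al be
    (z : forall f, 'I_(rdim b c f) -> 'I_(ldim a f d) -> R[i]) :
  @lpath e al be \oc (\sum_g \sum_k \sum_l z g k l *: @rpath' g k l)
    = (\sum_f \sum_mu \sum_nu F al be mu nu * z f mu nu) *: idm (smp d).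
Proof.
rewrite lpathE cmp_suml scaler_suml; apply: eq_bigr => f _.
rewrite cmp_suml scaler_suml; apply: eq_bigr => mu _.
rewrite cmp_suml scaler_suml; apply: eq_bigr => nu _.
by rewrite cmpZl rpathP scalerA.
Qed.

Lemma lpath_rpath e al be f mu nu :
  @lpath e al be \oc @rpath' f mu nu = F al be mu nu *: idm (smp d).
Proof.
rewrite lpathE cmp_suml (bigD1 f) //= [X in _ + X]big1 ?addr0 => [|g gf];
  last first.
  rewrite cmp_suml big1 // => k _; rewrite cmp_suml big1 // => l _.
  by rewrite cmpZl rpath_neq 1?eq_sym // scaler0.
rewrite cmp_suml (bigD1 mu) //= [X in _ + X]big1 ?addr0 => [|k kmu]; last first.
  rewrite cmp_suml big1 // => l _.
  by rewrite cmpZl rpath_eq (negbTE kmu) scale0r scaler0.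
rewrite cmp_suml (bigD1 nu) //= [X in _ + X]big1 ?addr0 => [|l lnu].
  by rewrite cmpZl rpath_eq !eqxx scale1r.
by rewrite cmpZl rpath_eq (negbTE lnu) andbF scale0r scaler0.
Qed.

(* [F] is injective as a matrix, so its right inverse is determined. *)
Lemma FiE e al be f mu nu :
  Fi al be mu nu = sc (@rpath f mu nu \oc @lpath' e al be).
Proof.
pose z g (k : 'I_(rdim b c g)) (l : 'I_(ldim a g d)) := sc (@rpath g k l \oc
  @lpath' e al be) - Fi al be k l.
have Z0 : \sum_g \sum_k \sum_l @z g k l *: @rpath' g k l = 0.
  rewrite [LHS]lpath_expand big1 // => e1 _; rewrite big1 // => al1 _.
  rewrite big1 // => be1 _; rewrite lpath_rpath' scZ //.
  rewrite [X in X *: _](_ : _ = 0) ?scale0r //.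
  transitivity (sc (@lpath e1 al1 be1 \oc @lpath' e al be)
    - \sum_f \sum_(mu < rdim b c f) \sum_(nu < ldim a f d)
      F al1 be1 mu nu * Fi al be mu nu).
    rewrite lpathE cmp_suml sc_sum -sumrB; apply: eq_bigr => g _.
    rewrite cmp_suml sc_sum -sumrB; apply: eq_bigr => k _.
    rewrite cmp_suml sc_sum -sumrB; apply: eq_bigr => l _.
    by rewrite cmpZl sc_scale -mulrBr.
  by rewrite lpathP scZ // Fi_inverse subrr.
apply/eqP; rewrite eq_sym -subr_eq0 -/(@z f mu nu); apply/eqP.
by rewrite -(scZ (smp_simple d) (@z f mu nu)) -rpathP Z0 cmp0r sc0.
Qed.

End Sector.

(** In the term of [a], expanding the morphism from [smp d] to [smp a |> smp f] in the dual basis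
    [bl'] separates [lpath \oc rpath'], which is an entry of [F], from [rpath \oc lpath'], which is
    an entry of [Fi]. *)
Lemma average_Fsum b c c' d e f (be : 'I_(rdim e c d)) (be' : 'I_(rdim e c' d))
    (mu : 'I_(rdim b c f)) (mu' : 'I_(rdim b c' f)) :
  tnth (br e c d) be
    \oc average (br' mu \oc tnth (br b c' f) mu') (smp e) \oc br' be'
  = ((wt e)^-1 * \sum_a \sum_(al < ldim a b e) \sum_(nu < ldim a f d)
       q a * F al be mu nu * Fi al be' mu' nu) *: idm (smp d).
Proof.
rewrite (average_smp _ (fun a y => bl_expandr y)) cmpZr cmpZl.
rewrite -scalerA; congr (_ *: _).
rewrite cmp_sumr cmp_suml scaler_suml; apply: eq_bigr => a _.
rewrite cmpZr cmpZl cmp_sumr cmp_suml scaler_sumr scaler_suml.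
apply: eq_bigr => al _.
transitivity (q a *: (lpath al be \oc (bsV (smp a) (smp b) (smp c)
    \oc (smp a |>m br' mu)
    \oc ((smp a |>m tnth (br b c' f) mu') \oc bs (smp a) (smp b) (smp c')
      \oc lpath' al be')))).
  congr (_ *: _); rewrite /sandwich /transport /lpath /lpath' la_cmp !cmpA.
  by [].
rewrite [X in _ \oc (_ \oc X)]bl_expandr !cmp_sumr scaler_sumr scaler_suml.
apply: eq_bigr => nu _.
rewrite (FiE _ _ mu' nu) !cmpZr -/(rpath' mu nu) lpath_rpath.
rewrite /rpath !cmpA !scalerA -!mulrA; congr (_ * _ *: _).
exact: mulrC.
Qed.

(** Orthogonality along the other index of [F]: the dual right path is expanded in left paths and
    then paired with a right path. *)
Lemma sum_FFi a b c d f (mu mu' : 'I_(rdim b c f)) (nu : 'I_(ldim a f d)) :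
  \sum_e \sum_(al < ldim a b e) \sum_(be < rdim e c d)
    F al be mu nu * Fi al be mu' nu = (mu == mu')%:R.
Proof.
apply: (scale_idI (smp_simple d)).
transitivity (rpath mu' nu \oc rpath' mu nu); last first.
  by rewrite rpath_eq eqxx andbT eq_sym.
rewrite [rpath' mu nu]lpath_expand cmp_sumr scaler_suml; apply: eq_bigr => e _.
rewrite cmp_sumr scaler_suml; apply: eq_bigr => al _.
rewrite cmp_sumr scaler_suml; apply: eq_bigr => be _.
rewrite cmpZr lpath_rpath scZ // (FiE _ _ mu' nu) -scalerA.
by rewrite -(scE (smp_simple d)).
Qed.

(** The sum is [wt e] times a matrix coefficient of an average, which is induced by a morphism from
    [smp c'] to [smp c]. This morphism is zero if the two differ; otherwise it is a scalar [z], and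
    the coefficient is [z] times the Kronecker delta of [be] and [be']. *)
Lemma Fsymbol_orthogonality b c c' d e f (be : 'I_(rdim e c d))
    (be' : 'I_(rdim e c' d)) (mu : 'I_(rdim b c f)) (mu' : 'I_(rdim b c' f)) :
  \sum_a \sum_(al < ldim a b e) \sum_(nu < ldim a f d)
    q a * F al be mu nu * Fi al be' mu' nu
  = ([&& c == c', (be == be' :> nat) & (mu == mu' :> nat)])%:R
      * (wt e * wt f / (dD c)%:C%C).
Proof.
have [h hE] := average_dual
  (br' mu \oc tnth (br b c' f) mu').
have := average_Fsum be be' mu mu'; rewrite hE.
case: eqVneq be be' mu mu' h hE => [->|cc] be be' mu mu' h hE /=; last first.
  rewrite mul0r [h]smp_disjoint 1?eq_sym // (bm0r RL) cmp0r cmp0l => /esym/eqP.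
  rewrite scaler_eq0 (negbTE (simple_neq0 (smp_simple d))) orbF.
  by rewrite mulf_eq0 invr_eq0 (negbTE (wt_neq0 e)) => /eqP.
have [z zE] := simple_scal (smp_simple c') h.
have FE d1 e1 (be1 be2 : 'I_(rdim e1 c' d1)) :
    \sum_a \sum_(al < ldim a b e1) \sum_(nu < ldim a f d1)
      q a * F al be1 mu nu * Fi al be2 mu' nu = wt e1 * (z * (be1 == be2)%:R).
  apply: (mulfI (invr_neq0 (wt_neq0 e1))); apply: (scale_idI (smp_simple d1)).
  rewrite -average_Fsum hE zE (bmZr RL) (bm1 RL) cmpZr cmpm1 cmpZl brP.
  by rewrite scalerA mulKf ?wt_neq0.
move=> _; rewrite FE.
suff -> : z = (mu == mu')%:R * (wt f / (dD c')%:C%C).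
  rewrite -[(be == be' :> nat)]/(be == be') -[(mu == mu' :> nat)]/(mu == mu').
  by rewrite -mulnb natrM; ring.
have dD0 : (dD c')%:C%C != 0 :> R[i].
  have := dD_gt0 dD_FPdim e c'.
  by rewrite -ltcR => /gt_eqF ->.
apply: (mulIf dD0); apply: (mulIf (wt_neq0 d)).
(* The diagonal coefficients are summed over all [e1] and [be1]. By [FE] and [sum_rdim] the total is
   [z * dD c' * wt d]; by [sum_FFi] and [sum_ldim] it is [wt f * wt d] if [mu = mu'], and zero
   otherwise. *)
transitivity (\sum_e1 \sum_(be1 < rdim e1 c' d)
  \sum_a \sum_(al < ldim a b e1) \sum_(nu < ldim a f d)
      q a * F al be1 mu nu * Fi al be1 mu' nu).
  under [RHS]eq_bigr => e1 _.
    under eq_bigr do rewrite FE eqxx mulr1.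
    rewrite sumr_const card_ord -mulr_natl mulrA [_%:R * _]mulrC.
    over.
  have wE : \sum_(e1 : irr M) wt e1 * (rdim e1 c' d)%:R = (dD c')%:C%C * wt d.
    have := congr1 (real_complex R)
      (sum_rdim dD_FPdim e c' d).
    rewrite rmorphM rmorph_sum /= => <-.
    by apply: eq_bigr => e1 _; rewrite rmorphM rmorph_nat.
  by rewrite /= -mulr_suml wE -mulrA mulrC.
transitivity (\sum_a q a * ((ldim a f d)%:R * (mu == mu')%:R)).
  under eq_bigr do rewrite exchange_big.
  rewrite exchange_big; apply: eq_bigr => a _ /=.
  rewrite -[X in X%:R * _]card_ord -sumr_const mulr_suml mulr_sumr.
  under [RHS]eq_bigr => nu _ do rewrite mul1r -(sum_FFi mu mu' nu) mulr_sumr.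
  rewrite [RHS]exchange_big; apply: eq_bigr => e1 _ /=.
  rewrite exchange_big /=.
  under eq_bigr do rewrite exchange_big /=.
  rewrite exchange_big /=; apply: eq_bigr => nu _; rewrite mulr_sumr.
  apply: eq_bigr => al _; rewrite mulr_sumr.
  by apply: eq_bigr => be1 _; rewrite mulrA.
under eq_bigr do rewrite mulrA.
rewrite -mulr_suml sum_ldim.
rewrite [_%:R * (_ / _)]mulrA divfK //.
by rewrite mulrC mulrA.
Qed.

End Orthogonality.
End Dimensions.
End ModuleCategory.

Local Open Scope complex_scope.

Theorem theorem2 (R : realType) (C D : ufuscat R) (M : ubimod C D)
    (M_indecomposable : indecomposable (ub_str M))
    (D_dual : is_dual_category (ub_str M))
    (M_invertible : invertible (ub_str M))
    (dC : irr C -> R) (dD : irr D -> R) (dM : irr M -> R)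
    (dC_FPdim : is_FPdim dC) (dD_FPdim : is_FPdim dD)
    (dM_dim : is_module_dim dC dM)
    (bl : lbasis M) (br : rbasis M) (bases : are_bases bl br)
    (F Fi : fsymbol M) (F_symbol : is_Fsymbol bl br F)
    (Fi_inverse : is_inverse_Fsymbol F Fi) (F_unitary : unitary_Fsymbol F Fi)
    (c c' : irr D) (b d e f : irr M)
    (be : 'I_(rdim e c d)) (be' : 'I_(rdim e c' d))
    (mu : 'I_(rdim b c f)) (mu' : 'I_(rdim b c' f)) :
  \sum_(a : irr C) \sum_(al < ldim a b e) \sum_(nu < ldim a f d)
    (dC a)%:C * F a b c d e f al be mu nu * Fi a b c' d e f al be' mu' nu
  = ([&& c == c', (be == be' :> nat) & (mu == mu' :> nat)])%:R
      * (dM e * dM f / dD c)%:C.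
Proof.
rewrite fmorph_div rmorphM /=.
rewrite -(Fsymbol_orthogonality dC_FPdim dM_dim D_dual dD_FPdim bases F_symbol
  Fi_inverse).
by apply: eq_bigr => a _; rewrite (stdqE dC_FPdim e).
Qed.
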